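(* There are uncountably many non-elementary type-preserving representations $\rho:\pi_1(\Sigma_{0,4})\rightarrow PSL(2,\mathbb R)$ with relative Euler class $e(\rho)=\pm1$ that send every non-peripheral simple closed curve to a hyperbolic element of $PSL(2,\mathbb R)$. In particular, these representations are not Fuchsian.
   Context: $\Sigma_{0,4}$ is the oriented sphere with four punctures. A peripheral element of $\pi_1(\Sigma_{0,4})$ is one represented by a curve freely homotopic to a circle around a single puncture. A representation $\rho:\pi_1(\Sigma_{0,4})\to PSL(2,\mathbb R)$ is type-preserving if it sends every (non-trivial) peripheral element to a parabolic element; it is non-elementary if its image is Zariski-dense in $PSL(2,\mathbb R)$; it is Fuchsian if it is discrete and faithful. A non-peripheral simple closed curve is a simple closed curve that is neither null-homotopic nor freely homotopic to a circle around one puncture; its $\rho$-image is well defined up to conjugation and inversion. Relative Euler class: $e(\rho)=\frac1{2\pi}\int_{\Sigma_{0,4}}(D_\rho)^*\omega$, where $\omega$ is the hyperbolic area form and $D_\rho:\widetilde{\Sigma_{0,4}}\to\mathbb H^2$ is a piecewise smooth $\rho$-equivariant map (pseudo-developing map) which sends each lift of a puncture to the fixed point in $\partial\mathbb H^2$ of the $\rho$-image of the corresponding peripheral subgroup. Equivalently: write $\pi_1(\Sigma_{0,4})=\langle c_1,\dots,c_4\mid c_1c_2c_3c_4=1\rangle$ with $c_i$ going once counterclockwise around the $i$-th puncture, let $\tilde c_i$ be the lift of $\rho(c_i)$ to the universal cover of $PSL(2,\mathbb R)$ having fixed points on the universal cover of $\partial\mathbb H^2$; then $\tilde c_1\tilde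 c_2\tilde c_3\tilde c_4=z^{e(\rho)}$, where $z$ is the generator of the centre given by translation by one positive full turn. One has $|e(\rho)|\leqslant 2$. *)

(* Defs.v *)
From HB Require Import structures.
From mathcomp Require Import all_boot all_order all_algebra all_fingroup.
From mathcomp Require Import generic_quotient ring lra.
From mathcomp Require Import all_classical all_reals all_analysis homotopy.
From mathcomp Require mpoly.
Set Implicit Arguments.
Unset Strict Implicit.
Unset Printing Implicit Defensive.
Import Order.TTheory GRing.Theory Num.Theory.
Import numFieldNormedType.Exports.
Local Open Scope classical_set_scope.
Local Open Scope ring_scope.
Local Open Scope quotient_scope.

Section pasting.
Context {R : realType} {X Y : topologicalType}.

Lemma pasting (h : X -> R) (c : R) (F G : X -> Y) :
  continuous h -> continuous F -> continuous G ->
  (forall x, h x = c -> F x = G x) ->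
  continuous (fun x => if h x <= c then F x else G x).
Proof.
move=> hc Fc Gc FG.
have cl : closed [set x | h x <= c].
  apply: (@preimage_closed _ _ h [set y | y <= c]); last exact: closed_le.
  by move=> x _; exact: hc.
have cg : closed [set x | c <= h x].
  apply: (@preimage_closed _ _ h [set y | c <= y]); last exact: closed_ge.
  by move=> x _; exact: hc.
apply/continuous_subspace_setT.
have -> : [set: X] = [set x | h x <= c] `|` [set x | c <= h x].
  by apply/seteqP; split=> // x _; have [|/ltW] := leP (h x) c; [left|right].
apply: withinU_continuous => //.
- apply: (@subspace_eq_continuous _ _ _ F).
    by move=> x /set_mem /= hx; rewrite /from_subspace hx.
  exact: continuous_subspaceT.
- apply: (@subspace_eq_continuous _ _ _ G).
    move=> x /set_mem /= ch; rewrite /from_subspace; case: ifP => // hx.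
    by rewrite FG //; apply/eqP; rewrite eq_le hx ch.
  exact: continuous_subspaceT.
Qed.

End pasting.

Section unit_interval.
Variable R : realType.

Definition unit_itv : Type := [set x : R | 0 <= x <= 1].
Local Notation I := unit_itv.
HB.instance Definition _ := Topological.on unit_itv.

Lemma clamp_subproof (x : R) : [set x : R | 0 <= x <= 1] (Num.max 0 (Num.min 1 x)).
Proof. by rewrite /= le_max lexx /= ge_max ler01 ge_min lexx. Qed.

Definition clamp (x : R) : I :=
  exist _ (Num.max 0 (Num.min 1 x)) (mem_set (clamp_subproof x)).

Lemma I01 (t : I) : 0 <= val t <= 1.
Proof. exact: set_mem (valP t). Qed.

Lemma clampE (x : R) : 0 <= x <= 1 -> val (clamp x) = x.
Proof. by move=> /andP[x0 x1]; rewrite /= (min_idPr x1) (max_idPr x0). Qed.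

Lemma clampK (t : I) : clamp (val t) = t.
Proof. by apply/val_inj; rewrite clampE ?I01. Qed.

Lemma I_val_continuous : continuous (fun t : I => val t).
Proof. exact: initial_continuous. Qed.

Lemma clamp_continuous : continuous clamp.
Proof.
have cc (c : R) : continuous (fun _ : R => c) by move=> ?; exact: cvg_cst.
apply: (@continuous_comp_initial I R R (fun t : I => val t)) => x.
apply: (@continuous_max R R (fun=> 0) (fun x => Num.min 1 x)); first exact: cc.
apply: (@continuous_min R R (fun=> 1) id); first exact: cc.
exact: cvg_id.
Qed.

Lemma I_neq01 : clamp 0 != clamp 1.
Proof.
apply/eqP => /(congr1 val); rewrite !clampE ?lexx ?ler01 //.
by move/eqP; rewrite eq_sym oner_eq0.
Qed.

HB.instance Definition _ := @isBiPointed.Build unit_itv (clamp 0) (clamp 1) I_neq01.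

End unit_interval.

Lemma fst_continuous (X Y : topologicalType) : continuous (@fst X Y).
Proof. by move=> x; exact: cvg_fst. Qed.

Lemma snd_continuous (X Y : topologicalType) : continuous (@snd X Y).
Proof. by move=> x; exact: cvg_snd. Qed.

Lemma comp_continuous (X Y Z : topologicalType) (f : X -> Y) (g : Y -> Z) :
  continuous f -> continuous g -> continuous (g \o f).
Proof. by move=> cf cg x; apply: continuous_comp; [exact: cf|exact: cg]. Qed.

Lemma pair_continuous (X Y Z : topologicalType) (f : X -> Y) (g : X -> Z) :
  continuous f -> continuous g -> continuous (fun x => (f x, g x)).
Proof. by move=> cf cg x; apply: cvg_pair; [exact: cf|exact: cg]. Qed.

Section continuity.
Variables (R : realType) (S : topologicalType).
Implicit Types f g : S -> R.

Lemma add_continuous f g : continuous f -> continuous g ->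
  continuous (fun x => f x + g x).
Proof. by move=> cf cg x; apply: cvgD; [exact: cf|exact: cg]. Qed.

Lemma sub_continuous f g : continuous f -> continuous g ->
  continuous (fun x => f x - g x).
Proof. by move=> cf cg x; apply: cvgB; [exact: cf|exact: cg]. Qed.

Lemma mul_continuous f g : continuous f -> continuous g ->
  continuous (fun x => f x * g x).
Proof. by move=> cf cg x; apply: cvgM; [exact: cf|exact: cg]. Qed.

End continuity.

Section fundamental_group.
Variables (R : realType) (T : topologicalType) (x0 : T).
Local Notation I := (unit_itv R).

Definition loop : Type := {path I from x0 to x0 in T}.
HB.instance Definition _ := Choice.on loop.

Definition loop_fun (a : loop) : I -> T := a.

Definition mkloop (f : I -> T) (cf : continuous f)
  (f0 : f zero = x0) (f1 : f one = x0) : loop := mk_path cf f0 f1.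

Lemma loop_continuous (a : loop) : continuous (loop_fun a).
Proof. exact: cts_fun. Qed.

Lemma loop0 (a : loop) : loop_fun a zero = x0. Proof. exact: path_zero. Qed.

Lemma loop1 (a : loop) : loop_fun a one = x0. Proof. exact: path_one. Qed.

Definition homotopic (a b : loop) : Prop :=
  exists H : I * I -> T,
    [/\ continuous H,
        forall t, H (zero, t) = loop_fun a t,
        forall t, H (one, t) = loop_fun b t &
        forall s, H (s, zero) = x0 /\ H (s, one) = x0].

Lemma val_zero : val (zero : I) = 0.
Proof. by rewrite clampE ?lexx ?ler01. Qed.

Lemma val_one : val (one : I) = 1.
Proof. by rewrite clampE ?lexx ?ler01. Qed.

Lemma clamp_comp_continuous (X : topologicalType) (f : X -> R) :
  continuous f -> continuous (fun x => clamp (f x)).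
Proof. by move=> cf; apply: comp_continuous cf (@clamp_continuous R). Qed.

Lemma affine_continuous (X : topologicalType) (f : X -> I) (m c : R) :
  continuous f -> continuous (fun x => m * val (f x) + c).
Proof.
move=> cf x; apply: cvgD; last exact: cvg_cst.
apply: cvgMr.
exact: (comp_continuous cf (@I_val_continuous R)).
Qed.

Definition affI (m c : R) (t : I) : I := clamp (m * val t + c).

Lemma affI_continuous (X : topologicalType) (f : X -> I) (m c : R) :
  continuous f -> continuous (fun x => affI m c (f x)).
Proof. by move=> cf; exact/clamp_comp_continuous/affine_continuous. Qed.

Lemma affI0 (m c : R) (t : I) : m * val t + c <= 0 -> affI m c t = zero.
Proof.
move=> h; apply/val_inj; rewrite val_zero /= (min_idPr _) ?(max_idPl _) //.
exact: le_trans ler01.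
Qed.

Lemma affI1 (m c : R) (t : I) : 1 <= m * val t + c -> affI m c t = one.
Proof.
move=> h; apply/val_inj; rewrite val_one /= (min_idPl _) ?(max_idPr _) //.
Qed.

Lemma half_continuous (X : topologicalType) (h : X -> I) (F G : X -> T) :
  continuous h -> continuous F -> continuous G ->
  (forall x, val (h x) = 2^-1 -> F x = G x) ->
  continuous (fun x => if val (h x) <= 2^-1 then F x else G x).
Proof.
move=> ch; apply: (@pasting _ _ _ (fun x => val (h x))).
exact: (comp_continuous ch (@I_val_continuous R)).
Qed.

Lemma homotopic_refl (a : loop) : homotopic a a.
Proof.
exists (loop_fun a \o snd); split=> //=.
  exact: comp_continuous (@snd_continuous _ _) (@loop_continuous a).
by move=> _; rewrite loop0 loop1.
Qed.

Lemma homotopic_sym (a b : loop) : homotopic a b -> homotopic b a.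
Proof.
move=> [H [cH Ha Hb Hs]].
exists (fun p => H (affI (-1) 1 p.1, p.2)); split=> [|t|t|s]; cbn [fst snd].
- apply: comp_continuous cH; apply: pair_continuous.
    exact/affI_continuous/fst_continuous.
  exact: snd_continuous.
- by rewrite affI1 // val_zero mulr0 add0r.
- by rewrite affI0 // val_one mulr1 addNr.
- exact: Hs.
Qed.

Lemma homotopic_trans (a b c : loop) :
  homotopic a b -> homotopic b c -> homotopic a c.
Proof.
move=> [H [cH Ha Hb Hs]] [K [cK Kb Kc Ks]].
exists (fun p => if val p.1 <= 2^-1 then H (affI 2 0 p.1, p.2)
                 else K (affI 2 (-1) p.1, p.2)); split=> [|t|t|s]; cbn [fst snd].
- apply: half_continuous.
  + exact: fst_continuous.
  + apply: comp_continuous cH; apply: pair_continuous.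
      exact/affI_continuous/fst_continuous.
    exact: snd_continuous.
  + apply: comp_continuous cK; apply: pair_continuous.
      exact/affI_continuous/fst_continuous.
    exact: snd_continuous.
  + move=> [s t]; cbn [fst snd] => s2; rewrite affI1 ?affI0 ?Hb ?Kb //; rewrite ?s2 ?t2; lra.
- by rewrite val_zero invr_ge0 ler0n affI0 // val_zero mulr0 addr0.
- by rewrite val_one ifF ?affI1 ?val_one//; [lra|apply/negbTE; lra].
- by case: ifP.
Qed.

Definition homotopicb (a b : loop) : bool := `[< homotopic a b >].

Lemma homotopicb_refl : reflexive homotopicb.
Proof. by move=> a; exact/asboolP/homotopic_refl. Qed.

Lemma homotopicb_sym : symmetric homotopicb.
Proof.
by move=> a b; apply/asboolP/asboolP; exact: homotopic_sym.
Qed.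

Lemma homotopicb_trans : transitive homotopicb.
Proof.
by move=> b a c /asboolP ab /asboolP bc; exact/asboolP/(homotopic_trans ab).
Qed.

Definition homotopic_equiv :=
  EquivRel homotopicb homotopicb_refl homotopicb_sym homotopicb_trans.

Definition pi1 : Type := {eq_quot homotopic_equiv}.
HB.instance Definition _ := Quotient.on pi1.
HB.instance Definition _ := Choice.on pi1.
HB.instance Definition _ := EqQuotient.on pi1.

Lemma pi_pi1P (a b : loop) : \pi_pi1 a = \pi_pi1 b <-> homotopic a b.
Proof.
split; first by move/eqmodP => /asboolP.
by move=> ab; apply/eqmodP/asboolP.
Qed.

Definition const_loop : loop :=
  @mkloop (cst x0) (@cst_continuous _ _ _) erefl erefl.

Section concat.
Variables a b : loop.

Definition concat_fun (t : I) : T :=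
  if val t <= 2^-1 then loop_fun a (affI 2 0 t)
  else loop_fun b (affI 2 (-1) t).

Lemma concat_continuous : continuous concat_fun.
Proof.
apply: (@half_continuous I id).
- by move=> ?; exact: cvg_id.
- apply: comp_continuous (@loop_continuous a); apply: affI_continuous.
  by move=> ?; exact: cvg_id.
- apply: comp_continuous (@loop_continuous b); apply: affI_continuous.
  by move=> ?; exact: cvg_id.
- by move=> t t2; rewrite affI1 ?affI0 ?loop0 ?loop1 //; rewrite ?s2 ?t2; lra.
Qed.

Lemma concat0 : concat_fun zero = x0.
Proof.
by rewrite /concat_fun val_zero invr_ge0 ler0n affI0 ?loop0 // val_zero; lra.
Qed.

Lemma concat1 : concat_fun one = x0.
Proof.
rewrite /concat_fun val_one ifF ?affI1 ?loop1 ?val_one //; first lra.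
by apply/negbTE; lra.
Qed.

Definition concat : loop := mkloop concat_continuous concat0 concat1.

End concat.

Lemma concatE (a b : loop) (t : I) :
  loop_fun (concat a b) t = if val t <= 2^-1 then loop_fun a (affI 2 0 t)
                            else loop_fun b (affI 2 (-1) t).
Proof. by []. Qed.

Definition rev_loop (a : loop) : loop.
Proof.
apply: (@mkloop (fun t => loop_fun a (affI (-1) 1 t))).
- apply: comp_continuous (@loop_continuous a); apply: affI_continuous.
  by move=> ?; exact: cvg_id.
- by rewrite affI1 ?loop1 // val_zero; lra.
- by rewrite affI0 ?loop0 // val_one; lra.
Defined.

Lemma concat_homotopic (a a' b b' : loop) :
  homotopic a a' -> homotopic b b' -> homotopic (concat a b) (concat a' b').
Proof.
move=> [H [cH Ha Ha' Hs]] [K [cK Kb Kb' Ks]].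
exists (fun p => if val p.2 <= 2^-1 then H (p.1, affI 2 0 p.2)
                 else K (p.1, affI 2 (-1) p.2)); split=> [|t|t|s]; cbn [fst snd].
- apply: half_continuous.
  + exact: snd_continuous.
  + apply: comp_continuous cH; apply: pair_continuous.
      exact: fst_continuous.
    exact/affI_continuous/snd_continuous.
  + apply: comp_continuous cK; apply: pair_continuous.
      exact: fst_continuous.
    exact/affI_continuous/snd_continuous.
  + move=> [s t]; cbn [fst snd] => t2.
    rewrite affI1 ?affI0 ?(proj1 (Ks _)) ?(proj2 (Hs _)) //; rewrite ?s2 ?t2; lra.
- by rewrite Ha Kb.
- by rewrite Ha' Kb'.
- split.
    by rewrite val_zero invr_ge0 ler0n affI0 ?(proj1 (Hs _)) // val_zero; lra.
  rewrite val_one ifF ?affI1 ?(proj2 (Ks _)) ?val_one //; first lra.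
  by apply/negbTE; lra.
Qed.

Lemma reparam_homotopic (c a b : loop) (phi psi : I -> I) :
  continuous phi -> continuous psi ->
  phi zero = psi zero -> phi one = psi one ->
  loop_fun a =1 loop_fun c \o phi -> loop_fun b =1 loop_fun c \o psi ->
  homotopic a b.
Proof.
move=> cphi cpsi e0 e1 ea eb.
pose L (p : I * I) : R := (1 - val p.1) * val (phi p.2) + val p.1 * val (psi p.2).
have cL : continuous L.
  have cv := @I_val_continuous R.
  have c1 : continuous (fun p : I * I => val p.1 : R).
    exact: comp_continuous (@fst_continuous _ _) cv.
  have cf (f : I -> I) : continuous f -> continuous (fun p : I * I => val (f p.2) : R).
    move=> cf; apply: (@comp_continuous _ _ _ (fun p => f p.2)) cv.
    exact: comp_continuous (@snd_continuous _ _) cf.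
  move=> p; apply: cvgD; apply: cvgM; [|exact: cf| |exact: cf].
    by apply: cvgB; [exact: cvg_cst|exact: c1].
  exact: c1.
exists (fun p => loop_fun c (clamp (L p))); split=> [|t|t|s]; cbn [fst snd].
- exact: comp_continuous (clamp_comp_continuous cL) (@loop_continuous c).
- by rewrite ea /L; cbn [fst snd]; rewrite val_zero subr0 mul1r mul0r addr0 clampK.
- by rewrite eb /L; cbn [fst snd]; rewrite val_one subrr mul1r mul0r add0r clampK.
- rewrite /L; cbn [fst snd]; rewrite e0 e1 -!mulrDl !subrK !mul1r !clampK.
  by rewrite -[loop_fun c (psi zero)]eb -[loop_fun c (psi one)]eb loop0 loop1.
Qed.

Definition pi1_one : pi1 := \pi_pi1 const_loop.
Definition pi1_mul (x y : pi1) : pi1 := \pi_pi1 (concat (repr x) (repr y)).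
Definition pi1_inv (x : pi1) : pi1 := \pi_pi1 (rev_loop (repr x)).

Lemma pi_concat (a b : loop) :
  pi1_mul (\pi_pi1 a) (\pi_pi1 b) = \pi_pi1 (concat a b).
Proof.
by apply/pi_pi1P/concat_homotopic; apply/pi_pi1P; rewrite reprK.
Qed.

Lemma cont_id (X : topologicalType) : continuous (fun x : X => x).
Proof. by move=> ?; exact: cvg_id. Qed.

Lemma pi1_mul1 : left_id pi1_one pi1_mul.
Proof.
elim/quotW=> a; rewrite pi_concat; apply/pi_pi1P.
apply: (@reparam_homotopic a _ _ (affI 2 (-1)) id).
- exact/affI_continuous/cont_id.
- exact: cont_id.
- by rewrite affI0 // val_zero; lra.
- by rewrite affI1 // val_one; lra.
- move=> t; rewrite concatE /comp; case: ifP => // t2.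
  by rewrite (@affI0 2 (-1)) ?loop0 //; lra.
- by [].
Qed.

Lemma pi1_1mul : right_id pi1_one pi1_mul.
Proof.
elim/quotW=> a; rewrite pi_concat; apply/pi_pi1P.
apply: (@reparam_homotopic a _ _ (affI 2 0) id).
- exact/affI_continuous/cont_id.
- exact: cont_id.
- by rewrite affI0 // val_zero; lra.
- by rewrite affI1 // val_one; lra.
- move=> t; rewrite concatE /comp; case: ifPn => //; rewrite -ltNge => t2.
  by rewrite (@affI1 2 0) ?loop1 //; lra.
- by [].
Qed.

Lemma affI_val (m c : R) (t : I) : 0 <= m * val t + c <= 1 ->
  val (affI m c t) = m * val t + c.
Proof. exact: clampE. Qed.

Definition tent (t : I) : I :=
  if val t <= 2^-1 then affI 2 0 t else affI (-2) 2 t.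

Lemma pasteI_continuous (m c m' c' r : R) :
  m * r + c = m' * r + c' ->
  continuous (fun t : I => if val t <= r then affI m c t else affI m' c' t).
Proof.
move=> e; apply: pasting.
- exact: I_val_continuous.
- exact/affI_continuous/cont_id.
- exact/affI_continuous/cont_id.
- by move=> t tr; rewrite /affI tr e.
Qed.

Lemma pi1_Vmul : right_inverse pi1_one pi1_inv pi1_mul.
Proof.
move=> x; rewrite -{1}[x]reprK pi_concat; apply/pi_pi1P; set a := repr x.
apply: (@reparam_homotopic a _ _ tent (fun=> zero)).
- by apply: pasteI_continuous; lra.
- exact: cst_continuous.
- by rewrite /tent val_zero invr_ge0 ler0n affI0 // val_zero; lra.
- rewrite /tent val_one ifF; last by apply/negbTE; lra.
  by rewrite affI0 // val_one; lra.
- move=> t; rewrite concatE /comp /tent; case: ifPn => //.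
  rewrite -ltNge => t2; have := I01 t => /andP[t0 t1].
  congr (loop_fun a _); apply: val_inj; rewrite !affI_val ?affI_val; lra.
- by move=> t; rewrite /= loop0.
Qed.

Lemma pi1_mulV : left_inverse pi1_one pi1_inv pi1_mul.
Proof.
move=> x; rewrite -{2}[x]reprK pi_concat; apply/pi_pi1P; set a := repr x.
apply: (@reparam_homotopic a _ _
  (fun t => if val t <= 2^-1 then affI (-2) 1 t else affI 2 (-1) t)
  (fun=> one)).
- by apply: pasteI_continuous; lra.
- exact: cst_continuous.
- by rewrite val_zero invr_ge0 ler0n affI1 // val_zero; lra.
- rewrite val_one ifF; last by apply/negbTE; lra.
  by rewrite affI1 // val_one; lra.
- move=> t; rewrite concatE /comp; case: ifPn => //.
  move=> t2; have := I01 t => /andP[t0 t1].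
  congr (loop_fun a _); apply: val_inj; rewrite !affI_val ?affI_val; lra.
- by move=> t; rewrite /= loop1.
Qed.

Lemma pi1_mulA : associative pi1_mul.
Proof.
elim/quotW=> a; elim/quotW=> b; elim/quotW=> c.
rewrite (pi_concat b c) (pi_concat a b) (pi_concat a) (pi_concat _ c).
apply/pi_pi1P.
pose phi (t : I) : I := if val t <= 2^-1 then affI 2^-1 0 t else
  (fun u : I => if val u <= 3 / 4 then affI 1 (- 4^-1) u else affI 2 (-1) u) t.
apply: (@reparam_homotopic (concat (concat a b) c) _ _ phi id).
- apply: pasting.
  + exact: I_val_continuous.
  + exact/affI_continuous/cont_id.
  + by apply: pasteI_continuous; lra.
  + by move=> t t2; rewrite t2 ifT; [rewrite /affI t2; congr clamp|]; lra.
- exact: cont_id.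
- by rewrite /phi val_zero invr_ge0 ler0n affI0 // val_zero; lra.
- rewrite /phi val_one ifF; last by apply/negbTE; lra.
  rewrite ifF; last by apply/negbTE; lra.
  by rewrite affI1 // val_one; lra.
- move=> t; have /andP[t0 t1] := I01 t.
  rewrite /comp [LHS]concatE [RHS]concatE.
  have [t2|t2] := leP (val t) 2^-1.
    have vp : val (phi t) = 2^-1 * val t by rewrite /phi t2 affI_val; lra.
    have -> : val (phi t) <= 2^-1 by rewrite vp; lra.
    have e2 : affI 2 0 (phi t) = t.
      by apply: val_inj; rewrite affI_val vp; lra.
    by rewrite concatE e2 t2.
  have v2 : val (affI 2 (-1) t) = 2 * val t - 1 by rewrite affI_val; lra.
  have [t4|t4] := leP (val t) (3 / 4).
    have vp : val (phi t) = val t - 4^-1.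
      by rewrite /phi ifF ?ifT ?affI_val; try lra; apply/negbTE; lra.
    have -> : val (phi t) <= 2^-1 by rewrite vp; lra.
    have e2 : val (affI 2 0 (phi t)) = 2 * val t - 2^-1.
      by rewrite affI_val vp; lra.
    rewrite !concatE v2 e2 ifT; last lra.
    rewrite ifF; last by apply/negbTE; lra.
    congr (loop_fun b _); apply: val_inj.
    by rewrite (@affI_val 2 0) ?v2 ?(@affI_val 2 (-1)) ?e2; lra.
  have ep : phi t = affI 2 (-1) t.
    by rewrite /phi ifF ?ifF //; apply/negbTE; lra.
  rewrite ep concatE v2 ifF; last by apply/negbTE; lra.
  by rewrite ifF //; apply/negbTE; lra.
- by [].
Qed.

HB.instance Definition _ := isGroup.Build pi1
  pi1_mulA pi1_mul1 pi1_1mul pi1_mulV pi1_Vmul.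

End fundamental_group.

Section psl2.
Variable R : realType.

Definition SL2 : Type := [set A : 'M[R]_2 | \det A = 1].
HB.instance Definition _ := Topological.on SL2.

Lemma SL2_det (A : SL2) : \det (val A) = 1.
Proof. exact: set_mem (valP A). Qed.

Lemma SL2_unit (A : SL2) : val A \in unitmx.
Proof. by rewrite unitmxE SL2_det unitr1. Qed.

Definition mkSL2 (A : 'M[R]_2) (hA : \det A = 1) : SL2 :=
  exist _ A (@mem_set _ [set A : 'M[R]_2 | \det A = 1] _ hA).

Definition sl2_one : SL2 := mkSL2 (det1 _ _).

Lemma sl2_mul_subproof (A B : SL2) : \det (val A *m val B) = 1.
Proof. by rewrite det_mulmx !SL2_det mulr1. Qed.

Definition sl2_mul (A B : SL2) : SL2 := mkSL2 (sl2_mul_subproof A B).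

Lemma sl2_inv_subproof (A : SL2) : \det (invmx (val A)) = 1.
Proof. by rewrite det_inv SL2_det invr1. Qed.

Definition sl2_inv (A : SL2) : SL2 := mkSL2 (sl2_inv_subproof A).

Definition psl2_eq (A B : SL2) : bool :=
  (val A == val B) || (val A == - val B).

Lemma psl2_eq_refl : reflexive psl2_eq.
Proof. by move=> A; rewrite /psl2_eq eqxx. Qed.

Lemma psl2_eq_sym : symmetric psl2_eq.
Proof.
by move=> A B; rewrite /psl2_eq eq_sym -eqr_oppLR [- _ == _]eq_sym.
Qed.

Lemma psl2_eq_trans : transitive psl2_eq.
Proof.
move=> B A C; rewrite /psl2_eq => /orP[]/eqP -> /orP[]/eqP ->;
  by rewrite ?opprK eqxx ?orbT.
Qed.

Definition psl2_equiv :=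
  EquivRel psl2_eq psl2_eq_refl psl2_eq_sym psl2_eq_trans.

Definition PSL2 : Type := {eq_quot psl2_equiv}.
HB.instance Definition _ := Topological.copy PSL2 (quotient_topology PSL2).
HB.instance Definition _ := Quotient.on PSL2.
HB.instance Definition _ := Choice.on PSL2.
HB.instance Definition _ := EqQuotient.on PSL2.

Definition psl2_one : PSL2 := \pi_PSL2 sl2_one.
Definition psl2_mul (g h : PSL2) : PSL2 := \pi_PSL2 (sl2_mul (repr g) (repr h)).
Definition psl2_inv (g : PSL2) : PSL2 := \pi_PSL2 (sl2_inv (repr g)).

Lemma pi_PSL2P (A B : SL2) :
  \pi_PSL2 A = \pi_PSL2 B <-> val A = val B \/ val A = - val B.
Proof.
split; first by move/eqmodP => /orP[]/eqP; [left|right].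
by move=> h; apply/eqmodP/orP; case: h => ->; [left|right].
Qed.

Lemma pi_SL2M (A B : SL2) : psl2_mul (\pi_PSL2 A) (\pi_PSL2 B) = \pi_PSL2 (sl2_mul A B).
Proof.
apply/pi_PSL2P => /=.
have /pi_PSL2P[->|->] : \pi_PSL2 (repr (\pi_PSL2 A)) = \pi_PSL2 A by rewrite reprK.
- have /pi_PSL2P[->|->] : \pi_PSL2 (repr (\pi_PSL2 B)) = \pi_PSL2 B by rewrite reprK.
    by left.
  by right; rewrite mulmxN.
- have /pi_PSL2P[->|->] : \pi_PSL2 (repr (\pi_PSL2 B)) = \pi_PSL2 B by rewrite reprK.
    by right; rewrite mulNmx.
  by left; rewrite mulNmx mulmxN opprK.
Qed.

Lemma psl2_mulA : associative psl2_mul.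
Proof.
elim/quotW=> A; elim/quotW=> B; elim/quotW=> C; rewrite (pi_SL2M B C) (pi_SL2M A B) !pi_SL2M.
by apply/pi_PSL2P; left; rewrite /= mulmxA.
Qed.

Lemma psl2_mul1 : left_id psl2_one psl2_mul.
Proof.
by elim/quotW=> A; rewrite pi_SL2M; apply/pi_PSL2P; left; rewrite /= mul1mx.
Qed.

Lemma psl2_1mul : right_id psl2_one psl2_mul.
Proof.
by elim/quotW=> A; rewrite pi_SL2M; apply/pi_PSL2P; left; rewrite /= mulmx1.
Qed.

Lemma psl2_mulV : left_inverse psl2_one psl2_inv psl2_mul.
Proof.
move=> g; rewrite -{2}[g]reprK pi_SL2M.
by apply/pi_PSL2P; left; rewrite /= mulVmx ?SL2_unit.
Qed.

Lemma psl2_Vmul : right_inverse psl2_one psl2_inv psl2_mul.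
Proof.
move=> g; rewrite -{1}[g]reprK pi_SL2M.
by apply/pi_PSL2P; left; rewrite /= mulmxV ?SL2_unit.
Qed.

HB.instance Definition _ := isGroup.Build PSL2
  psl2_mulA psl2_mul1 psl2_1mul psl2_mulV psl2_Vmul.

Definition psl2_abstr (g : PSL2) : R := `|\tr (val (repr g))|.
Definition hyperbolic (g : PSL2) : Prop := 2 < psl2_abstr g.
Definition parabolic (g : PSL2) : Prop := g <> 1%g /\ psl2_abstr g = 2.

(* Density in PSL2 amounts to density in SL2 of the preimage of S, which is
   stable under A |-> - A. *)
Definition zariski_dense (S : set PSL2) : Prop :=
  forall P : mpoly.mpoly (2 * 2) R,
    (forall A : SL2, S (\pi_PSL2 A) -> mpoly.meval (mxvec (val A) 0) P = 0) ->
    forall A : SL2, mpoly.meval (mxvec (val A) 0) P = 0.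

End psl2.

Section free_homotopy.
Variables (R : realType) (T : topologicalType).
Local Notation I := (unit_itv R).

Definition free_homotopic (a b : I -> T) : Prop :=
  exists H : I * I -> T,
    [/\ continuous H,
        forall t, H (zero, t) = a t,
        forall t, H (one, t) = b t &
        forall s, H (s, zero) = H (s, one)].

Definition null_homotopic (a : I -> T) : Prop :=
  exists x : T, free_homotopic a (cst x).

Definition simple_closed_curve (a : I -> T) : Prop :=
  [/\ continuous a, a zero = a one &
      forall s t : I, a s = a t ->
        [\/ s = t, s = zero /\ t = one | s = one /\ t = zero]].

End free_homotopy.

Section four_punctured_sphere.
Variable R : realType.
Local Notation I := (unit_itv R).

Definition finite_punctures : set (R * R) :=
  [set p | [\/ p = (1, 0), p = (0, 0) | p = (-1, 0)]].

(* The sphere is the plane together with a point at infinity, which is the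
   fourth puncture; the orientation is the standard one of the plane. *)
Definition sphere4 : Type := ~` finite_punctures.
HB.instance Definition _ := Topological.on sphere4.

Lemma basepoint_subproof : (~` finite_punctures) (0, -1).
Proof. by move=> [] []; lra. Qed.

Definition basepoint : sphere4 := exist _ (0, -1) (mem_set basepoint_subproof).

Definition puncture_circle (a : I -> sphere4) : Prop :=
  exists (p : R * R) (r e : R),
    [/\ finite_punctures p /\ 0 < r < 1 \/ p = (0, 0) /\ 1 < r,
        e = 1 \/ e = -1 &
        forall t : I, val (a t) =
          (p.1 + r * cos (2 * pi * val t),
           p.2 + e * (r * sin (2 * pi * val t)))].

Definition peripheral (a : I -> sphere4) : Prop :=
  exists2 b : I -> sphere4, puncture_circle b & free_homotopic a b.

(* Seen from basepoint, petal m w sweeps the directions (u, 1) with u going from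
   m + w to m - w; in the direction (u, 1) it runs through the point
   basepoint + s (u, 1) with s = 2 (1 - ((u - m) / w)^2). The puncture (m, 0) is
   basepoint + (m, 1), so it lies on the inner side s < 2 for u = m. *)
Definition petal_fun (m w t : R) : R * R :=
  (8 * t * (1 - t) * (m + w * (1 - 2 * t)), 8 * t * (1 - t) - 1).

Definition petal_ok (m w : R) : Prop :=
  [/\ 2 * (1 - m) ^+ 2 != w ^+ 2, 2 * (0 - m) ^+ 2 != w ^+ 2 &
      2 * (-1 - m) ^+ 2 != w ^+ 2].

Section petal.
Variables (m w : R) (mw : petal_ok m w).

Lemma petal_avoids (t : R) : (~` finite_punctures) (petal_fun m w t).
Proof.
have key p : petal_fun m w t = (p, 0) -> 2 * (p - m) ^+ 2 = w ^+ 2.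
  move=> [] e1 e2.
  have e3 : 8 * t * (1 - t) = 1 by lra.
  have -> : p = m + w * (1 - 2 * t) by rewrite -e1 e3 mul1r.
  have -> : 2 * (m + w * (1 - 2 * t) - m) ^+ 2 =
    w ^+ 2 * (2 - 8 * t * (1 - t)) by ring.
  by rewrite e3; lra.
by case: mw => /eqP h1 /eqP h2 /eqP h3; case=> /key.
Qed.

Definition petal_map (t : I) : sphere4 :=
  exist _ (petal_fun m w (val t)) (mem_set (@petal_avoids (val t))).

Lemma petal_continuous : continuous petal_map.
Proof.
apply: (@continuous_comp_initial sphere4 I (R * R)%type (fun x => val x)).
have cv : continuous (fun t : I => val t : R) := @I_val_continuous R.
have cc (c : R) : continuous (fun _ : I => c : R) by exact: cst_continuous.
have cS : continuous (fun t : I => 8 * val t * (1 - val t) : R).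
  by apply: mul_continuous; [exact: mul_continuous|exact: sub_continuous].
apply: pair_continuous; last exact: sub_continuous.
apply: mul_continuous => //; apply: add_continuous => //.
apply: mul_continuous => //; apply: sub_continuous => //.
exact: mul_continuous.
Qed.

Lemma petal0 : petal_map zero = basepoint.
Proof.
apply: val_inj; transitivity (petal_fun m w (val (zero : I))) => //.
rewrite val_zero /petal_fun.
by rewrite mulr0 !mul0r sub0r.
Qed.

Lemma petal1 : petal_map one = basepoint.
Proof.
apply: val_inj; transitivity (petal_fun m w (val (one : I))) => //.
rewrite val_one /petal_fun.
by rewrite subrr !mulr0 !mul0r sub0r.
Qed.

Definition petal : loop R basepoint := mkloop petal_continuous petal0 petal1.

End petal.

Lemma petal_ok1 : petal_ok 1 2^-1.
Proof. by split; apply/eqP; lra. Qed.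

Lemma petal_ok2 : petal_ok 0 2^-1.
Proof. by split; apply/eqP; lra. Qed.

Lemma petal_ok3 : petal_ok (-1) 2^-1.
Proof. by split; apply/eqP; lra. Qed.

Lemma petal_ok4 : petal_ok 0 (-2).
Proof. by split; apply/eqP; lra. Qed.

(* c1, c2, c3 go once counterclockwise around (1, 0), (0, 0), (-1, 0), and c4
   once clockwise around these three punctures together, that is
   counterclockwise around infinity. As c1 c2 c3 leaves basepoint to the right and
   comes back from the left, c1 * c2 * c3 * c4 = 1. *)
Definition c1 : pi1 R basepoint := \pi_(pi1 R basepoint) (petal petal_ok1).
Definition c2 : pi1 R basepoint := \pi_(pi1 R basepoint) (petal petal_ok2).
Definition c3 : pi1 R basepoint := \pi_(pi1 R basepoint) (petal petal_ok3).
Definition c4 : pi1 R basepoint := \pi_(pi1 R basepoint) (petal petal_ok4).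

Definition rep : Type := {multiplicative pi1 R basepoint -> PSL2 R}.

Definition rep_image (rho : rep) : set (PSL2 R) := range rho.

Definition type_preserving (rho : rep) : Prop :=
  forall a : loop R basepoint, peripheral (loop_fun a) ->
    parabolic (rho (\pi_(pi1 R basepoint) a)).

Definition non_elementary (rho : rep) : Prop := zariski_dense (rep_image rho).

Definition discrete_rep (rho : rep) : Prop :=
  rep_image rho `<=` isolated (rep_image rho).

Definition fuchsian (rho : rep) : Prop := discrete_rep rho /\ injective rho.

Definition simple_hyperbolic (rho : rep) : Prop :=
  forall g : I -> sphere4,
    simple_closed_curve g -> ~ null_homotopic g -> ~ peripheral g ->
    forall a : loop R basepoint, free_homotopic (loop_fun a) g ->
      hyperbolic (rho (\pi_(pi1 R basepoint) a)).

Definition conjugacy_class (rho : rep) : set rep :=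
  [set rho' : rep | exists g : PSL2 R, forall x, rho' x = (rho x ^ g)%g].

(* The boundary of the upper half-plane is the projective line, [x : y] being
   the boundary point x / y. Through theta |-> [sin theta : cos theta], that is
   x / y = tan theta, its universal cover is R; increasing theta turns
   counterclockwise, and one full turn is the translation by pi. *)
Definition dir (theta : R) : 'cV[R]_2 :=
  \col_i (if i == 0 then sin theta else cos theta).

(* No choice of sign is made in val (repr g): r may be negative. *)
Definition lifts (g : PSL2 R) (f : R -> R) : Prop :=
  continuous f /\
  forall theta, exists r : R,
    val (repr g) *m dir theta = r *: dir (f theta).

Definition parabolic_lift (g : PSL2 R) (f : R -> R) : Prop :=
  lifts g f /\ exists theta, f theta = theta.

(* The relation c1 c2 c3 c4 = 1 lifts to f1 f2 f3 f4 = z^e. A parabolic element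
   has exactly one lift with fixed points, so e is determined by a
   type-preserving rho. *)
Definition relative_euler_class (rho : rep) (e : int) : Prop :=
  exists f1 f2 f3 f4 : R -> R,
    [/\ parabolic_lift (rho c1) f1, parabolic_lift (rho c2) f2,
        parabolic_lift (rho c3) f3, parabolic_lift (rho c4) f4 &
        forall theta, f1 (f2 (f3 (f4 theta))) = theta + e%:~R * pi].

End four_punctured_sphere.

(* Main.v *)
From HB Require Import structures.
From mathcomp Require Import all_boot all_order all_algebra.
From mathcomp Require Import generic_quotient zify ring lra finmap.
From mathcomp Require Import all_classical all_reals all_analysis homotopy.
From mathcomp Require mpoly.
Require Import Defs.
Set Implicit Arguments.
Unset Strict Implicit.
Unset Printing Implicit Defensive.
Import Order.TTheory GRing.Theory Num.Theory.
Import numFieldNormedType.Exports.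
Local Open Scope classical_set_scope.
Local Open Scope ring_scope.
Local Open Scope quotient_scope.

(** The representations form an explicit family [family_rep] with a real parameter [m > 0]. The four
    peripheral generators go to unipotent matrices [gen i], shears of strength [scale m i] along
    explicit vectors, whose product is [-1]. The strengths for [c1], [c2], [c3] are positive and the
    one for [c4] is negative, which is the sign pattern of relative Euler class 1 ([base_turn],
    [family_euler]); the sign [eta] conjugates by a reflection and so gives class -1 as well.

    Hyperbolicity. A non-peripheral simple closed curve separates the punctures two by two, so up to
    conjugation and inversion its class is [c ^ w * c4] with [c] among [c1], [c2], [c3]
    ([simple_word]). The trace of a product of two shears of opposite signs is 2 plus a non-negative
    term that vanishes only if the fixed directions agree. For transcendental [m] they never agree
    ([word_hyperbolic]): after clearing denominators, the image consists of matrices over [Z[m]]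
    that become scalar in [F_2] under [m |-> 1], so the coordinate that would have to vanish is an
    integer polynomial in [m] with an odd value at 1. There are uncountably many transcendental [m],
    and the trace [2 + 4 m] of the image of [c4 * c1] tells the conjugacy classes apart. Zariski
    density holds because [c4] and [c1] go to an upper and a lower unipotent matrix
    ([zariski_dense_shears]).

    The topology behind [simple_word] rests on holonomy. Group elements [k 0], ..., [k 3], attached
    to upward crossings of the four pieces of the real axis between the punctures, define a
    homotopy-invariant transport [hol] ([hol_square]), and suitable labels [kappa] in the
    fundamental group recover the class of a loop ([cls_hol]). A simple closed curve has the
    holonomy, up to conjugation, of a simple cycle in a fine square lattice ([simple_lattice]). A
    discrete Jordan theorem ([jordan_ccw]) writes that holonomy as a product of conjugates of face
    holonomies, one for each enclosed face; only faces around punctures matter, and a keyhole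
    contour gives access to the exterior ([lattice_simple]).

    No such representation is Fuchsian. The odd Euler class forces the trace 2 lifts of the
    generators to multiply to [-1] ([euler_relation]), so the traces x, y, z of the pairwise
    products satisfy x^2 + y^2 + z^2 + xyz = 4 ([cayley_cubic]). If the representation is discrete
    and faithful, Shimizu's lemma ([shimizu]) shows that a trace of absolute value at least 2 has
    absolute value at least 3 ([good_gap]). Starting from the hyperbolic image of [c1 * c2], Vieta
    moves, induced by changes of generators, then lower the largest trace by at least 5 again and
    again, which is absurd ([good_size_ge]). *)

(** * Walks on the square lattice: winding numbers and holonomy *)

Definition vert : Type := (int * int)%type.

Definition rt (v : vert) : vert := (v.1 + 1, v.2).
Definition up (v : vert) : vert := (v.1, v.2 + 1).
Definition dg (v : vert) : vert := (v.1 + 1, v.2 + 1).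

Definition adj (x y : vert) : bool :=
  [|| y == rt x, x == rt y, y == up x | x == up y].

Lemma adj_sym x y : adj x y = adj y x.
Proof. by rewrite /adj orbCA; congr (_ || (_ || _)); rewrite orbC. Qed.

(* Contribution of the step x -> y to the winding number around the face with
   lower left corner f: signed crossings of the ray going west from f. *)
Definition wl (f x y : vert) : int :=
  if (x.1 == y.1) && (x.1 <= f.1) then
    if (x.2 == f.2) && (y.2 == f.2 + 1) then -1
    else if (x.2 == f.2 + 1) && (y.2 == f.2) then 1 else 0
  else 0.

Fixpoint psum (l : vert -> vert -> int) (x : vert) (s : seq vert) : int :=
  if s is y :: s' then l x y + psum l y s' else 0.

Definition csum l (s : seq vert) : int :=
  if s is x :: s' then psum l x (rcons s' x) else 0.

Definition wind (s : seq vert) (f : vert) : int := csum (wl f) s.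

Lemma wl_antisym f x y : wl f y x = - wl f x y.
Proof. by case: x y f => [a b] [c d] [e g]; rewrite /wl /=; do ?case: ifP; lia. Qed.

Lemma wl_refl f x : wl f x x = 0.
Proof. by have := wl_antisym f x x; lia. Qed.

(** A primitive of the difference between the crossings of the ray of [f] and those of the ray one
    row higher; around a closed walk it contributes nothing. *)
Definition colroot (f v : vert) : int := ((v.1 <= f.1) && (v.2 == f.2 + 1))%:Z.

Lemma adj_cases x y : adj x y ->
  [\/ y = (x.1 + 1, x.2), y = (x.1 - 1, x.2),
      y = (x.1, x.2 + 1) | y = (x.1, x.2 - 1)].
Proof.
case: x y => [a b] [c d]; rewrite /adj /rt /up /= => /or4P[] /eqP[-> ->].
- by constructor 1.
- by constructor 2; congr (_, _); lia.
- by constructor 3.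
- by constructor 4; congr (_, _); lia.
Qed.

(** The two rays differ only in the edge from [f] to [up f], which a step avoiding one of its ends
    cannot use. *)
Lemma wl_west f x y p : adj x y -> (p == f) || (p == up f) -> x != p -> y != p ->
  wl (f.1 - 1, f.2) x y = wl f x y.
Proof.
move=> /adj_cases h; case: x y f p h => [a b] [c d] [e g] [i j] h.
rewrite /up /= !xpair_eqE /wl /=.
by move=> hp hx hy; case: h => -[? ?]; subst; do ?case: ifP; lia.
Qed.

(** The crossings of two neighbouring rays differ by what enters and leaves the half-row between
    them. Sideways, that half-row is left only through the edge from [up f] to [dg f], which a step
    avoiding one of its ends cannot use. *)
Lemma wl_north f x y p : adj x y -> (p == up f) || (p == dg f) -> x != p -> y != p ->
  wl (up f) x y = wl f x y + colroot f y - colroot f x.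
Proof.
move=> /adj_cases h; case: x y f p h => [a b] [c d] [e g] [i j] h.
rewrite /up /dg /= !xpair_eqE /wl /colroot /=.
by move=> hp hx hy; case: h => -[? ?]; subst; do ?case: ifP; lia.
Qed.

Lemma psum_cat l x s1 y s2 :
  psum l x (s1 ++ y :: s2) = psum l x (rcons s1 y) + psum l y s2.
Proof. by elim: s1 x => [|z s1 IH] x /=; rewrite ?addr0 // IH addrA. Qed.

Lemma psum_rev l x s y : (forall u v, l v u = - l u v) ->
  psum l y (rcons (rev s) x) = - psum l x (rcons s y).
Proof.
move=> anti; elim: s x => [|z s IH] x /=; first by rewrite !addr0 anti.
by rewrite rev_cons -cats1 cat_rcons psum_cat IH /= anti addr0 opprD addrC.
Qed.

Lemma wind_rot s1 s2 f : wind (s1 ++ s2) f = wind (s2 ++ s1) f.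
Proof.
case: s1 s2 => [|x s1] [|y s2]; rewrite ?cats0 //= /wind /= !rcons_cat /= !psum_cat.
by rewrite addrC.
Qed.

Lemma wind_rev x s f : wind (x :: rev s) f = - wind (x :: s) f.
Proof. exact/psum_rev/wl_antisym. Qed.

Lemma psum_eq l l' (c : vert -> int) x s :
  (forall u v, u \in x :: s -> v \in x :: s -> adj u v -> l' u v = l u v + c v - c u) ->
  path adj x s -> psum l' x s = psum l x s + c (last x s) - c x.
Proof.
move=> ll'; elim: s x ll' => [|y s IH] x ll' /=; first by rewrite add0r subrr.
move=> /andP[xy ys]; rewrite IH //.
  by rewrite ll' ?inE ?eqxx ?orbT //; ring.
by move=> u v us vs; apply: ll'; rewrite inE ?us ?vs orbT.
Qed.

Lemma psum_west f x s p : path adj x s -> (p == f) || (p == up f) ->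
  p \notin x :: s -> psum (wl (f.1 - 1, f.2)) x s = psum (wl f) x s.
Proof.
move=> xs hp ps; rewrite (@psum_eq (wl f) _ (fun=> 0)) ?subr0 ?addr0 //.
  move=> u v us vs uv; rewrite subr0 addr0 (wl_west uv hp) //.
    by apply: contraNneq ps => <-.
  by apply: contraNneq ps => <-.
Qed.

Lemma psum_north f x s p : path adj x s -> (p == up f) || (p == dg f) ->
  p \notin x :: s ->
  psum (wl (up f)) x s = psum (wl f) x s + colroot f (last x s) - colroot f x.
Proof.
move=> xs hp ps; apply: psum_eq => //.
  move=> u v us vs uv; rewrite (wl_north uv hp) //.
    by apply: contraNneq ps => <-.
  by apply: contraNneq ps => <-.
Qed.

Lemma cycle_path_rcons x s : cycle adj (x :: s) -> path adj x (rcons s x).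
Proof. by []. Qed.

Lemma notin_rcons (p x : vert) s : p \notin x :: s -> p \notin x :: rcons s x.
Proof. by rewrite !inE mem_rcons inE !negb_or => /andP[-> ->]. Qed.

Lemma wind_west f C p : cycle adj C -> (p == f) || (p == up f) -> p \notin C ->
  wind C (f.1 - 1, f.2) = wind C f.
Proof.
by case: C => // x s xs hp /notin_rcons ps; exact: psum_west hp ps.
Qed.

Lemma wind_north f C p : cycle adj C -> (p == up f) || (p == dg f) -> p \notin C ->
  wind C (up f) = wind C f.
Proof.
case: C => // x s xs hp /notin_rcons ps.
by rewrite /wind /csum (psum_north xs hp ps) last_rcons addrK.
Qed.

(* The four faces around the vertex p are f such that p is a corner of f. *)
Definition corner (p f : vert) : bool :=
  [|| p == f, p == rt f, p == up f | p == dg f].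

(** The winding number changes only across edges of the cycle, while neighbouring faces around [p]
    are separated by an edge ending at [p]. *)
Lemma wind_corner C p f : cycle adj C -> p \notin C -> corner p f ->
  wind C f = wind C p.
Proof.
move=> cC pC; case/or4P => /eqP e; first by rewrite e.
- have -> : f = (p.1 - 1, p.2) by rewrite e /= addrK -surjective_pairing.
  by rewrite (wind_west cC _ pC) ?eqxx.
- by rewrite [in RHS]e (wind_north cC _ pC) // e eqxx.
- rewrite -(wind_north (f := f) cC _ pC) ?e ?eqxx ?orbT //.
  have -> : up f = ((dg f).1 - 1, (dg f).2) by rewrite /= addrK.
  by rewrite -e (wind_west cC _ pC) ?eqxx.
Qed.

Section lattice_holonomy.
Variables (G : groupType) (T : eqType) (l : T -> T -> G).
Hypothesis lV : forall x y, l y x = ((l x y)^-1)%g.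
Local Open Scope group_scope.

Fixpoint phol (x : T) (s : seq T) : G :=
  if s is y :: s' then l x y * phol y s' else 1.

Definition chol (s : seq T) : G :=
  if s is x :: s' then phol x (rcons s' x) else 1.

Lemma phol_cat x s1 y s2 :
  phol x (s1 ++ y :: s2) = phol x (rcons s1 y) * phol y s2.
Proof. by elim: s1 x => [|z s1 IH] x /=; rewrite ?mulg1 // IH mulgA. Qed.

Lemma phol_rev x s y : phol y (rcons (rev s) x) = (phol x (rcons s y))^-1.
Proof.
elim: s x => [|z s IH] x /=; first by rewrite !mulg1 lV.
by rewrite rev_cons -cats1 cat_rcons phol_cat IH /= mulg1 invgM lV.
Qed.

Lemma chol_rev x s : chol (x :: rev s) = (chol (x :: s))^-1.
Proof. exact: phol_rev. Qed.

Lemma chol_rot s1 s2 : exists g, chol (s1 ++ s2) = (chol (s2 ++ s1)) ^ g.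
Proof.
case: s1 s2 => [|x s1] [|y s2]; try by exists 1; rewrite ?cats0 conjg1.
exists (phol y (rcons s2 x)); rewrite /= !rcons_cat /= !phol_cat.
by rewrite /conjg !mulgA mulVg mul1g.
Qed.

Lemma phol_rcons x s y : phol x (rcons s y) = phol x s * l (last x s) y.
Proof.
by elim: s x => [|z s IH] x /=; rewrite ?mulg1 ?mul1g // IH mulgA.
Qed.

End lattice_holonomy.

(** * A discrete Jordan theorem for simple lattice cycles *)

Section jordan.
Variables (G : groupType) (l : vert -> vert -> G).
Hypothesis l1 : forall x, l x x = 1%g.
Hypothesis lV : forall x y, l y x = ((l x y)^-1)%g.
Local Notation phol := (phol l).
Local Notation chol := (chol l).

Definition face_hol (f : vert) : G := chol [:: f; rt f; dg f; up f].

Fixpoint conj_prod (b : bool) (L : seq vert) (h : G) : Prop :=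
  if L is f :: L' then
    exists g h', h = ((if b then (face_hol f)^-1 else face_hol f) ^ g * h')%g
                 /\ conj_prod b L' h'
  else h = 1%g.

Lemma conj_prodJ b L h g : conj_prod b L h -> conj_prod b L (h ^ g)%g.
Proof.
elim: L h => [|f L IH] h /=; first by move=> ->; rewrite conj1g.
by case=> g' [h' [-> /IH h'P]]; exists (g' * g)%g, (h' ^ g)%g; rewrite conjMg conjgM.
Qed.

Lemma conj_prodV b L h : conj_prod b L h -> conj_prod (~~ b) L (h^-1)%g.
Proof.
elim: L h => [|f L IH] h /=; first by move=> ->; rewrite invg1.
case=> g [h' [-> /IH h'P]]; exists (g * h')%g, (h'^-1)%g; split=> //.
rewrite conjgM; set c := (if b then _ else _); rewrite -/c.
have -> : (if ~~ b then (face_hol f)^-1 else face_hol f)%g = (c^-1)%g.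
  by rewrite /c; case: b {IH h'P c} => //=; rewrite invgK.
by rewrite conjVg [(_ ^ h')%g]/conjg invgM -!mulgA mulgV mulg1.
Qed.

Lemma conj_prod_cat b L1 L2 h1 h2 :
  conj_prod b L1 h1 -> conj_prod b L2 h2 -> conj_prod b (L1 ++ L2) (h1 * h2)%g.
Proof.
elim: L1 h1 => [|f L IH] h1 /=; first by move=> -> ?; rewrite mul1g.
case=> g [h' [-> h'P]] h2P; exists g, (h' * h2)%g; rewrite mulgA; split=> //.
exact: IH.
Qed.

(** The Jordan theorem in the form needed here: [L] is the interior, [b] says that the cycle runs
    clockwise, and since [L] has no repetition every interior face contributes exactly one conjugate
    to the holonomy. *)
Definition enclosed (C : seq vert) (b : bool) (L : seq vert) : Prop :=
  [/\ uniq L, forall f, wind C f = if f \in L then (if b then -1 else 1) else 0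
    & conj_prod b L (chol C)].

Definition jordan (C : seq vert) : Prop := exists b L, enclosed C b L.

Lemma jordan_rot s1 s2 : jordan (s1 ++ s2) -> jordan (s2 ++ s1).
Proof.
case=> b [L [uL wL cL]]; exists b, L; split=> // [f|]; first by rewrite wind_rot wL.
by have [g ->] := chol_rot l s2 s1; exact: conj_prodJ.
Qed.

Lemma jordan_rev x s : jordan (x :: rev s) -> jordan (x :: s).
Proof.
case=> b [L [uL wL cL]]; exists (~~ b), L; split=> // [f|].
  rewrite -[LHS]opprK -wind_rev wL; case: ifP => _; last by rewrite oppr0.
  by case: b {wL cL} => //=; rewrite opprK.
by move/conj_prodV: cL; rewrite chol_rev // invgK.
Qed.

Lemma jordan_small C : (size C <= 2)%N -> jordan C.
Proof.
case: C => [|x [|y [|]]] //= _; exists false, [::]; split=> //=.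
- by move=> f /=; rewrite /wind /= addr0 wl_refl.
- by rewrite mulg1 l1.
- by move=> f; rewrite /wind /= addr0 wl_antisym; lia.
- by rewrite mulg1 lV mulVg.
Qed.

End jordan.

Lemma up_neq v : up v != v.
Proof. by case: v => a b; rewrite xpair_eqE /=; lia. Qed.

Lemma psum_rcons l x s y : psum l x (rcons s y) = psum l x s + l (last x s) y.
Proof. by elim: s x => [|z s IH] x /=; rewrite ?addr0 ?add0r // IH addrA. Qed.

Lemma wind_face v f : wind [:: v; rt v; dg v; up v] f = (f == v)%:Z.
Proof.
case: v f => [a b] [c d]; rewrite /wind /= /wl /rt /up /dg /= xpair_eqE.
by do ?case: ifP; lia.
Qed.

Lemma psum_below x s f : (forall u, u \in x :: s -> f.2 < u.2) -> psum (wl f) x s = 0.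
Proof.
elim: s x => [//|y s IH] x h /=; rewrite IH; last first.
  by move=> u us; apply: h; rewrite inE us orbT.
have hx := h x (mem_head _ _); have hy : f.2 < y.2 by apply: h; rewrite !inE eqxx orbT.
rewrite /wl; move: hx hy {IH h}; move: (x.1) (x.2) (y.1) (y.2) (f.1) (f.2) => a b c d e g.
by do ?case: ifP; lia.
Qed.

Lemma wind_below C f : (forall u, u \in C -> f.2 < u.2) -> wind C f = 0.
Proof.
case: C => // x s h; apply: psum_below => u.
by rewrite inE mem_rcons inE => /or3P[/eqP->|/eqP->|us]; apply: h; rewrite inE ?eqxx ?us ?orbT.
Qed.

Lemma psum_west_left x s f : (forall u, u \in x :: s -> f.1 < u.1) -> psum (wl f) x s = 0.
Proof.
elim: s x => [//|y s IH] x h /=; rewrite IH; last first.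
  by move=> u us; apply: h; rewrite inE us orbT.
have hx := h x (mem_head _ _).
rewrite /wl; move: hx {IH h}; move: (x.1) (x.2) (y.1) (y.2) (f.1) (f.2) => a b c d e g.
by do ?case: ifP; lia.
Qed.

Lemma wind_left C f : (forall u, u \in C -> f.1 < u.1) -> wind C f = 0.
Proof.
case: C => // x s h; apply: psum_west_left => u.
by rewrite inE mem_rcons inE => /or3P[/eqP->|/eqP->|us]; apply: h; rewrite inE ?eqxx ?us ?orbT.
Qed.

(** One of the faces around [v] lies below the whole cycle, hence has winding number 0, and the
    faces around an avoided vertex all have the same winding number. *)
Lemma wind_avoid C v f : cycle adj C -> v \notin C -> (forall u, u \in C -> v.2 <= u.2) ->
  corner v f -> wind C f = 0.
Proof.
move=> cC vC low vf; rewrite (wind_corner cC vC vf).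
rewrite -(@wind_corner _ _ (v.1, v.2 - 1) cC vC); last first.
  by rewrite /corner /up /= subrK -surjective_pairing eqxx !orbT.
by apply: wind_below => u /low /=; lia.
Qed.

Lemma corner0 v : corner v v. Proof. by rewrite /corner eqxx. Qed.

Lemma wind_adj C x y : cycle adj C -> x \notin C -> y \notin C -> adj x y ->
  wind C y = wind C x.
Proof.
move=> cC xC yC /or4P[]/eqP e.
- by rewrite -(wind_corner cC yC (f := x)) // /corner e eqxx orbT.
- by rewrite -(wind_corner cC xC (f := y)) // /corner e eqxx orbT.
- by rewrite -(wind_corner cC yC (f := x)) // /corner e eqxx !orbT.
- by rewrite -(wind_corner cC xC (f := y)) // /corner e eqxx !orbT.
Qed.

Lemma wind_spread C x s : cycle adj C -> path adj x s ->
  (forall y, y \in x :: s -> y \notin C) -> wind C x = 0 ->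
  forall y f, y \in x :: s -> corner y f -> wind C f = 0.
Proof.
move=> cC; elim: s x => [|z s IH] x /=.
  by move=> _ h w0 y f; rewrite inE => /eqP-> xf; rewrite (wind_corner cC _ xf) // h ?mem_head.
move=> /andP[xz zs] h w0 y f; rewrite inE => /orP[/eqP->|ys] yf.
  by rewrite (wind_corner cC _ yf) // h ?mem_head.
apply: (IH z) ys yf => // [u us|]; first by apply: h; rewrite inE us orbT.
by rewrite (wind_adj cC _ _ xz) // h // !inE eqxx ?orbT.
Qed.

(** The faces [v] and [rt v] are separated by the closing edge of the cycle, from [dg v] down to
    [rt v]. A simple cycle of more than two vertices uses this edge only once, so the winding
    numbers differ by 1. *)
Lemma wind_jump_west v t : uniq (rt v :: t) -> cycle adj (rt v :: t) ->
  last (rt v) t = dg v -> (1 < size t)%N ->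
  wind (rt v :: t) (rt v) = wind (rt v :: t) v + 1.
Proof.
case: t => [//|y [//|z t]] u; set t' := z :: t => cy e _.
have /andP[ry yt] : adj (rt v) y && path adj y (rcons t' (rt v)) := cy.
have uR : rt v \notin y :: t' by case/andP: u.
have yw : y != dg v.
  case/and3P: u => _ yt' _; apply: contraNneq yt' => ->.
  by rewrite -e /= mem_last.
have rw : rt v != dg v by case: (v) => a b; rewrite xpair_eqE /=; lia.
have vW : v = ((rt v).1 - 1, (rt v).2) by rewrite /= addrK -surjective_pairing.
have lt : last y t' = dg v := e.
have windE f : wind (rt v :: y :: t') f = wl f (rt v) y + psum (wl f) y (rcons t' (rt v)) by [].
rewrite !windE.
rewrite !psum_rcons lt.
have pt' : path adj y t' by move: yt; rewrite -/(rcons t' _) rcons_path => /andP[].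
have -> : wl v (rt v) y = wl (rt v) (rt v) y.
  by rewrite {1}vW (wl_west (p := dg v)) // /up /rt /dg /= eqxx orbT.
have -> : psum (wl v) y t' = psum (wl (rt v)) y t'.
  by rewrite {1}vW (@psum_west (rt v) y t' (rt v)) // eqxx.
have -> : wl (rt v) (dg v) (rt v) = 1.
  by case: (v) => a b; rewrite /wl /rt /dg /=; do ?case: ifP; lia.
have -> : wl v (dg v) (rt v) = 0.
  by case: (v) => a b; rewrite /wl /rt /dg /=; do ?case: ifP; lia.
by rewrite addr0 addrA.
Qed.

Lemma wind_jump_north v t : uniq (dg v :: t) -> cycle adj (dg v :: t) ->
  last (dg v) t = up v -> (1 < size t)%N ->
  wind (dg v :: t) (up v) = wind (dg v :: t) v + 1.
Proof.
case: t => [//|y [//|z t]] u; set t' := z :: t => cy e _.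
have /andP[ry yt] : adj (dg v) y && path adj y (rcons t' (dg v)) := cy.
have uR : dg v \notin y :: t' by case/andP: u.
have yw : y != up v.
  case/and3P: u => _ yt' _; apply: contraNneq yt' => ->.
  by rewrite -e /= mem_last.
have rw : dg v != up v by case: (v) => a b; rewrite xpair_eqE /=; lia.
have lt : last y t' = up v := e.
have windE f : wind (dg v :: y :: t') f = wl f (dg v) y + psum (wl f) y (rcons t' (dg v)) by [].
rewrite !windE.
rewrite !psum_rcons lt.
have pt' : path adj y t' by move: yt; rewrite -/(rcons t' _) rcons_path => /andP[].
rewrite (wl_north ry (p := up v)) ?eqxx // (psum_north pt' (p := dg v)) ?eqxx ?orbT // lt.
have -> : wl (up v) (up v) (dg v) = 0.
  by case: (v) => a b; rewrite /wl /up /dg /=; do ?case: ifP; lia.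
have -> : wl v (up v) (dg v) = 0.
  by case: (v) => a b; rewrite /wl /up /dg /=; do ?case: ifP; lia.
have -> : colroot v (dg v) = 0.
  by case: (v) => a b; rewrite /colroot /dg /=; lia.
have -> : colroot v (up v) = 1.
  by case: (v) => a b; rewrite /colroot /up /=; lia.
by ring.
Qed.

Lemma wind_spread_last C x s : cycle adj C -> path adj x s ->
  (forall y, y \in x :: s -> y \notin C) -> wind C (last x s) = 0 ->
  forall y f, y \in x :: s -> corner y f -> wind C f = 0.
Proof.
move=> cC xs h w0 y f ys; have e : last x s :: rev (belast x s) =i x :: s.
  by move=> z; rewrite [in RHS]lastI mem_rcons !inE mem_rev.
apply: (wind_spread (s := rev (belast x s)) cC _ _ w0) => [|z|].
- by rewrite rev_path; move: xs; apply: sub_path => a b; rewrite adj_sym.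
- by rewrite e; exact: h.
- by rewrite e.
Qed.

Lemma left_bound (C : seq vert) : exists m, forall u, u \in C -> m < u.1.
Proof.
elim: C => [|x C [m h]]; first by exists 0.
exists (Num.min m (x.1 - 1)) => u; rewrite inE gt_min => /orP[/eqP->|/h ->//].
by rewrite ltrBlDr ltrDl ltr01 orbT.
Qed.

Section jordan.
Variables (G : groupType) (l : vert -> vert -> G).
Hypothesis l1 : forall x, l x x = 1%g.
Hypothesis lV : forall x y, l y x = ((l x y)^-1)%g.

Lemma enclosed_pos C b L f : enclosed l C b L -> wind C f = 1 -> enclosed l C false L.
Proof.
case: b => // -[uL wL _] w1; exfalso.
by have := wL f; rewrite w1; case: ifP.
Qed.

Lemma enclosed_small C : size C = 2 -> enclosed l C false [::].
Proof.
case: C => [|x [|y [|]]] //= _; split=> //=.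
- by move=> f; rewrite /wind /= addr0 wl_antisym; lia.
- by rewrite mulg1 lV mulVg.
Qed.

Lemma enclosed_rot s1 s2 b L : enclosed l (s1 ++ s2) b L -> enclosed l (s2 ++ s1) b L.
Proof.
case=> [uL wL cL]; split=> // [f|]; first by rewrite wind_rot wL.
by have [g ->] := chol_rot l s2 s1; exact: conj_prodJ.
Qed.

Section corner.
Variables (v : vert) (s : seq vert).
Let C := v :: rt v :: s.
Hypotheses (uC : uniq C) (cC : cycle adj C) (lastC : last (rt v) s = up v).
Hypothesis low : forall u, u \in C -> v.2 <= u.2.

Let pC : path adj (rt v) s.
Proof. by move: cC; rewrite /= rcons_path => /and3P[]. Qed.

Let wind_split (s1 s2 : seq vert) f : s = s1 ++ dg v :: s2 ->
  wind C f = wind (rt v :: rcons s1 (dg v)) f + wind (dg v :: s2) f + (f == v)%:Z.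
Proof.
move=> es; rewrite -wind_face /wind /C es /= !addr0 rcons_cat /= psum_cat !psum_rcons.
rewrite !last_rcons (wl_antisym _ (dg v) (rt v)) (wl_antisym _ (up v) (dg v)).
have -> : last (dg v) s2 = up v by rewrite -lastC es last_cat.
ring.
Qed.

Let chol_split (s1 s2 : seq vert) : s = s1 ++ dg v :: s2 ->
  chol l (rt v :: rcons s (v)) = (chol l (rt v :: rcons s1 (dg v)) *
    (chol l (dg v :: s2) ^ l (dg v) (rt v)) * (face_hol l v ^ l v (rt v)))%g.
Proof.
move=> es; rewrite /face_hol /= es !rcons_cat /= phol_cat !phol_rcons !last_rcons mulg1.
have -> : last (dg v) s2 = up v by rewrite -lastC es last_cat.
rewrite /conjg (lV (rt v) (dg v)) (lV (dg v) (up v)) invgK !mulgA.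
by rewrite !(mulgVK, mulgK, mulVg, mulgV, mul1g, mulg1).
Qed.

Let chol_flip : chol l (rt v :: rcons s (v)) =
  ((chol l (dg v :: rt v :: s) ^ l (dg v) (rt v)) * (face_hol l v ^ l v (rt v)))%g.
Proof.
rewrite /face_hol /= !phol_rcons !last_rcons mulg1 lastC.
rewrite /conjg (lV (rt v) (dg v)) (lV (dg v) (up v)) invgK !mulgA.
by rewrite !(mulgVK, mulgK, mulVg, mulgV, mul1g, mulg1).
Qed.

Let wind_flip f : wind C f = wind (dg v :: rt v :: s) f + (f == v)%:Z.
Proof.
rewrite -wind_face /wind /C /= !psum_rcons /= lastC !addr0.
rewrite (wl_antisym _ (dg v) (rt v)) (wl_antisym _ (up v) (dg v)); ring.
Qed.

Let rtNv : v \notin rt v :: s. Proof. by case/andP: uC. Qed.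

Let low' u : u \in rt v :: s -> v.2 <= u.2.
Proof. by move=> us; apply: low; rewrite inE us orbT. Qed.

Let rtNup : rt v != up v.
Proof. by case: (v) => a b; rewrite xpair_eqE /=; lia. Qed.
Let rtNdg : rt v != dg v.
Proof. by case: (v) => a b; rewrite xpair_eqE /=; lia. Qed.
Let upNdg : up v != dg v.
Proof. by case: (v) => a b; rewrite xpair_eqE /=; lia. Qed.
Let vNdg : v != dg v.
Proof. by case: (v) => a b; rewrite xpair_eqE /=; lia. Qed.

Let adj_rt : adj (dg v) (rt v).
Proof. by case: (v) => a b; rewrite /adj /rt /up /dg /= !xpair_eqE; lia. Qed.
Let adj_up : adj (up v) (dg v).
Proof. by case: (v) => a b; rewrite /adj /rt /up /dg /= !xpair_eqE; lia. Qed.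

(** Replacing the corner [v] by the opposite corner [dg v] of its square removes the face [v] from
    the interior. The new cycle still runs counterclockwise: its winding number is 0 at [v], hence 1
    across the edge from [up v] to [dg v]. *)
Lemma jordan_flip : dg v \notin s -> jordan l (dg v :: rt v :: s) ->
  exists L, enclosed l C false L.
Proof.
move=> ws [b [L eL]].
have uC' : uniq (dg v :: rt v :: s).
  by rewrite cons_uniq inE eq_sym (negbTE rtNdg) /= ws; case/andP: uC.
have cC' : cycle adj (dg v :: rt v :: s).
  by rewrite /= adj_rt rcons_path pC lastC adj_up.
have vC' : v \notin dg v :: rt v :: s by rewrite inE (negbTE vNdg).
have low1 u : u \in dg v :: rt v :: s -> v.2 <= u.2.
  by rewrite inE => /orP[/eqP->|/low'//]; rewrite /= lerDl.
have w0 : wind (dg v :: rt v :: s) v = 0 by exact: wind_avoid (corner0 v).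
have size2 : (1 < size (rt v :: s))%N.
  by case: (s) lastC => // e; move: rtNup; rewrite -e eqxx.
have w1 : wind (dg v :: rt v :: s) (up v) = 1.
  by rewrite wind_jump_north // w0.
have {eL} [uL wL cL] := enclosed_pos eL w1.
have vL : v \notin L by have := wL v; rewrite w0; case: ifP.
suff [L' eL'] : exists L', enclosed l (rt v :: rcons s v) false L'.
  by exists L'; move: eL'; rewrite -cats1 -cat_cons => /enclosed_rot.
exists (L ++ [:: v]); split.
- by rewrite cat_uniq uL /= orbF vL.
- move=> f; rewrite -cats1 -cat_cons wind_rot -[wind _ _]/(wind C f) wind_flip wL mem_cat inE.
  by have [->|] := eqVneq f v; rewrite ?(negbTE vL) ?orbT ?orbF ?addr0.
rewrite chol_flip; apply: conj_prod_cat; first exact: conj_prodJ.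
by exists (l v (rt v)), 1%g; rewrite mulg1.
Qed.

(** When the cycle already visits [dg v], cutting off the corner square makes it fall apart at
    [dg v] into two simple cycles. The interior is the disjoint union of theirs and of the face [v];
    the disjointness is the main point. *)
Lemma jordan_split s1 s2 : s = s1 ++ dg v :: s2 ->
  jordan l (rt v :: rcons s1 (dg v)) -> jordan l (dg v :: s2) ->
  exists L, enclosed l C false L.
Proof.
move=> es [b1 [L1 eL1]] [b2 [L2 eL2]].
set C1 := rt v :: rcons s1 (dg v); set C2 := dg v :: s2.
have eC : rt v :: s = C1 ++ s2 by rewrite es /C1 /= cat_rcons.
have eC' : rt v :: s = (rt v :: s1) ++ C2 by rewrite es.
have u12 : uniq (C1 ++ s2) by rewrite -eC; case/andP: uC.
have u21 : uniq ((rt v :: s1) ++ C2) by rewrite -eC'; case/andP: uC.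
have uC1 : uniq C1 by move: u12; rewrite cat_uniq => /andP[].
have uC2 : uniq C2 by move: u21; rewrite cat_uniq => /and3P[].
have lC2 : last (dg v) s2 = up v by rewrite -lastC es last_cat.
have p1 : path adj (rt v) (rcons s1 (dg v)).
  by move: pC; rewrite es -cat_rcons cat_path => /andP[].
have p2 : path adj (dg v) s2.
  by move: pC; rewrite es -cat_rcons cat_path last_rcons => /andP[].
have cC1 : cycle adj C1 by rewrite /C1 /= rcons_path p1 last_rcons adj_rt.
have cC2 : cycle adj C2 by rewrite /C2 /= rcons_path p2 lC2 adj_up.
have sub1 u : u \in C1 -> u \in rt v :: s by rewrite eC mem_cat => ->.
have sub2 u : u \in C2 -> u \in rt v :: s by rewrite eC' mem_cat => ->; rewrite orbT.
have v1 : v \notin C1 by apply: contra rtNv => /sub1.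
have v2 : v \notin C2 by apply: contra rtNv => /sub2.
have low1 u : u \in C1 -> v.2 <= u.2 by move/sub1/low'.
have low2 u : u \in C2 -> v.2 <= u.2 by move/sub2/low'.
have w10 : wind C1 v = 0 by exact: wind_avoid (corner0 v).
have w20 : wind C2 v = 0 by exact: wind_avoid (corner0 v).
(* The induction hypothesis does not tell how the pieces are oriented. This is read off from the
   winding number 1 just across the edge of the corner square that closes the piece; a piece with
   two vertices encloses nothing. *)
have {b1 L1 eL1} [L1 eL1] : exists L1, enclosed l C1 false L1.
  case: (eqVneq s1 [::]) => [e|n0]; first by exists [::]; apply: enclosed_small; rewrite /C1 e.
  exists L1; apply: enclosed_pos eL1 (_ : wind C1 (rt v) = 1).
  rewrite wind_jump_west ?w10 ?last_rcons //.
  by case: (s1) n0 => // a s1'; rewrite size_rcons.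
have {b2 L2 eL2} [L2 eL2] : exists L2, enclosed l C2 false L2.
  case: s2 es lC2 @C2 cC2 uC2 eC eC' u12 u21 p2 sub2 v2 low2 w20 eL2 => [|a [|b s2]] es lC2 C2 cC2 uC2 eC eC' u12 u21 p2 sub2 v2 low2 w20 eL2.
  - by move: upNdg; rewrite -lC2 eqxx.
  - by exists [::]; apply: enclosed_small.
  exists L2; apply: enclosed_pos eL2 (_ : wind C2 (up v) = 1).
  by rewrite wind_jump_north ?w20.
case: eL1 => uL1 wL1 cL1; case: eL2 => uL2 wL2 cL2.
have vL1 : v \notin L1 by have := wL1 v; rewrite w10; case: ifP.
have vL2 : v \notin L2 by have := wL2 v; rewrite w20; case: ifP.
(* away from the common vertex dg v, each of C1 and C2 lies outside the other *)
have out1 y f : y \in C2 -> y != dg v -> corner y f -> wind C1 f = 0.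
  case: s2 es lC2 @C2 cC2 uC2 eC eC' u12 u21 p2 sub2 v2 low2 w20 cL2 wL2 => [|a s2].
    by move=> _ e; move: upNdg; rewrite -e eqxx.
  move=> es lC2 C2 cC2 uC2 eC eC' u12 u21 /andP[_ p2] sub2 v2 low2 w20 cL2 wL2 yC2 yw.
  have d12 z : z \in a :: s2 -> z \notin C1.
    move=> zs; apply: contraL zs => zC1; move: u12; rewrite cat_uniq.
    by case/and3P=> _ /hasPn h _; apply: contraL zC1 => /h.
  apply: (wind_spread_last cC1 p2 d12); last by move: yC2; rewrite inE (negbTE yw).
  have -> : last a s2 = up v := lC2.
  rewrite -(@wind_corner _ _ v cC1) ?w10 //; last by rewrite /corner eqxx !orbT.
  by apply: d12; rewrite -lC2 /= mem_last.
have out2 y f : y \in C1 -> y != dg v -> corner y f -> wind C2 f = 0.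
  move=> yC1 yw.
  have d21 z : z \in rt v :: s1 -> z \notin C2.
    move=> zs; move: u21; rewrite cat_uniq.
    by case/and3P=> _ /hasPn h _; apply: contraL zs => /h.
  have p1' : path adj (rt v) s1 by move: p1; rewrite rcons_path => /andP[].
  apply: (wind_spread cC2 p1' d21); last first.
    by move: yC1; rewrite /C1 -rcons_cons mem_rcons inE (negbTE yw).
  rewrite -(@wind_corner _ _ v cC2) ?w20 //; last by rewrite /corner eqxx !orbT.
  by rewrite d21 ?mem_head.
have [m hm] := left_bound (rt v :: s).
(* Let both pieces enclose [g]. Neither can contain both ends of the west edge of [g]: one of these
   ends is not [dg v], so its adjacent faces lie outside the other piece. Hence the face to the west
   is again enclosed by both, and moving west ends up left of all vertices, where winding numbers
   vanish. *)
have disj f : f \in L1 -> f \notin L2.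
  suff h n g : g.1 - m <= n%:Z -> wind C1 g = 1 -> wind C2 g = 1 -> False.
    move=> f1; apply/negP => f2; apply: (h `|f.1 - m|%N f); first by rewrite abszE ler_norm.
      by rewrite wL1 f1.
    by rewrite wL2 f2.
  elim: n g => [|n IH] g gn g1 g2.
    move: g1; rewrite wind_left // => u /sub1 us.
    by rewrite (le_lt_trans _ (hm _ us)) // -subr_le0.
  have key D D' (cD : cycle adj D) : wind D' g = 1 ->
      (forall y f, y \in D -> y != dg v -> corner y f -> wind D' f = 0) ->
      wind D (g.1 - 1, g.2) = wind D g.
    move=> wg out; case gD: (g \in D); last by rewrite (wind_west cD (p := g)) ?eqxx ?gD.
    case ugD: (up g \in D); last by rewrite (wind_west cD (p := up g)) ?eqxx ?orbT ?ugD.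
    case: (eqVneq g (dg v)) => [e|ne]; last by move: (out _ g gD ne (corner0 _)); rewrite wg.
    suff ne : up g != dg v.
      by have := out _ g ugD ne; rewrite wg /corner eqxx !orbT => /(_ isT).
    by rewrite -e up_neq.
  apply: (IH (g.1 - 1, g.2)); first by rewrite /= addrAC lerBlDr -[1]/(1%:Z) -PoszD addn1.
    by rewrite (key C1 C2).
  by rewrite (key C2 C1).
suff [L' eL'] : exists L', enclosed l (rt v :: rcons s v) false L'.
  by exists L'; move: eL'; rewrite -cats1 -cat_cons => /enclosed_rot.
exists ((L1 ++ L2) ++ [:: v]); split.
- rewrite cat_uniq cat_uniq uL1 uL2 /= !orbF mem_cat negb_or vL1 vL2 !andbT.
  by apply/hasPn => f fL2; apply: contraL fL2 => /disj.
- move=> f; rewrite -cats1 -cat_cons wind_rot -[wind _ _]/(wind C f) (wind_split _ es) wL1 wL2 !mem_cat inE.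
  have [->|_] := eqVneq f v; first by rewrite (negbTE vL1) (negbTE vL2).
  rewrite addr0 orbF; have := @disj f; case: ifP => _ /=; last by rewrite add0r.
  by move=> /(_ isT)/negbTE->; rewrite addr0.
rewrite (chol_split es); apply: conj_prod_cat.
  by apply: conj_prod_cat => //; exact: conj_prodJ.
by exists (l v (rt v)), 1%g; rewrite mulg1.
Qed.

End corner.
End jordan.

(** A combinatorial form of being simple and counterclockwise: the cycle leaves the leftmost vertex
    of its lowest row to the right and comes back to it from above. *)
Definition ccw_at (v : vert) (s : seq vert) : Prop :=
  [/\ uniq (v :: rt v :: s), cycle adj (v :: rt v :: s), last (rt v) s = up v
    & forall u, u \in v :: rt v :: s -> (v.2 < u.2) || ((v.2 == u.2) && (v.1 <= u.1))].

Lemma lowest_left (C : seq vert) : C != [::] ->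
  exists2 v, v \in C & forall u, u \in C -> (v.2 < u.2) || ((v.2 == u.2) && (v.1 <= u.1)).
Proof.
elim: C => // x [|y C] IH _.
  by exists x => [|u]; rewrite inE ?eqxx // => /eqP->; rewrite eqxx lexx orbT.
have [//|v vC h] := IH.
case: (boolP ((v.2 < x.2) || ((v.2 == x.2) && (v.1 <= x.1)))) => hx.
  exists v => [|u]; first by rewrite inE vC orbT.
  by rewrite inE => /orP[/eqP->//|/h].
exists x; rewrite ?mem_head // => u; rewrite inE => /orP[/eqP->|/h].
  by rewrite eqxx lexx orbT.
move: hx; move: (x.1) (x.2) (v.1) (v.2) (u.1) (u.2) => a b c d e g; lia.
Qed.

Lemma cycle_rev x s : cycle adj (x :: s) -> cycle adj (x :: rev s).
Proof.
move=> cs; rewrite -rev_rcons rev_cycle.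
rewrite (eq_cycle (e' := adj)); last by move=> a b; rewrite adj_sym.
by move: cs; rewrite -(rot_cycle 1) rot1_cons.
Qed.

(** The leftmost vertex of the lowest row has no neighbours on the cycle except the one to the right
    and the one above, so one of the two directions of travel is counterclockwise there. *)
Lemma ccw_exists C : uniq C -> cycle adj C -> (2 < size C)%N ->
  exists v s, ccw_at v s /\
    exists i, rot i C = v :: rt v :: s \/ rot i C = v :: rev (rt v :: s).
Proof.
move=> uC cC sC; have [|v vC low] := @lowest_left C; first by case: (C) sC.
have [i t ev] := rot_to vC.
have ut : uniq (v :: t) by rewrite -ev rot_uniq.
have ct : cycle adj (v :: t) by rewrite -ev rot_cycle.
have lt u : u \in v :: t -> (v.2 < u.2) || ((v.2 == u.2) && (v.1 <= u.1)).
  by rewrite -ev mem_rot; exact: low.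
have st : (2 < size (v :: t))%N by rewrite -ev size_rot.
have nbr u : u \in v :: t -> adj v u -> u = rt v \/ u = up v.
  move=> /lt; case: (v) (u) => [a b] [c d] /= h /adj_cases[] -[e1 e2]; subst.
  - by left.
  - by exfalso; move: h; lia.
  - by right.
  - by exfalso; move: h; lia.
case: t ev ut ct lt st nbr => [//|a [//|z t]] ev ut ct lt st nbr.
have va : adj v a by move: ct => /= /andP[].
have zv : adj v (last z t).
  by move: ct => /= /and3P[_ _]; rewrite rcons_path adj_sym => /andP[].
have az : a != last z t.
  by move: ut => /= /and3P[_ + _]; apply: contraNneq => ->; exact: mem_last.
have la : last z t \in [:: v, a, z & t] by rewrite 2!inE mem_last !orbT.
have aa : a \in [:: v, a, z & t] by rewrite !inE eqxx orbT.
have [ea|ea] := nbr a aa va; have [ez|ez] := nbr _ la zv.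
- by move: az; rewrite ea ez eqxx.
- exists v, (z :: t); split; last by exists i; left; rewrite ev ea.
  by rewrite /ccw_at -ea; split.
- have er : rev (a :: z :: t) = rt v :: rev (a :: belast z t).
    by rewrite [in LHS]lastI rev_rcons /= ez.
  exists v, (rev (a :: belast z t)).
  have mr : v :: rev (a :: z :: t) =i v :: a :: z :: t by move=> u; rewrite !in_cons mem_rev.
  rewrite /ccw_at -er; split; last by exists i; right; rewrite ev revK.
  split.
  + by move: ut; rewrite !cons_uniq rev_uniq mem_rev.
  + exact: cycle_rev.
  + by rewrite rev_cons last_rcons.
  + by move=> u; rewrite mr; exact: lt.
- by move: az; rewrite ea ez eqxx.
Qed.

Section jordan.
Variables (G : groupType) (l : vert -> vert -> G).
Hypothesis l1 : forall x, l x x = 1%g.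
Hypothesis lV : forall x y, l y x = ((l x y)^-1)%g.

(** The measure for the induction. With all coordinates at most [M], replacing [v] by [dg v] brings
    it closer to the corner [(M, M)], and each piece of a split has lost at least the vertex [v],
    which counts because of the successor. *)
Definition weight (M : int) (C : seq vert) : nat :=
  sumn [seq (absz (M - x.1)%R + absz (M - x.2)%R).+1 | x <- C].

Lemma weight_cat M C1 C2 : weight M (C1 ++ C2) = (weight M C1 + weight M C2)%N.
Proof. by rewrite /weight map_cat sumn_cat. Qed.

Lemma weight_cons M x C : weight M (x :: C) = ((absz (M - x.1)%R + absz (M - x.2)%R).+1 + weight M C)%N.
Proof. by []. Qed.

Lemma upper_bound (C : seq vert) : exists M, forall u, u \in C -> u.1 <= M /\ u.2 <= M.
Proof.
elim: C => [|x C [m h]]; first by exists 0.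
exists (Num.max m (Num.max x.1 x.2)) => u; rewrite inE !le_max => /orP[/eqP->|/h[-> ->]//].
by rewrite !lexx !orbT.
Qed.

Lemma weight_perm M C1 C2 : perm_eq C1 C2 -> weight M C1 = weight M C2.
Proof. by move=> e; rewrite /weight (perm_sumn (perm_map _ e)). Qed.

Lemma jordan_reduce C : uniq C -> cycle adj C ->
  (forall v s, ccw_at v s -> perm_eq C (v :: rt v :: s) ->
     exists L, enclosed l (v :: rt v :: s) false L) ->
  jordan l C.
Proof.
move=> uC cC IH.
have [/(jordan_small l1 lV)//|sC] := leqP (size C) 2.
have [v [s [ccw [i ei]]]] := ccw_exists uC cC sC.
have [|L eL] := IH v s ccw.
  rewrite -(perm_rot i); case: ei => ->; rewrite ?perm_refl //.
  by rewrite perm_cons perm_rev.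
have jC : jordan l (v :: rt v :: s) by exists false, L.
have : jordan l (rot i C) by case: ei => ->; [|apply: jordan_rev; rewrite ?revK].
by rewrite /rot => /jordan_rot; rewrite cat_take_drop.
Qed.

(** Induction on [weight], cutting off the square at the corner [v]. The smaller cycles have another
    lowest vertex and unknown orientation, which [jordan_reduce] absorbs by rotating and
    reversing. *)
Theorem jordan_ccw v s : ccw_at v s -> exists L, enclosed l (v :: rt v :: s) false L.
Proof.
have [M] := upper_bound (v :: rt v :: s).
have [n] := ubnP (weight M (v :: rt v :: s)); elim: n v s => // n IH v s wC hM.
case=> us cs ls low.
have low2 u : u \in v :: rt v :: s -> v.2 <= u.2 by move/low; move: (v.1) (v.2) (u.1) (u.2); lia.
have rtM : v.1 + 1 <= M by have [] := hM (rt v); rewrite // !inE eqxx orbT.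
have upM : v.2 + 1 <= M.
  by have [] := hM (up v); rewrite // -ls inE mem_last orbT.
have {}IH C : (forall u, u \in C -> u.1 <= M /\ u.2 <= M) ->
    (weight M C < weight M (v :: rt v :: s))%N -> uniq C -> cycle adj C -> jordan l C.
  move=> CM wM uC cC; apply: jordan_reduce => // v' s' ccw e; apply: IH => //.
    rewrite -(weight_perm M e); rewrite ltnS in wC; exact: leq_trans wC.
  by move=> u; rewrite -(perm_mem e); exact: CM.
have [ws|ws] := boolP (dg v \in s); last first.
  apply: jordan_flip => //; apply: IH.
  - move=> u; rewrite inE => /orP[/eqP->|us']; first by rewrite /=.
    by apply: hM; rewrite inE us' orbT.
  - rewrite !(weight_cons _ v) !(weight_cons _ (dg v)) /=.
    by move: (weight _ _) => k; move: rtM upM {wC hM low low2 us cs ls ws}; move: (v.1) (v.2); lia.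
  - rewrite cons_uniq inE (negbTE ws) orbF (subseq_uniq (subseq_cons _ _) us) andbT.
    by case: (v) => a b; rewrite xpair_eqE /=; lia.
  - move: cs; rewrite /= !rcons_path ls => /and3P[_ -> _] /=.
    by case: (v) => a b; rewrite /adj /rt /up /dg /= !xpair_eqE; lia.
have [s1 [s2 es]] : exists s1 s2, s = s1 ++ dg v :: s2.
  by case: (splitPr ws) => s1 s2; exists s1, s2.
have e1 : rt v :: s = (rt v :: rcons s1 (dg v)) ++ s2 by rewrite es /= cat_rcons.
have e2 : rt v :: s = (rt v :: s1) ++ dg v :: s2 by rewrite es.
have [ps _] : path adj (rt v) s /\ true by move: cs; rewrite /= rcons_path => /and3P[].
have wgt : (weight M (rt v :: s) < weight M (v :: rt v :: s))%N.
  by rewrite (weight_cons _ v) addSn ltnS leq_addl.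
apply: (jordan_split lV us cs ls low2 es); apply: IH.
- by move=> u u1; apply: hM; rewrite inE e1 mem_cat u1 orbT.
- by apply: leq_ltn_trans wgt; rewrite e1 weight_cat leq_addr.
- by move: us; rewrite cons_uniq e1 cat_uniq => /and3P[_ ->].
- move: ps; rewrite es -cat_rcons cat_path => /andP[p1 _].
  rewrite /= rcons_path p1 last_rcons.
  by case: (v) => a b; rewrite /adj /rt /up /dg /= !xpair_eqE; lia.
- by move=> u u1; apply: hM; rewrite inE e2 mem_cat u1 !orbT.
- by apply: leq_ltn_trans wgt; rewrite e2 weight_cat leq_addl.
- by move: us; rewrite cons_uniq e2 cat_uniq => /and4P[].
- move: ps; rewrite es -cat_rcons cat_path last_rcons => /andP[_ p2].
  have l2 : last (dg v) s2 = up v by rewrite -ls es last_cat.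
  rewrite /= rcons_path p2 l2.
  by case: (v) => a b; rewrite /adj /rt /up /dg /= !xpair_eqE; lia.
Qed.

End jordan.

(** * Holonomy of lattice cycles around the three finite punctures *)

Section axis_labels.
Variables (N : nat) (G : groupType) (k : nat -> G).

(* The vertex (a, b) stands for the point ((2a+1)/2N, (2b+1)/2N); col_index is
   the index of the component of the real line minus {-1, 0, 1} below or above it. *)
Definition col_index (a : int) : nat :=
  if a < - N%:Z then 0%N else if a < 0 then 1%N else if a < N%:Z then 2%N else 3%N.

Definition high (v : vert) : bool := 0 <= v.2.

Definition llab (x y : vert) : G :=
  if high x == high y then 1%g
  else if high y then k (col_index y.1) else ((k (col_index x.1))^-1)%g.

Lemma llab1 x : llab x x = 1%g. Proof. by rewrite /llab eqxx. Qed.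

Lemma llabV x y : llab y x = ((llab x y)^-1)%g.
Proof.
by rewrite /llab eq_sym; case: (high x) (high y) => -[] /=; rewrite ?invg1 ?invgK.
Qed.

Lemma phol_flat b x s : (forall u, u \in x :: s -> high u = b) -> phol llab x s = 1%g.
Proof.
elim: s x => [//|y s IH] x h /=; rewrite IH ?mulg1; last first.
  by move=> u us; apply: h; rewrite inE us orbT.
by rewrite /llab !h ?inE ?eqxx ?orbT.
Qed.

(** Inside one component all crossings carry the same label, so the transport is a coboundary and
    telescopes. *)
Lemma phol_col c x s : (forall u, u \in x :: s -> col_index u.1 = c) ->
  phol llab x s =
  ((if high x then k c else 1)^-1 * (if high (last x s) then k c else 1))%g.
Proof.
elim: s x => [|y s IH] x h /=; first by rewrite mulVg.
rewrite IH; last by move=> u us; apply: h; rewrite inE us orbT.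
rewrite /llab !h ?inE ?eqxx ?orbT //.
by case: (high x) (high y) => -[] /=; rewrite ?invg1 ?mul1g ?mulVKg ?mulKg.
Qed.

Lemma phol_app x s1 s2 : phol llab x (s1 ++ s2) = (phol llab x s1 * phol llab (last x s1) s2)%g.
Proof. by elim: s1 x => [|y s1 IH] x /=; rewrite ?mul1g // IH mulgA. Qed.

Lemma face_hol_axis f : face_hol llab f =
  if f.2 == -1 then (k (col_index (f.1 + 1)) * (k (col_index f.1))^-1)%g else 1%g.
Proof.
rewrite /face_hol /= !mulg1 /llab /high /rt /up /dg /= !eqxx mul1g.
case: (f.2 =P -1) => [e|n].
  have -> : 0 <= f.2 + 1 by rewrite e.
  have -> : (0 <= f.2) = false by rewrite e.
  by rewrite /= mul1g.
have -> : (0 <= f.2 + 1) = (0 <= f.2) by move: n; move: (f.2); lia.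
by rewrite eqxx /= !mul1g.
Qed.

End axis_labels.

Definition lf (v : vert) : vert := (v.1 - 1, v.2).
Definition dn (v : vert) : vert := (v.1, v.2 - 1).

Lemma iter_rt n v : iter n rt v = (v.1 + n%:Z, v.2).
Proof. by elim: n => [|n IH]; rewrite ?addr0 -?surjective_pairing //= IH /rt /=; congr (_, _); lia. Qed.

Lemma iter_lf n v : iter n lf v = (v.1 - n%:Z, v.2).
Proof. by elim: n => [|n IH]; rewrite ?subr0 -?surjective_pairing //= IH /lf /=; congr (_, _); lia. Qed.

Lemma iter_up n v : iter n up v = (v.1, v.2 + n%:Z).
Proof. by elim: n => [|n IH]; rewrite ?addr0 -?surjective_pairing //= IH /up /=; congr (_, _); lia. Qed.

Lemma iter_dn n v : iter n dn v = (v.1, v.2 - n%:Z).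
Proof. by elim: n => [|n IH]; rewrite ?subr0 -?surjective_pairing //= IH /dn /=; congr (_, _); lia. Qed.

Definition unit_step (f : vert -> vert) : Prop :=
  exists d : int * int, adj (0, 0) d /\ forall v, f v = (v.1 + d.1, v.2 + d.2).

Lemma step_rt : unit_step rt.
Proof. by exists (1, 0); split=> // -[a b]; rewrite /rt /= addr0. Qed.
Lemma step_lf : unit_step lf.
Proof. by exists (-1, 0); split=> // -[a b]; rewrite /lf /= addr0. Qed.
Lemma step_up : unit_step up.
Proof. by exists (0, 1); split=> // -[a b]; rewrite /up /= addr0. Qed.
Lemma step_dn : unit_step dn.
Proof. by exists (0, -1); split=> // -[a b]; rewrite /dn /= addr0. Qed.

Lemma step_adj f v : unit_step f -> adj v (f v).
Proof.
case=> -[c d] [+ ->]; case: v => a b /adj_cases[] -[-> ->];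
  rewrite /adj /rt /up /= !xpair_eqE; lia.
Qed.

Lemma step_iter f : unit_step f -> exists d : int * int, d != (0, 0) /\
  forall n v, iter n f v = (v.1 + d.1 * n%:Z, v.2 + d.2 * n%:Z).
Proof.
case=> -[c d] [cd fE]; exists (c, d); split.
  by apply/eqP => -[e1 e2]; move: cd; rewrite e1 e2.
elim=> [|n IH] [a b]; first by rewrite /= !mulr0 !addr0.
by rewrite iterS IH fE /=; congr (_, _); lia.
Qed.

Lemma path_traject f v n : unit_step f -> path adj v (traject f (f v) n).
Proof.
move=> sf; apply: sub_path (fpath_traject f v n) => a b /eqP <-; exact: step_adj.
Qed.

Lemma uniq_traject f v n : unit_step f -> uniq (traject f v n).
Proof.
case/step_iter=> -[c d] [cd fE]; elim: n v => //= n IH v; rewrite IH andbT.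
apply/trajectP => -[i _]; rewrite -iterSr fE => /eqP.
rewrite [v in v == _]surjective_pairing xpair_eqE /= => /andP[/eqP e1 /eqP e2].
by move: cd; rewrite xpair_eqE; move: e1 e2; move: (v.1) (v.2); nia.
Qed.

(* The keyhole contour around C: the boundary of the box of half-width M, slit
   along the columns of v and rt v below C, and C traversed backwards. *)
Section keyhole.
Variables (v : vert) (s : seq vert) (M : nat).
Let m : int := M%:Z.
Let n1 := absz (v.1 + M%:Z)%R.
Let n2 := absz (v.2 - 1 + M%:Z)%R.
Let n4 := absz (v.2 + M%:Z)%R.
Let n5 := absz (M%:Z - v.1 - 1)%R.
Let c0 : vert := (- m, - m).
Let c1 : vert := (m, - m).
Let c2 : vert := (m, m).
Let c3 : vert := (- m, m).

Definition keyhole_tail : seq vert :=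
  traject rt (rt c0) n1 ++ (traject up (up (v.1, - m)) n2 ++
  ((v :: rev (rt v :: s)) ++ (traject dn (dn (rt v)) n4 ++
  (traject rt (rt (v.1 + 1, - m)) n5 ++ (traject up (up c1) (M + M) ++
  (traject lf (lf c2) (M + M) ++ traject dn (dn c3) (M + M).-1)))))).

Definition keyhole := c0 :: keyhole_tail.

Hypothesis ccw : ccw_at v s.
Hypothesis inbox : forall u, u \in v :: rt v :: s ->
  [/\ - m < u.1, u.1 < m, - m < u.2 & u.2 < m].

Let vbox : [/\ - m < v.1, v.1 + 1 < m, - m < v.2 & v.2 < m].
Proof.
have [? _ ? ?] := inbox (mem_head _ _).
by have [|_ ? _ _] := @inbox (rt v); rewrite ?inE ?eqxx ?orbT.
Qed.

Let e1 : last c0 (traject rt (rt c0) n1) = (v.1, - m).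
Proof. rewrite last_traject iter_rt /=; congr (_, _); case: vbox; rewrite /n1; lia. Qed.
Let e2 : iter n2 up (v.1, - m) = (v.1, v.2 - 1).
Proof. rewrite iter_up /=; congr (_, _); case: vbox; rewrite /n2; lia. Qed.
Let e3 : last v (rev (rt v :: s)) = rt v.
Proof. by rewrite rev_cons last_rcons. Qed.
Let e4 : iter n4 dn (rt v) = (v.1 + 1, - m).
Proof. rewrite iter_dn /=; congr (_, _); case: vbox; rewrite /n4; lia. Qed.
Let e5 : iter n5 rt (v.1 + 1, - m) = c1.
Proof. rewrite iter_rt /=; congr (_, _); case: vbox; rewrite /n5; lia. Qed.
Let e6 : iter (M + M) up c1 = c2.
Proof. rewrite iter_up /=; congr (_, _); lia. Qed.
Let e7 : iter (M + M) lf c2 = c3.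
Proof. rewrite iter_lf /=; congr (_, _); lia. Qed.
Let e8 : iter (M + M).-1 dn c3 = up c0.
Proof. rewrite iter_dn /up /=; congr (_, _); case: vbox; lia. Qed.

Lemma keyhole_path : path adj c0 keyhole_tail.
Proof.
case: ccw => us cs ls low.
rewrite /keyhole_tail cat_path path_traject ?e1 ?andTb; last exact: step_rt.
rewrite cat_path path_traject ?last_traject ?e2 ?andTb; last exact: step_up.
have pc x y p : path adj x (y :: p) = adj x y && path adj y p by [].
rewrite cat_cons pc; apply/andP; split.
  by rewrite adj_sym; exact: (step_adj v step_dn).
rewrite cat_path e3; apply/andP; split.
  by have /cycle_rev := cs; rewrite /= rcons_path => /andP[].
rewrite cat_path path_traject ?last_traject ?e4 ?andTb; last exact: step_dn.
rewrite cat_path path_traject ?last_traject ?e5 ?andTb; last exact: step_rt.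
rewrite cat_path path_traject ?last_traject ?e6 ?andTb; last exact: step_up.
rewrite cat_path path_traject ?last_traject ?e7 ?andTb; last exact: step_lf.
exact/path_traject/step_dn.
Qed.

Lemma keyhole_last : last c0 keyhole_tail = up c0.
Proof.
by rewrite /keyhole_tail !last_cat last_cons e3 last_traject e4 last_traject e5 last_traject e6
  last_traject e7 last_traject e8.
Qed.

Lemma mem_traj_rt x n y : y \in traject rt (rt x) n -> y.2 = x.2 /\ x.1 < y.1 <= x.1 + n%:Z.
Proof. by case/trajectP=> i lti ->; rewrite -iterSr iter_rt; split=> //=; lia. Qed.
Lemma mem_traj_lf x n y : y \in traject lf (lf x) n -> y.2 = x.2 /\ x.1 - n%:Z <= y.1 < x.1.
Proof. by case/trajectP=> i lti ->; rewrite -iterSr iter_lf; split=> //=; lia. Qed.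
Lemma mem_traj_up x n y : y \in traject up (up x) n -> y.1 = x.1 /\ x.2 < y.2 <= x.2 + n%:Z.
Proof. by case/trajectP=> i lti ->; rewrite -iterSr iter_up; split=> //=; lia. Qed.
Lemma mem_traj_dn x n y : y \in traject dn (dn x) n -> y.1 = x.1 /\ x.2 - n%:Z <= y.2 < x.2.
Proof. by case/trajectP=> i lti ->; rewrite -iterSr iter_dn; split=> //=; lia. Qed.

Lemma uniq_consR (x : vert) p : x \notin p -> uniq p -> uniq (x :: p).
Proof. by move=> /= -> ->. Qed.

Lemma uniq_catR (p q : seq vert) : uniq p -> uniq q -> (forall y, y \in p -> y \in q -> False) ->
  uniq (p ++ q).
Proof.
move=> up uq h; rewrite cat_uniq up uq andbT /=; apply/hasPn => y yq; apply/negP => yp; exact: h yq.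
Qed.

Lemma keyhole_uniq : uniq keyhole.
Proof.
case: ccw => us cs ls low; case: vbox => b1 b2 b3 b4.
have C3 y : y \in v :: rev (rt v :: s) ->
    (- m < y.1 < m) && (- m < y.2 < m) && ((v.2 < y.2) || ((v.2 == y.2) && (v.1 <= y.1))).
  have -> : (y \in v :: rev (rt v :: s)) = (y \in v :: rt v :: s) by rewrite !in_cons mem_rev.
  by move=> yC; have [-> -> -> ->] := inbox yC; exact: low.
have N1 : n1%:Z = v.1 + m by rewrite /n1; lia.
have N2 : n2%:Z = v.2 - 1 + m by rewrite /n2; lia.
have N4 : n4%:Z = v.2 + m by rewrite /n4; lia.
have N5 : n5%:Z = m - v.1 - 1 by rewrite /n5; lia.
have N6 : (M + M)%:Z = m + m by rewrite PoszD.
have N8 : (M + M).-1%:Z = m + m - 1 by rewrite /m; lia.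
have m0 : 0 < m by lia.
have C1 y : y \in traject rt (rt c0) n1 -> y.2 = - m /\ - m < y.1 <= v.1.
  by move/mem_traj_rt; rewrite N1 /=; lia.
have C2 y : y \in traject up (up (v.1, - m)) n2 -> y.1 = v.1 /\ - m < y.2 < v.2.
  by move/mem_traj_up; rewrite N2 /=; lia.
have C4 y : y \in traject dn (dn (rt v)) n4 -> y.1 = v.1 + 1 /\ - m <= y.2 < v.2.
  by move/mem_traj_dn; rewrite N4 /=; lia.
have C5 y : y \in traject rt (rt (v.1 + 1, - m)) n5 -> y.2 = - m /\ v.1 + 1 < y.1 <= m.
  by move/mem_traj_rt; rewrite N5 /=; lia.
have C6 y : y \in traject up (up c1) (M + M) -> y.1 = m /\ - m < y.2 <= m.
  by move/mem_traj_up; rewrite N6 /=; lia.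
have C7 y : y \in traject lf (lf c2) (M + M) -> y.2 = m /\ - m <= y.1 < m.
  by move/mem_traj_lf; rewrite N6 /=; lia.
have C8 y : y \in traject dn (dn c3) (M + M).-1 -> y.1 = - m /\ - m < y.2 < m.
  by move/mem_traj_dn; rewrite N8 /=; lia.
have U3 : uniq (v :: rev (rt v :: s)) by rewrite cons_uniq mem_rev rev_uniq -cons_uniq.
move: b1 b2 b3 b4 m0 C1 C2 C3 C4 C5 C6 C7 C8 U3 {N1 N2 N4 N5 N6 N8 us cs ls low}.
rewrite /keyhole /keyhole_tail.
move: (traject rt (rt c0) n1) (uniq_traject (rt c0) n1 step_rt) => P1 U1.
move: (traject up (up (v.1, - m)) n2) (uniq_traject (up (v.1, - m)) n2 step_up) => P2 U2.
move: (traject dn (dn (rt v)) n4) (uniq_traject (dn (rt v)) n4 step_dn) => P4 U4.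
move: (traject rt (rt (v.1 + 1, - m)) n5) (uniq_traject (rt (v.1 + 1, - m)) n5 step_rt) => P5 U5.
move: (traject up (up c1) (M + M)) (uniq_traject (up c1) (M + M) step_up) => P6 U6.
move: (traject lf (lf c2) (M + M)) (uniq_traject (lf c2) (M + M) step_lf) => P7 U7.
move: (traject dn (dn c3) (M + M).-1) (uniq_traject (dn c3) (M + M).-1 step_dn) => P8 U8.
move: (v :: rev (rt v :: s)) => P3 b1 b2 b3 b4 m0 C1 C2 C3 C4 C5 C6 C7 C8 U3.
clear ccw inbox vbox e1 e2 e3 e4 e5 e6 e7 e8.
apply: uniq_consR.
  rewrite !mem_cat; apply/negP; set y := c0; have h : y = (- m, - m) by [].
  case/or4P=> [/C1|/C2|/C3|/or4P[/C4|/C5|/C6|/orP[/C7|/C8]]]; rewrite h /=;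
    move: b1 b2 b3 b4 m0; clear; move: (v.1) (v.2) (m); lia.
have {}b1 : (- m < v.1) && (v.1 + 1 < m) && (- m < v.2 < m) by rewrite b1 b2 b3 b4.
apply: (uniq_catR U1); last first.
  move=> y /C1 h; rewrite ?mem_cat.
  case/or4P=> [/C2|/C3|/C4|/or4P[/C5|/C6|/C7|/C8]] h'; move: b1 m0 h h'; clear; move: (v.1) (v.2) (y.1) (y.2) (m); lia.
apply: (uniq_catR U2); last first.
  move=> y /C2 h; rewrite ?mem_cat.
  case/or4P=> [/C3|/C4|/C5|/or3P[/C6|/C7|/C8]] h'; move: b1 m0 h h'; clear; move: (v.1) (v.2) (y.1) (y.2) (m); lia.
apply: (uniq_catR U3); last first.
  move=> y /C3 h; rewrite ?mem_cat.
  case/or4P=> [/C4|/C5|/C6|/orP[/C7|/C8]] h'; move: b1 m0 h h'; clear; move: (v.1) (v.2) (y.1) (y.2) (m); lia.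
apply: (uniq_catR U4); last first.
  move=> y /C4 h; rewrite ?mem_cat.
  case/or4P=> [/C5|/C6|/C7|/C8] h'; move: b1 m0 h h'; clear; move: (v.1) (v.2) (y.1) (y.2) (m); lia.
apply: (uniq_catR U5); last first.
  move=> y /C5 h; rewrite ?mem_cat.
  case/or3P=> [/C6|/C7|/C8] h'; move: b1 m0 h h'; clear; move: (v.1) (v.2) (y.1) (y.2) (m); lia.
apply: (uniq_catR U6); last first.
  move=> y /C6 h; rewrite ?mem_cat.
  case/orP=> [/C7|/C8] h'; move: b1 m0 h h'; clear; move: (v.1) (v.2) (y.1) (y.2) (m); lia.
apply: (uniq_catR U7); last first.
  move=> y /C7 h; rewrite ?mem_cat.
  move/C8 => h'; move: b1 m0 h h'; clear; move: (v.1) (v.2) (y.1) (y.2) (m); lia.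
exact: U8.
Qed.

Lemma keyhole_corner u : u \in keyhole -> - m <= u.1 /\ - m <= u.2.
Proof.
case: vbox => b1 b2 b3 b4.
have C3 : u \in v :: rev (rt v :: s) -> (- m < u.1) && (- m < u.2).
  have -> : (u \in v :: rev (rt v :: s)) = (u \in v :: rt v :: s) by rewrite !in_cons mem_rev.
  by move=> /inbox[-> _ -> _].
have N2 : n2%:Z = v.2 - 1 + m by rewrite /n2; lia.
have N4 : n4%:Z = v.2 + m by rewrite /n4; lia.
have N6 : (M + M)%:Z = m + m by rewrite PoszD.
have N8 : (M + M).-1%:Z = m + m - 1 by rewrite /m; move: b1 b2; clear; rewrite /m; lia.
have m0 : 0 < m by move: b1 b2; clear; move: (v.1) (m); lia.
rewrite /keyhole inE => /orP[/eqP->//|]; rewrite /keyhole_tail !mem_cat.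
by case/or4P=> [/mem_traj_rt[+ +]|/mem_traj_up[+ +]|/C3|/or4P[/mem_traj_dn[+ +]|/mem_traj_rt[+ +]
  |/mem_traj_up[+ +]|/orP[/mem_traj_lf[+ +]|/mem_traj_dn[+ +]]]]; rewrite ?N2 ?N4 ?N6 ?N8 /=;
  move: b1 b2 b3 b4 m0; clear; move: (v.1) (v.2) (u.1) (u.2) (m) => a b c d e; lia.
Qed.

Section keyhole_holonomy.
Variables (N : nat) (G : groupType) (k : nat -> G).
Hypotheses (NM : (N < M)%N) (vlow : v.2 < 0).

(** Both sides of the slit lie below the axis and contribute nothing. The box crosses the axis
    upwards on the far right and downwards on the far left, and [C] is traversed backwards. *)
Lemma keyhole_hol : chol (llab N k) keyhole =
  ((chol (llab N k) (v :: rt v :: s))^-1 * k 3 * (k 0)^-1)%g.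
Proof.
case: ccw => us cs ls low; case: vbox => b1 b2 b3 b4.
have N2 : n2%:Z = v.2 - 1 + m by rewrite /n2; lia.
have N6 : (M + M)%:Z = m + m by rewrite PoszD.
have mN : N%:Z < m by rewrite /m ltz_nat.
have m2 : 2 <= m by move: b1 b2; clear; move: (v.1) (m); lia.
have lowE (u : vert) : u.2 < 0 -> high u = false by rewrite /high leNgt => ->.
have low1 x n : x.2 < 0 -> phol (llab N k) x (traject rt (rt x) n) = 1%g.
  move=> x2; apply: (@phol_flat N G k false) => u.
  by rewrite inE => /orP[/eqP->|/mem_traj_rt[e _]]; rewrite lowE ?e.
have H2 : phol (llab N k) (v.1, - m) (traject up (up (v.1, - m)) n2) = 1%g.
  apply: (@phol_flat N G k false) => u; rewrite inE => /orP[/eqP->|/mem_traj_up[_]].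
    by apply: lowE; move: m2; clear; rewrite /=; lia.
  rewrite N2 /= => h; apply: lowE => //; move: h vlow; clear; move: (u.2) (v.2) (m); lia.
have H3 : phol (llab N k) (v.1, v.2 - 1) (v :: rev (rt v :: s)) =
    ((chol (llab N k) (v :: rt v :: s))^-1)%g.
  rewrite -chol_rev; last exact: llabV.
  rewrite /chol phol_rcons e3.
  have lv : high v = false by exact: lowE.
  have -> : llab N k (rt v) v = 1%g by rewrite /llab lv lowE.
  rewrite mulg1 -[LHS]/(llab N k (v.1, v.2 - 1) v * phol (llab N k) v (rev (rt v :: s)))%g.
  rewrite /llab lv lowE ?mul1g //=; move: vlow; clear; move: (v.2); lia.
have H4 : phol (llab N k) (rt v) (traject dn (dn (rt v)) n4) = 1%g.
  apply: (@phol_flat N G k false) => u; rewrite inE => /orP[/eqP->|/mem_traj_dn[_]].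
    exact: lowE.
  move=> /= /andP[_ h]; apply: lowE => //; exact: lt_trans h vlow.
have c1l : high c1 = false by apply: lowE => //; move: m2; clear; rewrite /=; lia.
have hc2 : high c2 by rewrite /high /=; move: m2; clear; lia.
have H6 : phol (llab N k) c1 (traject up (up c1) (M + M)) = k 3.
  rewrite (@phol_col N G k 3) ?last_traject ?e6 ?c1l ?hc2 ?invg1 ?mul1g // => u.
  have cM : col_index N m = 3%N.
    by rewrite /col_index !ifF //; move: m2 mN; clear; lia.
  by rewrite inE => /orP[/eqP->//|/mem_traj_up[-> _]].
have H7 : phol (llab N k) c2 (traject lf (lf c2) (M + M)) = 1%g.
  apply: (@phol_flat N G k true) => u; rewrite inE => /orP[/eqP->//|/mem_traj_lf[e _]].
  by rewrite /high e.
have uc0 : high (up c0) = false by apply: lowE => //; move: m2; clear; rewrite /=; lia.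
have lc0 : high c0 = false by apply: lowE => //; move: m2; clear; rewrite /=; lia.
have H8 : phol (llab N k) c3 (traject dn (dn c3) (M + M).-1) = ((k 0)^-1)%g.
  rewrite (@phol_col N G k 0) ?last_traject ?e8 ?uc0 ?mulg1.
    by have -> : high c3.
  have cM : col_index N (- m) = 0%N.
    by rewrite /col_index ifT //; move: m2 mN; clear; lia.
  by move=> u; rewrite inE => /orP[/eqP->//|/mem_traj_dn[-> _]].
have mneg : - m < 0 by move: m2; clear; lia.
rewrite -[chol _ keyhole]/(phol (llab N k) c0 (rcons keyhole_tail c0)) phol_rcons.
rewrite keyhole_last /keyhole_tail !phol_app e1 last_traject e2 last_cons e3.
rewrite !last_traject e4 last_traject e5 last_traject e6 last_traject e7.
rewrite low1 // H2 H3 H4 low1 // H6 H7 H8 /llab uc0 lc0 eqxx !mul1g mulg1.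
by rewrite mulgA.
Qed.

End keyhole_holonomy.
End keyhole.

(* The additive group of integers, written multiplicatively. *)
Definition intg : Type := int.
HB.instance Definition _ := Choice.on intg.
HB.instance Definition _ := isGroup.Build intg (@addrA int) (@add0r int) (@addr0 int) (@addNr int) (@addrN int).

Lemma intgM (a b : intg) : (a * b)%g = (a + b :> int). Proof. by []. Qed.
Lemma intgV (a : intg) : (a^-1)%g = (- a :> int). Proof. by []. Qed.
Lemma intg1 : (1%g : intg) = (0 :> int). Proof. by []. Qed.

(** The face whose centre is the puncture [(m - 1, 0)]; the shift by [-1] comes from naming a face
    by its lower left corner. *)
Definition mark (N m : nat) : vert := ((m%:Z - 1) * N%:Z - 1, -1).

(** Integer labels with holonomy 1 around [mark N m] and 0 around the other two marks. They make
    winding numbers around punctures a special case of holonomy, so that [keyhole_hol] also computes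
    those of the keyhole. *)
Definition pot (m : nat) (j : nat) : intg := if (j <= m)%N then -1 else 0 : int.

Section lattice_simple.
Variables (N : nat) (G : groupType) (k : nat -> G).
Hypothesis N0 : (0 < N)%N.
Local Notation l := (llab N k).
Definition gap (m : nat) : G := (k m.+1 * (k m)^-1)%g.

Lemma face_mark m : (m < 3)%N -> face_hol l (mark N m) = gap m.
Proof.
case: m => [|[|[|//]]] _; rewrite face_hol_axis /gap /mark /= /col_index;
  do ?case: ifP; lia || by [].
Qed.

Lemma face_unmarked f : (forall m, (m < 3)%N -> f <> mark N m) -> face_hol l f = 1%g.
Proof.
move=> h; rewrite face_hol_axis; case: eqP => // f2.
have [[h0 h1] h2] := (h 0 isT, h 1 isT, h 2 isT).
suff e : col_index N (f.1 + 1) = col_index N f.1 by rewrite e mulgV.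
have neq m : f <> mark N m -> f.1 <> (m%:Z - 1) * N%:Z - 1.
  by move=> ne e; apply: ne; rewrite [f]surjective_pairing f2 e.
move: (neq _ h0) (neq _ h1) (neq _ h2); rewrite /col_index; move: (f.1); clear -N0 => a.
by do ?case: ifP; lia.
Qed.

(** The ray going west from [mark N m] runs along the axis, so its crossings are exactly the axis
    crossings in the components [0], ..., [m], and the equality holds step by step. *)
Lemma wind_chol m C : cycle adj C -> (m < 3)%N ->
  wind C (mark N m) = chol (llab N (pot m)) C.
Proof.
case: C => [//|x s] cC m3.
have h y t : path adj y t -> psum (wl (mark N m)) y t = phol (llab N (pot m)) y t.
  elim: t y => [//|z t IH] y /= /andP[yz zt]; rewrite IH // intgM; congr (_ + _).
  case/adj_cases: yz => ->; rewrite /wl /llab /high /pot /mark /col_index /= ?intg1 ?intgV;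
  case: m m3 {IH zt} => [|[|[|//]]] _; move: (y.1) (y.2) N0; clear => a b;
    do ?case: ifP; lia.
exact: h.
Qed.

Lemma conj_prod_filter b L h : conj_prod l b L h ->
  conj_prod l b [seq f <- L | f \in [:: mark N 0; mark N 1; mark N 2]] h.
Proof.
elim: L h => [//|f L IH] h /= [g [h' [-> /IH h'P]]].
case: ifP => [_|fm]; first by exists g, h'.
rewrite face_unmarked ?invg1 ?if_same ?conj1g ?mul1g //.
by case=> [|[|[|//]]] _ e; move: fm; rewrite e !inE eqxx ?orbT.
Qed.


(* The possible holonomies of a positively oriented simple closed curve, according
   to the number of punctures in its interior: none, one, all three, or two. In the
   last case the curve surrounds infinity and one puncture in the other direction. *)
Definition simple_class (h : G) : Prop :=
  [\/ h = 1%g,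
      exists m g, (m < 3)%N /\ h = (gap m ^ g)%g,
      exists g, h = ((k 3 / k 0) ^ g)%g
    | exists m g g', (m < 3)%N /\ h = ((k 3 / k 0) ^ g * (gap m)^-1 ^ g')%g].

Lemma simple_classJ h g : simple_class h -> simple_class (h ^ g)%g.
Proof.
case=> [->|[m [g' [m3 ->]]]|[g' ->]|[m [g' [g'' [m3 ->]]]]].
- by constructor 1; rewrite conj1g.
- by constructor 2; exists m, (g' * g)%g; rewrite conjgM.
- by constructor 3; exists (g' * g)%g; rewrite conjgM.
- by constructor 4; exists m, (g' * g)%g, (g'' * g)%g; move: (k 3 / k 0)%g => D; rewrite conjMg !conjgM.
Qed.

Lemma vert_bound (C : seq vert) : exists M : nat, (N < M)%N /\
  forall u, u \in C -> [/\ - M%:Z < u.1, u.1 < M%:Z, - M%:Z < u.2 & u.2 < M%:Z].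
Proof.
elim: C => [|x C [M [NM h]]]; first by exists N.+1.
exists (M + absz x.1 + absz x.2).+1; split; first by lia.
move=> u; rewrite inE => /orP[/eqP->|/h[]].
  by move: (x.1) (x.2); clear => a b; split; lia.
by move: (x.1) (x.2) (u.1) (u.2); clear => a b c d; split; lia.
Qed.

Lemma mark_inj m m' : mark N m = mark N m' -> m = m'.
Proof. by case=> e; move: N0 e; clear; nia. Qed.

Lemma conj_prod1 b f h : conj_prod l b [:: f] h ->
  exists g, h = ((if b then (face_hol l f)^-1 else face_hol l f) ^ g)%g.
Proof. by case=> g [h' [-> ->]]; exists g; rewrite mulg1. Qed.

Lemma enclosed_marks C b L : enclosed l C b L -> exists L', [/\ uniq L',
  forall f, (f \in L') = (f \in L) && (f \in [:: mark N 0; mark N 1; mark N 2]) &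
  conj_prod l b L' (chol l C)].
Proof.
case=> uL _ cL; exists [seq f <- L | f \in [:: mark N 0; mark N 1; mark N 2]].
split; [exact: filter_uniq | by move=> f; rewrite mem_filter andbC | exact: conj_prod_filter].
Qed.

(** If the cycle encloses no marked face or one, its own Jordan decomposition gives the class. If it
    encloses two, the keyhole contour around it encloses only the third; if it encloses all three,
    the keyhole encloses none and has trivial holonomy. *)
Lemma ccw_simple v s : ccw_at v s -> simple_class (chol l (v :: rt v :: s)).
Proof.
move=> ccw; have [us cs ls low] := ccw; set C := v :: rt v :: s.
have [L eL] := jordan_ccw (llab1 N k) (llabV N k) ccw.
have [L' [uL' mL' cL']] := enclosed_marks eL.
have Lw m : (m < 3)%N -> wind C (mark N m) = (mark N m \in L)%:Z.
  by move=> _; have [_ -> _] := eL; case: ifP.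
pose a m := mark N m \in L.
have markn m m' : m != m' -> (mark N m == mark N m') = false.
  by move=> ne; apply/eqP => /mark_inj e; move: ne; rewrite e eqxx.
have [none|some] := boolP [&& ~~ a 0, ~~ a 1 & ~~ a 2]%N.
  constructor 1; move: cL'; suff -> : L' = [::] by [].
  case/and3P: none => n0 n1 n2; apply/eqP; rewrite -size_eq0 -leqn0 leqNgt -has_predT.
  apply/negP => /hasP[f + _]; rewrite mL' !inE => /andP[fL /or3P[]] /eqP e; move: fL; rewrite e;
    apply/negP; [exact: n0|exact: n1|exact: n2].
(* Marked faces lie in row [-1], so a cycle that encloses one must reach below the axis; this keeps
   the slit of the keyhole below the axis. *)
have vlow : v.2 < 0.
  apply: contraNT some; rewrite -leNgt => v0.
  have w0 m : (m < 3)%N -> ~~ a m.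
    move=> m3; have := Lw m m3; rewrite wind_below /a; first by case: (_ \in _).
    move=> u /low; move: v0; rewrite /mark /=; move: (v.1) (v.2) (u.1) (u.2); lia.
  by rewrite !w0.
have [M [NM inbox]] := vert_bound C.
have [v1 v2] : v.1 + M%:Z > 0 /\ v.2 > - M%:Z.
  by have [? ? ? ?] := inbox v (mem_head _ _); rewrite -ltrBlDr sub0r.
pose c0 : vert := (- M%:Z, - M%:Z)%R.
have [t et] : exists t, keyhole_tail v s M = rt c0 :: t.
  rewrite /keyhole_tail; case: (absz _) (gtz0_abs v1) => [e|n _]; first by move: v1; rewrite -e.
  by eexists.
have kp := keyhole_path ccw inbox; have kl := keyhole_last inbox.
have ku := keyhole_uniq ccw inbox.
have kC : chol l (c0 :: rt c0 :: t) = ((chol l C)^-1 * k 3 * (k 0)^-1)%g.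
  by rewrite -(keyhole_hol ccw inbox k NM vlow) /keyhole et.
have kcyc : ccw_at c0 t.
  split.
  - by move: ku; rewrite /keyhole et.
  - rewrite /cycle -et rcons_path kp kl -/c0 /=.
    by rewrite /adj /up /= !eqxx !orbT.
  - by move: kl; rewrite et.
  - move=> u uK; have [] := @keyhole_corner _ _ _ inbox u; first by rewrite /keyhole et.
    by rewrite /c0 /=; move: (u.1) (u.2); clear => b c; lia.
have kW m : (m < 3)%N -> wind (c0 :: rt c0 :: t) (mark N m) = 1 - (a m)%:Z.
  move=> m3; rewrite (wind_chol _ m3); last by case: kcyc.
  have -> : c0 :: rt c0 :: t = keyhole v s M by rewrite /keyhole et.
  rewrite (keyhole_hol ccw inbox (pot m) NM vlow) !intgM !intgV -(wind_chol cs m3) Lw //.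
  by rewrite /pot leqNgt m3 leq0n /= /a; case: (_ \in _).
have [K eK] := jordan_ccw (llab1 N k) (llabV N k) kcyc.
have [K' [uK' mK' cK']] := enclosed_marks eK.
have Kw m : (m < 3)%N -> (mark N m \in K) = ~~ a m.
  move=> m3; have := kW m m3; have [_ -> _] := eK.
  by case: (_ \in _); case: (a m).
have one m : (m < 3)%N -> K' = [:: mark N m] -> simple_class (chol l C).
  move=> m3 e; move: cK'; rewrite e => /conj_prod1[g]; rewrite face_mark // kC => h.
  constructor 4; exists m, 1%g, g; split=> //.
  rewrite conjg1 conjVg -h !invgM !invgK !mulgA.
  by rewrite !(mulgVK, mulgK) mulgV mul1g.
have two m : (m < 3)%N -> L' = [:: mark N m] -> simple_class (chol l C).
  move=> m3 e; move: cL'; rewrite e => /conj_prod1[g]; rewrite face_mark // => ->.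
  by constructor 2; exists m, g.
have perm1 (S : seq vert) m : uniq S -> (forall f, (f \in S) = (f == mark N m)) -> S = [:: mark N m].
  move=> uS mS; apply/perm_small_eq => //; apply: uniq_perm => // f; by rewrite mS inE.
have mem3 (S : seq vert) (P : nat -> bool) : (forall f, (f \in S) ->
    f \in [:: mark N 0; mark N 1; mark N 2]) -> (forall i, (i < 3)%N -> (mark N i \in S) = P i) ->
    uniq S -> forall m, (m < 3)%N -> (forall i, (i < 3)%N -> P i = (i == m)) -> S = [:: mark N m].
  move=> S3 SP uS m m3 Pm; apply: perm1 => // f.
  apply/idP/eqP => [fS|->]; last by rewrite SP // Pm // eqxx.
  have := S3 f fS; rewrite !inE => /or3P[]/eqP e; move: fS; rewrite e SP // Pm // => /eqP <- //.
have L3 f : f \in L' -> f \in [:: mark N 0; mark N 1; mark N 2] by rewrite mL' => /andP[].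
have K3 f : f \in K' -> f \in [:: mark N 0; mark N 1; mark N 2] by rewrite mK' => /andP[].
have mm i : (i < 3)%N -> mark N i \in [:: mark N 0; mark N 1; mark N 2].
  by case: i => [|[|[|]]] // _; rewrite !inE eqxx ?orbT.
have La i : (i < 3)%N -> (mark N i \in L') = a i by move=> i3; rewrite mL' mm // andbT.
have Ka i : (i < 3)%N -> (mark N i \in K') = ~~ a i by move=> i3; rewrite mK' mm // andbT Kw.
have pick2 m : (m < 3)%N -> (forall i, (i < 3)%N -> a i = (i == m)) -> simple_class (chol l C).
  by move=> m3 h; apply: (two m m3); exact: (mem3 L' a L3 La uL' m m3 h).
have pick1 m : (m < 3)%N -> (forall i, (i < 3)%N -> ~~ a i = (i == m)) -> simple_class (chol l C).
  by move=> m3 h; apply: (one m m3); exact: (mem3 K' (fun i => ~~ a i) K3 Ka uK' m m3 h).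
case a0: (a 0); case a1: (a 1); case a2: (a 2).
- have K0 : K' = [::].
    case eK' : K' => [//|f K'']; have fK : f \in K' by rewrite eK' mem_head.
    by have := K3 f fK; rewrite !inE => /or3P[]/eqP e; move: fK; rewrite e Ka // ?a0 ?a1 ?a2.
  move: cK'; rewrite K0 kC => h; have {}h : ((chol l C)^-1 * k 3 * (k 0)^-1 = 1)%g := h.
  constructor 3; exists 1%g.
  rewrite conjg1; move/eqP: h; rewrite -mulgA mulg_eq1 => /eqP h.
  by rewrite -[chol l C]invgK h invgK.
- by apply: (pick1 2) => // -[|[|[|]]] //; rewrite ?a0 ?a1 ?a2.
- by apply: (pick1 1) => // -[|[|[|]]] //; rewrite ?a0 ?a1 ?a2.
- by apply: (pick2 0) => // -[|[|[|]]] //; rewrite ?a0 ?a1 ?a2.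
- by apply: (pick1 0) => // -[|[|[|]]] //; rewrite ?a0 ?a1 ?a2.
- by apply: (pick2 1) => // -[|[|[|]]] //; rewrite ?a0 ?a1 ?a2.
- by apply: (pick2 2) => // -[|[|[|]]] //; rewrite ?a0 ?a1 ?a2.
- by move: some; rewrite a0 a1 a2.
Qed.

Theorem lattice_simple C : uniq C -> cycle adj C ->
  simple_class (chol l C) \/ simple_class (chol l C)^-1%g.
Proof.
move=> uC cC; have [s2|s3] := leqP (size C) 2.
  left; constructor 1; case: C s2 {uC cC} => [|x [|y [|]]] //= _; rewrite ?mulg1 ?llab1 //.
  by rewrite llabV mulVg.
have [v [s [ccw [i ei]]]] := ccw_exists uC cC s3.
have [g eg] : exists g, chol l C = (chol l (rot i C) ^ g)%g.
  by rewrite /rot -{1}[C](cat_take_drop i); exact: chol_rot.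
rewrite eg; case: ei => ->.
  by left; apply: simple_classJ; exact: ccw_simple.
right; rewrite chol_rev; last exact: llabV.
by rewrite conjVg invgK; apply: simple_classJ; exact: ccw_simple.
Qed.

End lattice_simple.

(** * Charts of the punctured plane and the holonomy of curves *)

Section lebesgue.
Variable (R : realType).

(** The Lebesgue number lemma with the covering replaced by a property inherited by subsets; this
    form gives uniform continuity as well as subordination to the charts. *)
Lemma lebesgue_number (T : pseudoMetricType R) (K : set T) (Q : set T -> Prop) :
  (forall A B, A `<=` B -> Q B -> Q A) -> compact K ->
  (forall x, K x -> exists2 d : R, 0 < d & Q (ball x d)) ->
  exists2 e : R, 0 < e & forall x, K x -> Q (ball x e).
Proof.
move=> mono /compact_near_coveringP cK loc.
have := cK R (0^'+) (fun e x => Q (ball x e)) _.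
case.
  move=> x Kx; have [d d0 Qd] := loc x Kx.
  exists (ball x (d / 2), [set e : R | 0 < e < d / 2]).
    split=> /=; first by apply: nbhsx_ballx; rewrite divr_gt0.
    near=> e; rewrite /=; apply/andP; split; near: e.
      exact: nbhs_right_gt.
    by apply: nbhs_right_lt; rewrite divr_gt0.
  move=> [y e] /= [xy /andP[e0 ed]]; apply: mono Qd => z yz.
  rewrite [d](splitr d); apply: ball_triangle xy _.
  by apply: le_ball yz; exact: ltW.
move=> e /= e0 h; exists (e / 2); first by rewrite divr_gt0.
move=> x Kx; apply: (h (e / 2)) => //=; rewrite ?divr_gt0 //.
by rewrite sub0r normrN gtr0_norm ?divr_gt0 // ltr_pdivrMr // ltr_pMr // ltr1n.
Unshelve. all: by end_near.
Qed.

End lebesgue.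

Section charts.
Variable (R : realType).
Local Notation pt := (R * R)%type.

(* The punctured plane is covered by six convex sets: the two open half planes
   and the four open vertical strips between the punctures. *)
Definition chart (c : nat) : set pt :=
  match c with
  | 0%N => [set p | p.1 < -1]
  | 1%N => [set p | -1 < p.1 < 0]
  | 2%N => [set p | 0 < p.1 < 1]
  | 3%N => [set p | 1 < p.1]
  | 4%N => [set p | p.2 < 0]
  | _ => [set p | 0 < p.2]
  end.

Lemma chart_sphere4 c p : chart c p -> (~` @finite_punctures R) p.
Proof.
case: p => x y; case: c => [|[|[|[|[|c]]]]]; rewrite /chart /=;
by move=> h [] [e1 e2]; move: h; rewrite ?e1 ?e2; lra.
Qed.

Lemma conv_lt (a b c t : R) : 0 <= t <= 1 -> a < c -> b < c -> (1 - t) * a + t * b < c.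
Proof.
move=> /andP[t0 t1] ac bc; rewrite -subr_gt0.
have -> : c - ((1 - t) * a + t * b) = (1 - t) * (c - a) + t * (c - b) by ring.
have [t2|t2] := lerP t (1 / 2).
  by rewrite ltr_wpDr ?mulr_gt0 ?mulr_ge0; lra.
by rewrite ltr_wpDl ?mulr_gt0 ?mulr_ge0; lra.
Qed.

Lemma conv_gt (a b c t : R) : 0 <= t <= 1 -> c < a -> c < b -> c < (1 - t) * a + t * b.
Proof.
move=> t01 ca cb; rewrite -ltrN2 opprD -!mulrN; apply: conv_lt => //; by rewrite ltrN2.
Qed.

Lemma chart_convex c p q (t : R) : 0 <= t <= 1 -> chart c p -> chart c q ->
  chart c ((1 - t) * p.1 + t * q.1, (1 - t) * p.2 + t * q.2).
Proof.
move=> t01; case: p q => [x y] [x' y']; case: c => [|[|[|[|[|c]]]]]; rewrite /chart /=.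
- exact: conv_lt.
- by move=> /andP[? ?] /andP[? ?]; rewrite conv_lt ?conv_gt.
- by move=> /andP[? ?] /andP[? ?]; rewrite conv_lt ?conv_gt.
- exact: conv_gt.
- exact: conv_lt.
- exact: conv_gt.
Qed.

Lemma chart_cover p : (~` @finite_punctures R) p -> exists c, chart c p.
Proof.
case: p => x y h; have [y0|y0] := ltrP 0 y; first by exists 5%N.
have [y1|y1] := ltrP y 0; first by exists 4%N.
have ey : y = 0 by lra.
have [x1|x1] := ltrP x (-1); first by exists 0%N.
have [x2|x2] := ltrP 1 x; first by exists 3%N.
have [e|n1] := eqVneq x 1; first by exfalso; apply: h; constructor 1; rewrite e ey.
have [e|n0] := eqVneq x 0; first by exfalso; apply: h; constructor 2; rewrite e ey.
have [e|n_] := eqVneq x (-1); first by exfalso; apply: h; constructor 3; rewrite e ey.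
have [x0|x0] := ltrP x 0.
  by exists 1%N; rewrite /chart /= x0 lt_neqAle eq_sym n_ x1.
by exists 2%N; rewrite /chart /= !lt_neqAle eq_sym n0 x0 n1 x2.
Qed.

Lemma chart_open c : open (chart c).
Proof.
have ox (A : set R) : open A -> open [set p : pt | A p.1].
  by move=> oA; apply: open_comp oA => p _; exact: fst_continuous.
have oy (A : set R) : open A -> open [set p : pt | A p.2].
  by move=> oA; apply: open_comp oA => p _; exact: snd_continuous.
have oxx (a b : R) : open [set p : pt | a < p.1 < b].
  have -> : [set p : pt | a < p.1 < b] = [set p | a < p.1] `&` [set p | p.1 < b].
    by apply/seteqP; split=> p /=; [move/andP|case=> -> ->].
  by apply: openI; [apply: (ox [set z | a < z]); exact: open_gt|apply: (ox [set z | z < b]); exact: open_lt].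
case: c => [|[|[|[|[|c]]]]]; rewrite /chart.
- by apply: (ox [set z | z < -1]); exact: open_lt.
- exact: oxx.
- exact: oxx.
- by apply: (ox [set z | 1 < z]); exact: open_gt.
- by apply: (oy [set z | z < 0]); exact: open_lt.
- by apply: (oy [set z | 0 < z]); exact: open_gt.
Qed.

Definition strip (x : R) : nat :=
  if x < -1 then 0%N else if x < 0 then 1%N else if x < 1 then 2%N else 3%N.

Lemma chart_strip c p : (c < 4)%N -> chart c p -> strip p.1 = c.
Proof.
case: p => x y; case: c => [|[|[|[|//]]]]; rewrite /chart /strip //= => _ h;
by do !(case: ltP => //) => *; exfalso; lra.
Qed.

Section transport.
Variables (G : groupType) (k : nat -> G).

(** Points of the real axis count as lower, and the label of a crossing is read off at the upper end
    point. Only for two points of a common chart does this mean transport along a segment. *)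
Definition tau (p q : pt) : G :=
  if (0 < p.2) == (0 < q.2) then 1%g
  else if 0 < q.2 then k (strip q.1) else ((k (strip p.1))^-1)%g.

Lemma tau1 p : tau p p = 1%g. Proof. by rewrite /tau eqxx. Qed.

Lemma tauV p q : tau q p = ((tau p q)^-1)%g.
Proof. by rewrite /tau eq_sym; case: (0 < p.2) (0 < q.2) => -[] /=; rewrite ?invg1 ?invgK. Qed.

(** In a vertical strip all crossings carry the same label [k c], so [tau] is a coboundary there; in
    a half-plane it is trivial. *)
Lemma tau_chart c p q r : chart c p -> chart c q -> chart c r ->
  (tau p q * tau q r)%g = tau p r.
Proof.
have [c4 cp cq cr|c4] := ltnP c 4.
  rewrite /tau !(chart_strip c4 cp) !(chart_strip c4 cq) !(chart_strip c4 cr).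
  by case: (0 < p.2) (0 < q.2) (0 < r.2) => -[] -[] /=; rewrite ?(mulg1, mul1g, mulgV, mulVg).
move=> cp cq cr; have h : ((0 < p.2) = (0 < q.2)) /\ ((0 < q.2) = (0 < r.2)).
  case: c c4 cp cq cr => [|[|[|[|[|c]]]]] // _; rewrite /chart /=; last by move=> -> -> ->.
  by move=> /lt_gtF-> /lt_gtF-> /lt_gtF->.
by rewrite /tau !h.1 !h.2 !eqxx mulg1.
Qed.

Fixpoint tprod (x : nat -> pt) (n : nat) : G :=
  if n is n'.+1 then (tprod x n' * tau (x n') (x n))%g else 1%g.

Lemma tprod_add x m n : tprod x (m + n) = (tprod x m * tprod (fun i => x (m + i)%N) n)%g.
Proof.
elim: n => [|n IH]; rewrite ?addn0 ?mulg1 // addnS /= IH addnS.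
by rewrite mulgA.
Qed.

Lemma eq_tprod x y n : (forall i, (i <= n)%N -> x i = y i) -> tprod x n = tprod y n.
Proof.
elim: n => [//|n IH] h /=; rewrite IH ?h // => i ni; apply: h; exact: leqW.
Qed.

Lemma tprod_chart c x n : (forall i, (i <= n)%N -> chart c (x i)) -> tprod x n = tau (x 0%N) (x n).
Proof.
elim: n => [_|n IH h] /=; first by rewrite tau1.
rewrite IH; last by move=> i ni; apply: h; exact: leqW.
by apply: (tau_chart (c := c)); apply: h.
Qed.

Lemma tprod_block x m n :
  (forall i, (i < n)%N -> tprod (fun j => x (i * m + j)%N) m = tau (x (i * m)%N) (x (i.+1 * m)%N)) ->
  tprod x (n * m) = tprod (fun i => x (i * m)%N) n.
Proof.
elim: n => [//|n IH] h; rewrite mulSnr tprod_add IH; last by move=> i ni; apply: h; exact: leqW.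
by rewrite h.
Qed.

End transport.
End charts.

Section curves.
Variable (R : realType).
Local Notation I := (unit_itv R).
Local Notation pt := (R * R)%type.
Local Notation X := (sphere4 R).

Lemma sphere4_val_continuous : continuous (fun x : X => val x : pt).
Proof. exact: initial_continuous. Qed.

Definition mk4 (p : pt) (h : (~` @finite_punctures R) p) : X := exist _ p (mem_set h).

Lemma sphere4P (x : X) : (~` @finite_punctures R) (val x).
Proof. exact: set_mem (valP x). Qed.

Definition curve (f : I -> X) (r : R) : pt := val (f (clamp r)).

Lemma curve_continuous f : continuous f -> continuous (curve f).
Proof.
move=> cf; apply: (comp_continuous (f := fun r => f (clamp r)) _ sphere4_val_continuous).
exact: comp_continuous (@clamp_continuous R) cf.
Qed.

Lemma inv_nat_lt (e : R) : 0 < e -> exists2 n, (0 < n)%N & (n%:R)^-1 < e.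
Proof.
move=> e0; exists (Num.bound e^-1).+1 => //.
rewrite invf_plt ?posrE //; apply: lt_le_trans (archi_boundP _) _; last by rewrite ler_nat.
by rewrite invr_ge0 ltW.
Qed.

Definition fine (n : nat) (f : I -> X) : Prop :=
  (0 < n)%N /\ forall i, (i < n)%N ->
    exists c, forall r, i%:R / n%:R <= r <= i.+1%:R / n%:R -> chart c (curve f r).

Lemma fine_exists f : continuous f -> exists n, fine n f.
Proof.
move=> /curve_continuous cf.
pose Q (A : set R) := exists c, forall r, A r -> chart c (curve f r).
have [| |e e0 he] := @lebesgue_number R R `[0, 1] Q _ (@segment_compact _ _ _).
- by move=> A B AB [c h]; exists c => r /AB/h.
- move=> r _; have [c hc] := chart_cover (@sphere4P (f (clamp r))).
  have : nbhs r (curve f @^-1` chart c).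
    by apply: cf; apply: open_nbhs_nbhs; split=> //; exact: chart_open.
  by move=> /nbhs_ballP[d d0 hd]; exists d => //; exists c => s /hd.
have [n n0 ne] := inv_nat_lt e0; exists n; split=> // i ltin.
have n0' : 0 < n%:R :> R by rewrite ltr0n.
have [|c hc] := he (i%:R / n%:R).
  by rewrite /= in_itv /= divr_ge0 ?ler0n //= ler_pdivrMr // mul1r ler_nat ltnW.
exists c => r /andP[r1 r2]; apply: hc; rewrite /ball /= distrC ger0_norm ?subr_ge0 //.
apply: le_lt_trans ne; rewrite lerBlDl; apply: le_trans r2 _.
by rewrite -natr1 mulrDl mul1r.
Qed.

Section transport.
Variables (G : groupType) (k : nat -> G).

Definition gridprod (n : nat) (x : R -> pt) : G := tprod k (fun i => x (i%:R / n%:R)) n.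

Lemma fine_mul n m f : fine n f -> (0 < m)%N -> fine (n * m) f.
Proof.
move=> [n0 h] m0; split=> [|i]; first by rewrite muln_gt0 n0.
rewrite -ltn_divLR // => /h[c hc]; exists c => r /andP[r1 r2]; apply: hc.
have m0' : m%:R != 0 :> R by rewrite pnatr_eq0 -lt0n.
have nm0 : 0 < (n * m)%:R :> R by rewrite ltr0n muln_gt0 n0.
have e q : q%:R / n%:R = (q * m)%:R / (n * m)%:R :> R by rewrite !natrM -mulf_div divff // mulr1.
rewrite !e; apply/andP; split.
  by apply: le_trans r1; rewrite ler_pM2r ?invr_gt0 // ler_nat leq_divM.
by apply: (le_trans r2); rewrite ler_pM2r ?invr_gt0 // ler_nat ltn_ceil.
Qed.

Lemma gridprod_mul n m f : fine n f -> (0 < m)%N ->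
  gridprod (n * m) (curve f) = gridprod n (curve f).
Proof.
move=> [n0 h] m0; rewrite /gridprod tprod_block.
  apply: eq_tprod => i _; congr (curve f _).
  have m0' : m%:R != 0 :> R by rewrite pnatr_eq0 -lt0n.
  by rewrite !natrM -mulf_div divff // mulr1.
move=> i ltin; have [c hc] := h i ltin.
rewrite (tprod_chart k (c := c)) ?addn0.
  by rewrite mulSnr.
move=> j jm; apply: hc.
have m0' : m%:R != 0 :> R by rewrite pnatr_eq0 -lt0n.
have nm0 : 0 < (n * m)%:R :> R by rewrite ltr0n muln_gt0 n0.
have e q : q%:R / n%:R = (q * m)%:R / (n * m)%:R :> R by rewrite !natrM -mulf_div divff // mulr1.
by rewrite !e !ler_pM2r ?invr_gt0 // !ler_nat leq_addr mulSnr leq_add2l.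
Qed.

Lemma gridprod_fine n m f : fine n f -> fine m f -> gridprod n (curve f) = gridprod m (curve f).
Proof.
move=> fn fm; rewrite -(gridprod_mul fn (m := m)) ?(proj1 fm) //.
by rewrite mulnC (gridprod_mul fm) // (proj1 fn).
Qed.

(** Some fine subdivision is chosen; one exists for every continuous curve, and by passing to a
    common refinement all of them give the same product ([holE]). *)
Definition hol (f : I -> X) : G := gridprod (xget 1%N [set n | fine n f]) (curve f).

Lemma holE n f : fine n f -> hol f = gridprod n (curve f).
Proof.
move=> fn; rewrite /hol; case: xgetP => [m _ fm|/(_ n)//]; exact: gridprod_fine.
Qed.

End transport.
End curves.

Section homotopy_invariance.
Variable (R : realType).
Local Notation I := (unit_itv R).
Local Notation pt := (R * R)%type.
Local Notation X := (sphere4 R).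
Variables (G : groupType) (k : nat -> G).
Local Notation hol := (hol k).

(** In each small square, which has its corners in one chart, the two ways around agree by
    [tau_chart]; the whole grid follows by adding one square at a time. *)
Lemma tprod_square (z : nat -> nat -> pt) m n :
  (forall i j, (i < n)%N -> (j < m)%N -> exists c,
     [/\ chart c (z i j), chart c (z i.+1 j), chart c (z i j.+1) & chart c (z i.+1 j.+1)]) ->
  (tprod k (z 0%N) m * tprod k (z ^~ m) n = tprod k (z ^~ 0%N) n * tprod k (z n) m)%g.
Proof.
elim: n => [|n IH] h /=; first by rewrite mulg1 mul1g.
rewrite mulgA IH; last by move=> i j ni; apply: h; exact: leqW.
rewrite -!mulgA; congr (_ * _)%g.
have {h}: forall j, (j < m)%N -> exists c,
    [/\ chart c (z n j), chart c (z n.+1 j), chart c (z n j.+1) & chart c (z n.+1 j.+1)].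
  by move=> j jm; apply: h.
elim: m {IH} => [|m IH] h /=; first by rewrite mulg1 mul1g.
rewrite mulgA -IH; last by move=> j jm; apply: h; exact: leqW.
have [c [h1 h2 h3 h4]] := h m (leqnn _).
by rewrite -!mulgA; congr (_ * _)%g; rewrite !(@tau_chart R G k c).
Qed.

(** Flatness on a square, the common source of invariance under based homotopies (constant sides)
    and of conjugacy under free ones (equal sides). *)
Lemma hol_square (H : I * I -> X) : continuous H ->
  (hol (fun t => H (zero, t)) * hol (fun s => H (s, one)) =
   hol (fun s => H (s, zero)) * hol (fun t => H (one, t)))%g.
Proof.
move=> cH; pose F (p : R * R) : pt := val (H (clamp p.1, clamp p.2)).
have cF : continuous F.
  apply: (comp_continuous (f := fun p : R * R => H (clamp p.1, clamp p.2)) _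
    (@sphere4_val_continuous R)).
  apply: (comp_continuous (f := fun p : R * R => (clamp p.1, clamp p.2)) _ cH).
  apply: pair_continuous; apply: clamp_comp_continuous.
    exact: fst_continuous.
  exact: snd_continuous.
pose Q (A : set (R * R)) := exists c, forall p, A p -> chart c (F p).
have cK : compact (`[(0 : R), 1] `*` `[(0 : R), 1]) by apply: compact_setX; exact: segment_compact.
have [| |e e0 he] := @lebesgue_number R (R * R)%type _ Q _ cK.
- by move=> A B AB [c h]; exists c => r /AB/h.
- move=> r _; have [c hc] := chart_cover (@sphere4P _ (H (clamp r.1, clamp r.2))).
  have : nbhs r (F @^-1` chart c).
    by apply: cF; apply: open_nbhs_nbhs; split=> //; exact: chart_open.
  by move=> /nbhs_ballP[d d0 hd]; exists d => //; exists c => s /hd.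
have [n n0 ne] := inv_nat_lt e0.
have n0' : 0 < n%:R :> R by rewrite ltr0n.
have in01 i : (i <= n)%N -> 0 <= (i%:R / n%:R : R) <= 1.
  by move=> ltin; rewrite divr_ge0 ?ler0n //= ler_pdivrMr // mul1r ler_nat.
have sq i j : (i < n)%N -> (j < n)%N -> exists c, forall r s,
    i%:R / n%:R <= r <= i.+1%:R / n%:R -> j%:R / n%:R <= s <= j.+1%:R / n%:R ->
    chart c (F (r, s)).
  move=> ltin ltjn; have [|c hc] := he (i%:R / n%:R, j%:R / n%:R).
    by split; rewrite /= in_itv /= in01 // ltnW.
  exists c => r s /andP[r1 r2] /andP[s1 s2]; apply: hc; split;
    rewrite /= /ball /= distrC ger0_norm ?subr_ge0 //;
    apply: le_lt_trans ne; rewrite lerBlDl.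
    by apply: le_trans r2 _; rewrite -natr1 mulrDl mul1r.
  by apply: le_trans s2 _; rewrite -natr1 mulrDl mul1r.
have le1 i : (i%:R / n%:R : R) <= i.+1%:R / n%:R.
  by rewrite ler_pM2r ?invr_gt0 // ler_nat leqnSn.
have FE a b : F (a, b) = val (H (clamp a, clamp b)) by [].
have c0 : clamp (0 : R) = zero by [].
have c1 : clamp (1 : R) = one by [].
have nn : (n%:R / n%:R : R) = 1 by rewrite divff // lt0r_neq0.
have h0 : fine n (fun t => H (zero, t)).
  split=> // j jn; have [c hc] := sq 0%N j n0 jn; exists c => r rj.
  by have := hc 0 r; rewrite mul0r; apply=> //; rewrite lexx divr_ge0.
have h1 : fine n (fun t => H (one, t)).
  split=> // j jn; have [|c hc] := sq n.-1 j _ jn; first by rewrite prednK.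
  rewrite prednK // in hc; exists c => r rj.
  by have := hc 1 r; rewrite nn; apply=> //; rewrite lexx andbT ler_pdivrMr // mul1r ler_nat leq_pred.
have v0 : fine n (fun s => H (s, zero)).
  split=> // j jn; have [c hc] := sq j 0%N jn n0; exists c => r rj.
  by have := hc r 0; rewrite mul0r; apply=> //; rewrite lexx divr_ge0.
have v1 : fine n (fun s => H (s, one)).
  split=> // j jn; have [|c hc] := sq j n.-1 jn; first by rewrite prednK.
  rewrite prednK // in hc; exists c => r rj.
  by have := hc r 1; rewrite nn; apply=> //; rewrite lexx andbT ler_pdivrMr // mul1r ler_nat leq_pred.
rewrite (holE k h0) (holE k h1) (holE k v0) (holE k v1).
pose z i j := F (i%:R / n%:R, j%:R / n%:R).
have := @tprod_square z n n.
have e0' : (0%:R / n%:R : R) = 0 by rewrite mul0r.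
rewrite /gridprod /z nn e0' => -> // i j ltin ltjn; have [c hc] := sq i j ltin ltjn.
by exists c; split; apply: hc; rewrite ?lexx ?le1.
Qed.

End homotopy_invariance.

Section holonomy.
Variable (R : realType).
Local Notation I := (unit_itv R).
Local Notation pt := (R * R)%type.
Local Notation X := (sphere4 R).
Local Notation bp := (basepoint R).
Local Notation pi1 := (pi1 R bp).
Variables (G : groupType) (k : nat -> G).
Local Notation hol := (hol k).
Local Notation tau := (tau k).

Lemma hol_const (x : X) : hol (fun=> x) = 1%g.
Proof.
have f1 : fine 1 (fun=> x : X).
  split=> // i _; have [c hc] := chart_cover (@sphere4P _ x); by exists c.
by rewrite (holE k f1) /gridprod /= mul1g tau1.
Qed.

Lemma hol_free (f g : I -> X) : free_homotopic f g -> exists h, hol f = (hol g ^ h)%g.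
Proof.
case=> H [cH H0 H1 Hs]; have := hol_square k cH.
have -> : (fun t => H (zero, t)) = f by apply/funext.
have -> : (fun t => H (one, t)) = g by apply/funext.
have -> : (fun s => H (s, one)) = (fun s => H (s, zero)) by apply/funext => s; rewrite Hs.
set v := hol (fun s => H (s, zero)) => e; exists (v^-1)%g.
by rewrite conjgE invgK mulgA -e mulgK.
Qed.

Lemma hol_homotopic (a b : loop R bp) : homotopic a b ->
  hol (loop_fun a) = hol (loop_fun b).
Proof.
case=> H [cH H0 H1 Hs]; have := hol_square k cH.
have -> : (fun t => H (zero, t)) = loop_fun a by apply/funext.
have -> : (fun t => H (one, t)) = loop_fun b by apply/funext.
have -> : (fun s => H (s, one)) = (fun=> bp) by apply/funext => s; rewrite (Hs s).2.
have -> : (fun s => H (s, zero)) = (fun=> bp) by apply/funext => s; rewrite (Hs s).1.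
by rewrite hol_const mulg1 mul1g.
Qed.

Lemma val_clamp_nat (i n : nat) : (i <= n)%N -> (0 < n)%N ->
  val (clamp (i%:R / n%:R) : I) = i%:R / n%:R.
Proof.
move=> lin n0; rewrite clampE // divr_ge0 ?ler0n //=.
by rewrite ler_pdivrMr ?ltr0n // mul1r ler_nat.
Qed.

Lemma hol_concat (a b : loop R bp) :
  hol (loop_fun (concat a b)) = (hol (loop_fun a) * hol (loop_fun b))%g.
Proof.
have [n fn] := fine_exists (@loop_continuous _ _ _ a).
have [m fm] := fine_exists (@loop_continuous _ _ _ b).
have fa := fine_mul fn fm.1; have fb := fine_mul fm fn.1; rewrite mulnC in fb.
move: (n * m)%N fa fb => q [q0 fa] [_ fb] {n m fn fm}.
have q0' : 0 < q%:R :> R by rewrite ltr0n.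
have q20 : 0 < (q + q)%:R :> R by rewrite natrD; lra.
have dq (r : R) : r / (q + q)%:R = (r / q%:R) / 2.
  rewrite natrD; field; rewrite lt0r_neq0 //=; apply/eqP; lra.
have cl (r : R) : 0 <= r <= 1 -> r <= 2^-1 ->
    curve (loop_fun (concat a b)) r = curve (loop_fun a) (2 * r).
  move=> r01 r2; rewrite /curve concatE clampE // r2; congr (val (loop_fun a _)).
  by rewrite /affI clampE // addr0.
have cr (r : R) : 0 <= r <= 1 -> 2^-1 <= r ->
    curve (loop_fun (concat a b)) r = curve (loop_fun b) (2 * r - 1).
  move=> r01 r2; rewrite /curve concatE clampE //.
  case: (ltrgtP r 2^-1) => [h|_|->]; [by exfalso; lra| |].
    by congr (val (loop_fun b _)); rewrite /affI clampE.
  have -> : affI 2 0 (clamp 2^-1) = one :> I by rewrite affI1 // clampE; lra.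
  have -> : clamp (2 * 2^-1 - 1) = zero :> I.
    by rewrite mulfV ?subrr //; apply/eqP; lra.
  by rewrite loop0 loop1.
have fc : fine (q + q) (loop_fun (concat a b)).
  split=> [|i lti]; first by rewrite addn_gt0 q0.
  have i01 j (r : R) : (j < q + q)%N -> j%:R / (q + q)%:R <= r <= j.+1%:R / (q + q)%:R -> 0 <= r <= 1.
    move=> ltj /andP[r1 r2]; rewrite (le_trans _ r1) ?divr_ge0 //=.
    apply: (le_trans r2). by rewrite ler_pdivrMr // mul1r ler_nat.
  have [iq|qi] := ltnP i q.
    have [c hc] := fa i iq; exists c => r ri; have r01 := i01 i r lti ri.
    case/andP: ri; rewrite !dq => r1 r2.
    have r2' : r <= 2^-1.
      apply: le_trans r2 _; rewrite ler_pdivrMr // mulVf ?pnatr_eq0 //.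
      by rewrite ler_pdivrMr // mul1r ler_nat.
    by rewrite cl //; apply: hc; lra.
  have lti' : (i - q < q)%N by rewrite ltn_subLR.
  have [c hc] := fb (i - q)%N lti'; exists c => r ri; have r01 := i01 i r lti ri.
  case/andP: ri; rewrite !dq => r1 r2.
  have ei : i%:R / q%:R = (i - q)%:R / q%:R + 1 :> R.
    by rewrite -{1}(subnK qi) natrD mulrDl divff ?lt0r_neq0.
  have ei' : i.+1%:R / q%:R = (i - q).+1%:R / q%:R + 1 :> R.
    by rewrite -{1}(subnK qi) -addSn natrD mulrDl divff ?lt0r_neq0.
  rewrite ei in r1; rewrite ei' in r2.
  have p0 : 0 <= (i - q)%:R / q%:R :> R by rewrite divr_ge0.
  by rewrite cr //; [apply: hc; lra|lra].
rewrite (holE k fc) (holE k (conj q0 fa)) (holE k (conj q0 fb)) /gridprod tprod_add.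
have in01 i : (i <= q)%N -> 0 <= (i%:R / q%:R : R) <= 1.
  by move=> ltin; rewrite divr_ge0 ?ler0n //= ler_pdivrMr // mul1r ler_nat.
congr (_ * _)%g; apply: eq_tprod => i iq; have i01 := in01 i iq.
  by rewrite dq cl; [congr curve| |]; lra.
rewrite dq natrD mulrDl divff ?lt0r_neq0 //.
by rewrite cr; [congr curve| |]; lra.
Qed.

Definition hol_rep (x : pi1) : G := hol (loop_fun (repr x)).

Lemma hol_repE (a : loop R bp) : hol_rep (\pi_pi1 a) = hol (loop_fun a).
Proof. by apply: hol_homotopic; apply/pi_pi1P; rewrite reprK. Qed.

Lemma hol_repM : {morph hol_rep : x y / (x * y)%g}.
Proof.
move=> x y; rewrite -[x]reprK -[y]reprK.
have -> : (\pi_pi1 (repr x) * \pi_pi1 (repr y))%g = \pi_pi1 (concat (repr x) (repr y)).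
  exact: pi_concat.
by rewrite !hol_repE hol_concat.
Qed.

HB.instance Definition _ := isMultiplicative.Build pi1 G hol_rep hol_repM.

End holonomy.

(** * Holonomy of the petals and of the circles around the punctures *)

Section itineraries.
Variable (R : realType).
Local Notation I := (unit_itv R).
Local Notation pt := (R * R)%type.
Local Notation X := (sphere4 R).
Local Notation bp := (basepoint R).
Local Notation pi1 := (pi1 R bp).
Variables (G : groupType) (k : nat -> G).
Local Notation hol := (hol k).
Local Notation tau := (tau k).

(** A coarse subdivision with breakpoints among the multiples of [1 / N], each piece in one chart,
    so that the holonomy of a concrete curve is computed from a handful of points. *)
Fixpoint itinerary (f : I -> X) (N i : nat) (s : seq nat) : Prop :=
  if s is j :: s' then
    [/\ (i <= j)%N, (exists c, forall r, i%:R / N%:R <= r <= j%:R / N%:R -> chart c (curve f r))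
      & itinerary f N j s']
  else i = N.

Lemma hol_itinerary f N s : continuous f -> (0 < N)%N -> itinerary f N 0 s ->
  hol f = phol (fun i j => tau (curve f (i%:R / N%:R)) (curve f (j%:R / N%:R))) 0%N s.
Proof.
move=> /fine_exists[n fn] N0 its; rewrite (holE k (fine_mul fn N0)) /gridprod.
have n0 := fn.1; pose x i := curve f (i%:R / (n * N)%:R).
have nR : n%:R != 0 :> R by rewrite pnatr_eq0 -lt0n.
have nN0 : 0 < (n * N)%:R :> R by rewrite ltr0n muln_gt0 n0.
have e (i : nat) : i%:R / N%:R = (i * n)%:R / (n * N)%:R :> R.
  by rewrite [(n * N)%N]mulnC !natrM -mulf_div divff // mulr1.
suff h i : (i <= N)%N -> itinerary f N i s ->
    tprod k (fun t => x (i * n + t)%N) ((N - i) * n) =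
    phol (fun i j => tau (curve f (i%:R / N%:R)) (curve f (j%:R / N%:R))) i s.
  by rewrite -h // subn0 [(N * n)%N]mulnC.
elim: s i {its} => [|j s IH] i iN /=; first by move=> ->; rewrite subnn.
case=> ij [c hc] its.
have jN : (j <= N)%N.
  elim: s j its {ij hc IH} => [j /= ->//|l s IH j /= [jl _ /IH]]; exact: leq_trans.
have -> : ((N - i) * n = (j - i) * n + (N - j) * n)%N by rewrite -mulnDl; congr (_ * _)%N; lia.
rewrite tprod_add; congr (_ * _)%g; last first.
  rewrite -IH //; apply: eq_tprod => t _; congr x.
  by rewrite addnA -mulnDl subnKC.
rewrite (tprod_chart k (c := c)) ?addn0 /x.
  by rewrite -mulnDl subnKC // -!e.
move=> t tn; apply: hc; rewrite !e !ler_pM2r ?invr_gt0 // !ler_nat leq_addr /=.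
by rewrite -(subnKC ij) mulnDl leq_add2l.
Qed.

Section petals.
Variables (m w : R) (mw : petal_ok m w).

Lemma curve_petal (r : R) : 0 <= r <= 1 ->
  curve (loop_fun (petal mw)) r = petal_fun m w r.
Proof.
move=> r01; transitivity (petal_fun m w (val (clamp r : I))); first by [].
by rewrite clampE.
Qed.

Lemma hol_petal (jr jl : nat) : (jr < 4)%N -> (jl < 4)%N ->
  (forall r, 8^-1 <= r <= 6^-1 -> chart jr (petal_fun m w r)) ->
  (forall r, 5 / 6 <= r <= 7 / 8 -> chart jl (petal_fun m w r)) ->
  hol (loop_fun (petal mw)) = (k jr / k jl)%g.
Proof.
move=> jr4 jl4 hr hl.
(* The height [8 t (1 - t) - 1] vanishes at [t = (1 - 1 / sqrt 2) / 2] and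
   [t = (1 + 1 / sqrt 2) / 2], which lie between 3/24 and 4/24 and between 20/24 and 21/24. The
   petal thus crosses the axis once up and once down. *)
rewrite (@hol_itinerary _ 24 [:: 3; 4; 20; 21; 24]%N) //; last first.
- split=> //.
    exists 4%N => r hr'; rewrite curve_petal; last lra.
    by rewrite /chart /petal_fun /=; nra.
  split=> //; first by exists jr => r hr'; rewrite curve_petal; [apply: hr|]; lra.
  split=> //.
    exists 5%N => r hr'; rewrite curve_petal; last lra.
    by rewrite /chart /petal_fun /=; nra.
  split=> //; first by exists jl => r hr'; rewrite curve_petal; [apply: hl|]; lra.
  split=> //.
  exists 4%N => r hr'; rewrite curve_petal; last lra.
  by rewrite /chart /petal_fun /=; nra.
- exact: loop_continuous.
have l0 : (0 < (petal_fun m w (0%:R / 24%:R)).2) = false by rewrite /petal_fun /=; apply/negbTE; lra.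
have l3 : (0 < (petal_fun m w (3%:R / 24%:R)).2) = false by rewrite /petal_fun /=; apply/negbTE; lra.
have l4 : (0 < (petal_fun m w (4%:R / 24%:R)).2) = true by rewrite /petal_fun /=; lra.
have l20 : (0 < (petal_fun m w (20%:R / 24%:R)).2) = true by rewrite /petal_fun /=; lra.
have l21 : (0 < (petal_fun m w (21%:R / 24%:R)).2) = false by rewrite /petal_fun /=; apply/negbTE; lra.
have l24 : (0 < (petal_fun m w (24%:R / 24%:R)).2) = false by rewrite /petal_fun /=; apply/negbTE; lra.
have ct i : (i <= 24)%N -> curve (loop_fun (petal mw)) (i%:R / 24%:R) = petal_fun m w (i%:R / 24%:R).
  by move=> i24; rewrite curve_petal // divr_ge0 ?ler0n //= ler_pdivrMr // mul1r ler_nat.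
rewrite [phol _ _ _]/= !ct //.
have s4 : strip (petal_fun m w (4%:R / 24%:R)).1 = jr by apply: chart_strip => //; apply: hr; lra.
have s20 : strip (petal_fun m w (20%:R / 24%:R)).1 = jl by apply: chart_strip => //; apply: hl; lra.
by rewrite /tau l0 l3 l4 l20 l21 l24 s4 s20 /= !mul1g !mulg1.
Qed.

End petals.

Lemma petal_height (r : R) : 8^-1 <= r <= 6^-1 \/ 5 / 6 <= r <= 7 / 8 ->
  7 / 8 <= 8 * r * (1 - r) <= 10 / 9.
Proof. by case=> h; apply/andP; split; nra. Qed.

Lemma hol_c1 : hol_rep k (c1 R) = (k 3 / k 2)%g.
Proof.
rewrite hol_repE; apply: hol_petal => // r hr; rewrite /chart /petal_fun /=.
  by have := petal_height (or_introl hr); move: (8 * r * (1 - r)) => s hs; nra.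
by have := petal_height (or_intror hr); move: (8 * r * (1 - r)) => s hs; nra.
Qed.

Lemma hol_c2 : hol_rep k (c2 R) = (k 2 / k 1)%g.
Proof.
rewrite hol_repE; apply: hol_petal => // r hr; rewrite /chart /petal_fun /=.
  by have := petal_height (or_introl hr); move: (8 * r * (1 - r)) => s hs; nra.
by have := petal_height (or_intror hr); move: (8 * r * (1 - r)) => s hs; nra.
Qed.

Lemma hol_c3 : hol_rep k (c3 R) = (k 1 / k 0)%g.
Proof.
rewrite hol_repE; apply: hol_petal => // r hr; rewrite /chart /petal_fun /=.
  by have := petal_height (or_introl hr); move: (8 * r * (1 - r)) => s hs; nra.
by have := petal_height (or_intror hr); move: (8 * r * (1 - r)) => s hs; nra.
Qed.

Lemma hol_c4 : hol_rep k (c4 R) = (k 0 / k 3)%g.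
Proof.
rewrite hol_repE; apply: hol_petal => // r hr; rewrite /chart /petal_fun /=.
  by have := petal_height (or_introl hr); move: (8 * r * (1 - r)) => s hs; nra.
by have := petal_height (or_intror hr); move: (8 * r * (1 - r)) => s hs; nra.
Qed.

End itineraries.

Section circles.
Variable (R : realType).
Local Notation I := (unit_itv R).
Local Notation pt := (R * R)%type.
Local Notation X := (sphere4 R).
Variables (G : groupType) (k : nat -> G).
Local Notation hol := (hol k).

Definition circle_fun (x r e t : R) : pt :=
  (x + r * cos (2 * pi * t), e * (r * sin (2 * pi * t))).

Lemma circle_continuous (b : I -> X) x r e :
  (forall t, val (b t) = circle_fun x r e (val t)) -> continuous b.
Proof.
move=> bE; apply: (@continuous_comp_initial X I pt (fun x => val x)).
have -> : (fun x => val x) \o b = (fun t => circle_fun x r e (val t)).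
  by apply/funext => t; rewrite /= bE.
have cv : continuous (fun t : I => 2 * pi * val t : R).
  apply: mul_continuous; last exact: I_val_continuous.
  exact: cst_continuous.
have cc (c : R) : continuous (fun _ : I => c) by exact: cst_continuous.
have cs : continuous (fun t : I => sin (2 * pi * val t) : R).
  exact: (comp_continuous cv (@continuous_sin R)).
have cC : continuous (fun t : I => cos (2 * pi * val t) : R).
  exact: (comp_continuous cv (@continuous_cos R)).
apply: pair_continuous.
  by apply: add_continuous => //; exact: mul_continuous.
by apply: mul_continuous => //; exact: mul_continuous.
Qed.

Lemma cos_near1 (d : R) : d < 1 -> exists2 e : R, 0 < e & forall x, `|x| < e -> d < cos x.
Proof.
move=> d1; have : nbhs (0 : R) (cos @^-1` [set y | d < y]).
  apply: continuous_cos; apply: open_nbhs_nbhs; split; first exact: open_gt.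
  by rewrite /= cos0.
case/nbhs_ballP => e e0 he; exists e => // x xe; apply: he.
by rewrite /ball /= sub0r normrN.
Qed.

Lemma circle_grid M (N := (M + M)%N) : (1 < M)%N ->
  [/\ (0 < N)%N, (M.-1 <= N)%N, (M.+1 <= N)%N & (N.-1 <= N)%N] /\
  [/\ (1 <= M.-1)%N, (M.-1 <= M.+1)%N & (M.+1 <= N.-1)%N].
Proof. by move=> M2; split; split; rewrite /N; lia. Qed.

(** Within the angle [pi / M] of the two axis crossings the cosine is so close to its extreme value
    that the circle is in the strips [jr] and [jl]; on the remaining two arcs the sine has a
    constant sign, so they lie in half-planes. *)
Lemma hol_circle_gen (b : I -> X) x r e d (jr jl : nat) :
  (forall t, val (b t) = circle_fun x r e (val t)) -> 0 < r -> e = 1 \/ e = -1 ->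
  (jr < 4)%N -> (jl < 4)%N -> d < 1 ->
  (forall c y, d < c <= 1 -> chart jr (x + r * c, y) /\ chart jl (x - r * c, y)) ->
  hol b = if e == 1 then (k jr / k jl)%g else (k jl / k jr)%g.
Proof.
move=> bE r0 e1 jr4 jl4 d1 hc.
have [eta eta0 heta] := cos_near1 d1.
have pi0 : 0 < pi :> R := pi_gt0 R.
have [M0 M00 hM0] := @inv_nat_lt R (eta / pi) (divr_gt0 eta0 pi0).
pose M := M0.+1; have M2 : (1 < M)%N by [].
have MR : 0 < M%:R :> R by rewrite ltr0n.
have hM : pi / M%:R < eta.
  rewrite mulrC -ltr_pdivlMr //; apply: lt_trans hM0.
  by rewrite ltf_pV2 ?posrE ?ltr0n // ltr_nat.
pose N := (M + M)%N; have NR : N%:R = 2 * M%:R :> R by rewrite natrD mulr2n mulrDl mul1r.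
have cE t : 0 <= t <= 1 -> curve b t = circle_fun x r e t.
  by move=> t01; rewrite /curve bE clampE.
have ang (i : nat) : 2 * pi * (i%:R / N%:R) = i%:R * (pi / M%:R) :> R.
  by rewrite NR; field; exact: lt0r_neq0.
set a := pi / M%:R in hM ang; have a0 : 0 < a by rewrite divr_gt0.
have Ma : M%:R * a = pi by rewrite mulrC divfK // lt0r_neq0.
have a2 : a < pi by rewrite ltr_pdivrMr // ltr_pMr // ltr1n.
have rng (i j : nat) t : (j <= N)%N -> i%:R / N%:R <= t <= j%:R / N%:R ->
    0 <= t <= 1 /\ i%:R * a <= 2 * pi * t <= j%:R * a.
  move=> jN /andP[t1 t2]; rewrite -!ang !ler_pM2l ?mulr_gt0 // t1 t2; split=> //.
  rewrite (le_trans _ t1) ?divr_ge0 //=; apply: (le_trans t2).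
  by rewrite ler_pdivrMr ?ltr0n // mul1r ler_nat.
have M1 : (M.-1)%:R * a = pi - a by rewrite -Ma -[in RHS](prednK (ltnW M2)) -natr1 mulrDl mul1r addrK.
have Mp1 : (M.+1)%:R * a = pi + a by rewrite -natr1 mulrDl mul1r Ma.
have Np : N%:R * a = pi + pi by rewrite natrD mulrDl Ma.
have N1 : (N.-1)%:R * a = pi + pi - a.
  by rewrite -Np -[in RHS](prednK (_ : 0 < N)%N) // -natr1 mulrDl mul1r addrK.
have cos_le1 (t : R) : cos t <= 1 by exact: cos_le1.
have A1 t : `|t| <= a -> d < cos t <= 1 by move=> h; rewrite cos_le1 heta // (le_lt_trans h).
have sup t : a <= t <= pi - a -> 0 < sin t by move=> h; apply: sin_gt0_pi; lra.
have sdn t : pi + a <= t <= pi + pi - a -> sin t < 0.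
  by move=> h; rewrite -[t](subrK pi) sinDpi oppr_lt0; apply: sup; lra.
have cR0 y t : 0 <= t <= a -> chart jr (x + r * cos t, y).
  by move=> h; apply: (hc _ _ _).1; apply: A1; rewrite ger0_norm; lra.
have cL y t : pi - a <= t <= pi + a -> chart jl (x + r * cos t, y).
  move=> h; rewrite -[t](subrK pi) cosDpi mulrN; apply: (hc _ _ _).2; apply: A1.
  by rewrite ler_norml; lra.
have cR1 y t : pi + pi - a <= t <= pi + pi -> chart jr (x + r * cos t, y).
  move=> h; rewrite -[t](subrK pi) cosDpi -[t - pi](subrK pi) cosDpi opprK.
  by apply: (hc _ _ _).1; apply: A1; rewrite ler_norml; lra.
have cb : continuous b := circle_continuous bE.
have [[g1 g2 g3 g4] [g5 g6 g7]] := circle_grid M2.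
have its : itinerary b N 0 [:: 1; M.-1; M.+1; N.-1; N]%N.
  split=> //.
    exists jr => t /rng[//|t01].
    by rewrite mul0r mul1r => h; rewrite cE //; exact: cR0.
  split=> //.
    exists (if e == 1 then 5%N else 4%N) => t /rng[//|t01].
    rewrite mul1r M1 => /sup h; rewrite cE //.
    by case: e1 => ->; rewrite ?eqxx /chart /circle_fun /=; [|rewrite ifF /=; [|apply/negbTE; lra]]; nra.
  split=> //.
    exists jl => t /rng[//|t01].
    by rewrite M1 Mp1 => h; rewrite cE //; exact: cL.
  split=> //.
    exists (if e == 1 then 4%N else 5%N) => t /rng[//|t01].
    rewrite Mp1 N1 => /sdn h; rewrite cE //.
    by case: e1 => ->; rewrite ?eqxx /chart /circle_fun /=; [|rewrite ifF /=; [|apply/negbTE; lra]]; nra.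
  split=> //.
  exists jr => t /rng[//|t01].
  by rewrite N1 Np => h; rewrite cE //; exact: cR1.
have pE i : (i <= N)%N -> curve b (i%:R / N%:R) = (x + r * cos (i%:R * a), e * (r * sin (i%:R * a))).
  move=> iN; rewrite cE; last by rewrite divr_ge0 ?ler0n //= ler_pdivrMr ?ltr0n // mul1r ler_nat.
  by rewrite /circle_fun ang.
rewrite (hol_itinerary k cb _ its) // [phol _ _ _]/= !pE //.
rewrite mul0r mul1r M1 Mp1 N1 Np sin0.
have s1 : 0 < r * sin a by rewrite mulr_gt0 //; apply: sin_gt0_pi; rewrite a0.
have e2 : sin (pi - a) = sin a by rewrite -[LHS]opprK -sinN opprB -[a - pi]/(a - pi) -sinDpi subrK.
have e3 : sin (pi + a) = - sin a by rewrite addrC sinDpi.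
have e4 : sin (pi + pi - a) = - sin a by rewrite addrAC sinDpi e2.
have e5 : sin (pi + pi) = 0 :> R by rewrite -mulr2n sin2pi.
rewrite e2 e3 e4 e5 !mulr0.
have strip1 (y : R) : strip (x + r * cos a) = jr.
  by apply: (chart_strip jr4 (cR0 y a _)); rewrite lexx ltW.
have strip2 (y : R) : strip (x + r * cos (pi - a)) = jl.
  by apply: (chart_strip jl4 (cL y _ _)); lra.
have strip3 (y : R) : strip (x + r * cos (pi + a)) = jl.
  by apply: (chart_strip jl4 (cL y _ _)); lra.
have strip4 (y : R) : strip (x + r * cos (pi + pi - a)) = jr.
  by apply: (chart_strip jr4 (cR1 y _ _)); lra.
rewrite /tau /= ltxx (strip1 0) (strip2 0) (strip3 0) (strip4 0).
have n1 : (r * sin a < 0) = false by exact: lt_gtF.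
case: e1 => ->.
  have p1 : 0 < 1 * (r * sin a) by rewrite mul1r.
  have p2 : (0 < 1 * (r * - sin a)) = false by rewrite mul1r mulrN oppr_gt0.
  by rewrite p1 p2 /= eqxx !mulg1 !mul1g.
have p1 : (0 < -1 * (r * sin a)) = false by rewrite mulN1r oppr_gt0.
have p2 : 0 < -1 * (r * - sin a) by rewrite mulN1r mulrN opprK.
rewrite p1 p2 /= ifF; last by apply/eqP; lra.
by rewrite !mulg1 !mul1g.
Qed.

Lemma hol_circle (b : I -> X) : puncture_circle b ->
  (exists2 m, (m < 3)%N & hol b = gap k m \/ hol b = (gap k m)^-1%g) \/
  (hol b = (k 3 / k 0)%g \/ hol b = (k 3 / k 0)^-1%g).
Proof.
case=> p [r [e [hp e1 bE]]].
have small (x : R) m : (m < 3)%N -> p = (x, 0) -> 0 < r < 1 ->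
    (forall c y, 0 < c < 1 -> chart m.+1 (x + c, y) /\ chart m (x - c, y)) ->
    exists2 m, (m < 3)%N & hol b = gap k m \/ hol b = (gap k m)^-1%g.
  move=> m3 ep /andP[r0 r1] hc; exists m => //.
  have bE' t : val (b t) = circle_fun x r e (val t) by rewrite bE ep /circle_fun /= add0r.
  have hc' c y : 0 < c <= 1 -> chart m.+1 (x + r * c, y) /\ chart m (x - r * c, y).
    by move=> /andP[c0 c1]; apply: hc; rewrite mulr_gt0 //=; nra.
  rewrite (hol_circle_gen bE' r0 e1 (m3 : (m.+1 < 4)%N) (leqW m3) ltr01 hc') /gap.
  by case: ifP => _; [left|right; rewrite invgF].
case: hp => [[hp r01]|[ep r1]]; [left|right].
  have {}r01 : 0 < r < 1 by [].
  case: hp => ep.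
  - by apply: (small 1 2%N) => // c y; rewrite /chart /=; lra.
  - by apply: (small 0 1%N) => // c y; rewrite /chart /=; lra.
  - by apply: (small (-1) 0%N) => // c y; rewrite /chart /=; lra.
have r0 : 0 < r by lra.
have bE' t : val (b t) = circle_fun 0 r e (val t) by rewrite bE ep /circle_fun /= !add0r.
have hc' c y : r^-1 < c <= 1 -> chart 3 (0 + r * c, y) /\ chart 0 (0 - r * c, y).
  move=> /andP[c0 c1]; have : 1 < r * c by rewrite mulrC -ltr_pdivrMr // mul1r.
  by rewrite /chart /=; lra.
rewrite (hol_circle_gen bE' r0 e1 (isT : (3 < 4)%N) (isT : (0 < 4)%N) _ hc') ?invf_lt1 //.
by case: ifP => _; [left|right; rewrite invgF].
Qed.

End circles.

Section standard_circles.
Variable (R : realType).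
Local Notation I := (unit_itv R).
Local Notation X := (sphere4 R).

Lemma circle_avoids (x r e t : R) : e = 1 \/ e = -1 ->
  (x = 0 /\ r = 2) \/ (r = 2^-1 /\ [\/ x = 1, x = 0 | x = -1]) ->
  (~` @finite_punctures R) (circle_fun x r e t).
Proof.
rewrite /circle_fun => e1; have := cos2Dsin2 (2 * pi * t); move: (cos _) (sin _) => c s cs h.
have key q : (x + r * c, e * (r * s)) = (q, 0) -> q = x + r \/ q = x - r.
  case=> e2 e3; have r0 : r != 0 by case: h => -[h1 h2]; apply/eqP; lra.
  have e0 : e != 0 by case: e1 => ->; apply/eqP; lra.
  have s0 : s = 0 by apply/eqP; move/eqP: e3; rewrite !mulf_eq0 (negbTE r0) (negbTE e0).
  have : (c - 1) * (c + 1) = 0 by move: cs; rewrite s0; nra.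
  by move/eqP; rewrite mulf_eq0 => /orP[]/eqP c1; [left|right]; rewrite -e2; nra.
by case=> /key; case: h => -[h1 h2]; try (case: h2 => h2); case=> ?; lra.
Qed.

Definition std_circle (x r e : R) (e1 : e = 1 \/ e = -1)
    (h : (x = 0 /\ r = 2) \/ (r = 2^-1 /\ [\/ x = 1, x = 0 | x = -1])) (t : I) : X :=
  mk4 (@circle_avoids x r e (val t) e1 h).

(** Model circles with both orientations, whose holonomy is known for all labels at once; they serve
    to recognise peripheral curves by their holonomy. *)
Lemma circle_exists (m : nat) (e : R) : (m < 3)%N -> e = 1 \/ e = -1 -> exists b : I -> X,
  [/\ puncture_circle b, continuous b &
     forall (G : groupType) (k : nat -> G), hol k b = if e == 1 then gap k m else (gap k m)^-1%g].
Proof.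
move=> m3 e1; pose x : R := m%:R - 1.
have hc c y : 0 < c <= 1 -> chart m.+1 (x + 2^-1 * c, y) /\ chart m (x - 2^-1 * c, y).
  by rewrite /x; case: (m) m3 => [|[|[|//]]] _ /andP[c0 c1]; rewrite /chart /=; lra.
have h : (x = 0 /\ (2^-1 : R) = 2) \/ ((2^-1 : R) = 2^-1 /\ [\/ x = 1, x = 0 | x = -1]).
  right; split=> //; rewrite /x; case: (m) m3 => [|[|[|//]]] _.
  - by constructor 3; rewrite sub0r.
  - by constructor 2; rewrite subrr.
  - by constructor 1; lra.
have bE (t : I) : val (std_circle e1 h t) = circle_fun x 2^-1 e (val t) by [].
exists (std_circle e1 h); split.
- exists (x, 0), 2^-1, e; split; [|by []|by move=> t; rewrite bE /circle_fun /= add0r].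
  left; split; last lra.
  by case: (h) => -[h1 h2]; [lra|]; case: h2 => ->; [constructor 1|constructor 2|constructor 3].
- exact: circle_continuous bE.
- move=> G k; have r0 : 0 < 2^-1 :> R by lra.
  by rewrite (hol_circle_gen k bE r0 e1 (m3 : (m.+1 < 4)%N) (leqW m3) ltr01 hc) ?invgF.
Qed.

Lemma big_circle_exists (e : R) : e = 1 \/ e = -1 -> exists b : I -> X,
  [/\ puncture_circle b, continuous b &
     forall (G : groupType) (k : nat -> G), hol k b = if e == 1 then (k 3 / k 0)%g else (k 3 / k 0)^-1%g].
Proof.
move=> e1.
have h : ((0 : R) = 0 /\ (2 : R) = 2) \/ ((2 : R) = 2^-1 /\ [\/ (0 : R) = 1, (0 : R) = 0 | (0 : R) = -1]) by left.
have bE (t : I) : val (std_circle e1 h t) = circle_fun 0 2 e (val t) by [].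
exists (std_circle e1 h); split.
- exists (0, 0), 2, e; split; [|by []|by move=> t; rewrite bE /circle_fun /= !add0r].
  by right; split=> //; lra.
- exact: circle_continuous bE.
- move=> G k; have r0 : 0 < 2 :> R by lra.
  have d1 : 2^-1 < 1 :> R by lra.
  have hc c y : 2^-1 < c <= 1 -> chart 3 (0 + 2 * c : R, y) /\ chart 0 (0 - 2 * c : R, y).
    by move=> /andP[c0 c1]; rewrite /chart /=; lra.
  by rewrite (hol_circle_gen k bE r0 e1 (isT : (3 < 4)%N) (isT : (0 < 4)%N) d1 hc) ?invgF.
Qed.

End standard_circles.

(** * Homotopy of paths with fixed ends, and free homotopy *)

Section path_groupoid.
Variables (R : realType) (T : topologicalType).
Local Notation I := (unit_itv R).

Definition pth (x y : T) : Type := {path I from x to y in T}.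
Definition pfun x y (f : pth x y) : I -> T := f.
Definition mkpth x y (f : I -> T) (cf : continuous f) (f0 : f zero = x) (f1 : f one = y) : pth x y :=
  mk_path cf f0 f1.

Lemma pth_continuous x y (f : pth x y) : continuous (pfun f). Proof. exact: cts_fun. Qed.
Lemma pth0 x y (f : pth x y) : pfun f zero = x. Proof. exact: path_zero. Qed.
Lemma pth1 x y (f : pth x y) : pfun f one = y. Proof. exact: path_one. Qed.

Definition ph x y (f g : pth x y) : Prop :=
  exists H : I * I -> T,
    [/\ continuous H, forall t, H (zero, t) = pfun f t,
        forall t, H (one, t) = pfun g t &
        forall s, H (s, zero) = x /\ H (s, one) = y].

Lemma ph_trans x y (f g h : pth x y) : ph f g -> ph g h -> ph f h.
Proof.
move=> [H [cH Ha Hb Hs]] [K [cK Kb Kc Ks]].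
exists (fun p => if val p.1 <= 2^-1 then H (affI 2 0 p.1, p.2)
                 else K (affI 2 (-1) p.1, p.2)); split=> [|t|t|s]; cbn [fst snd].
- apply: half_continuous; first exact: fst_continuous.
  + apply: comp_continuous cH; apply: pair_continuous; last exact: snd_continuous.
    exact/affI_continuous/fst_continuous.
  + apply: comp_continuous cK; apply: pair_continuous; last exact: snd_continuous.
    exact/affI_continuous/fst_continuous.
  + move=> [s t]; cbn [fst snd] => s2; rewrite affI1 ?affI0 ?Hb ?Kb //; rewrite s2; lra.
- by rewrite val_zero invr_ge0 ler0n affI0 // val_zero; lra.
- by rewrite val_one ifF ?affI1 ?val_one //; [lra|apply/negbTE; lra].
- by case: ifP.
Qed.

Lemma ph_reparam u v x y (c : pth u v) (f g : pth x y) (phi psi : I -> I) :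
  continuous phi -> continuous psi -> phi zero = psi zero -> phi one = psi one ->
  pfun f =1 pfun c \o phi -> pfun g =1 pfun c \o psi -> ph f g.
Proof.
move=> cphi cpsi e0 e1 ef eg.
pose L (p : I * I) : R := (1 - val p.1) * val (phi p.2) + val p.1 * val (psi p.2).
have cv := @I_val_continuous R.
have c1 : continuous (fun p : I * I => val p.1 : R).
  exact: comp_continuous (@fst_continuous _ _) cv.
have cf (h : I -> I) : continuous h -> continuous (fun p : I * I => val (h p.2) : R).
  move=> ch; apply: (@comp_continuous _ _ _ (fun p => h p.2)) cv.
  exact: comp_continuous (@snd_continuous _ _) ch.
have cL : continuous L.
  apply: add_continuous; apply: mul_continuous; [|exact: cf|exact: c1|exact: cf].
  by apply: sub_continuous => //; exact: cst_continuous.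
exists (fun p => pfun c (clamp (L p))); split=> [|t|t|s].
- exact: comp_continuous (clamp_comp_continuous cL) (@pth_continuous _ _ c).
- by rewrite ef /L; cbn [fst snd]; rewrite val_zero subr0 mul1r mul0r addr0 clampK.
- by rewrite eg /L; cbn [fst snd]; rewrite val_one subrr mul1r mul0r add0r clampK.
- rewrite /L; cbn [fst snd]; rewrite e0 e1 -!mulrDl !subrK !mul1r !clampK.
  by rewrite -[pfun c (psi zero)]eg -[pfun c (psi one)]eg pth0 pth1.
Qed.

Lemma ph_eq x y (f g : pth x y) : pfun f =1 pfun g -> ph f g.
Proof.
move=> fg; apply: (@ph_reparam _ _ _ _ f _ _ id id) => //; try exact: cont_id.
by move=> t; rewrite -fg.
Qed.

Lemma ph_refl x y (f : pth x y) : ph f f. Proof. exact: ph_eq. Qed.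

Lemma ph_sym x y (f g : pth x y) : ph f g -> ph g f.
Proof.
move=> [H [cH Ha Hb Hs]].
exists (fun p => H (affI (-1) 1 p.1, p.2)); split=> [|t|t|s]; cbn [fst snd].
- apply: comp_continuous cH; apply: pair_continuous; last exact: snd_continuous.
  exact/affI_continuous/fst_continuous.
- by rewrite affI1 // val_zero mulr0 add0r.
- by rewrite affI0 // val_one mulr1 addNr.
- exact: Hs.
Qed.

Definition pcat x y z (f : pth x y) (g : pth y z) : pth x z.
Proof.
apply: (@mkpth x z (fun t => if val t <= 2^-1 then pfun f (affI 2 0 t) else pfun g (affI 2 (-1) t))).
- apply: (@half_continuous R T I id); first exact: cont_id.
  + by apply: comp_continuous (@pth_continuous _ _ f); exact/affI_continuous/cont_id.
  + by apply: comp_continuous (@pth_continuous _ _ g); exact/affI_continuous/cont_id.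
  + by move=> t t2; rewrite affI1 ?affI0 ?pth0 ?pth1 //; rewrite t2; lra.
- by rewrite val_zero invr_ge0 ler0n affI0 ?pth0 // val_zero; lra.
- rewrite val_one ifF ?affI1 ?pth1 ?val_one //; first lra.
  by apply/negbTE; lra.
Defined.

Lemma pcatE x y z (f : pth x y) (g : pth y z) t : pfun (pcat f g) t =
  if val t <= 2^-1 then pfun f (affI 2 0 t) else pfun g (affI 2 (-1) t).
Proof. by []. Qed.

Definition prev x y (f : pth x y) : pth y x.
Proof.
apply: (@mkpth y x (fun t => pfun f (affI (-1) 1 t))).
- by apply: comp_continuous (@pth_continuous _ _ f); exact/affI_continuous/cont_id.
- by rewrite affI1 ?pth1 // val_zero; lra.
- by rewrite affI0 ?pth0 // val_one; lra.
Defined.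

Lemma prevE x y (f : pth x y) t : pfun (prev f) t = pfun f (affI (-1) 1 t).
Proof. by []. Qed.

Definition pcst x : pth x x := @mkpth x x (cst x) (@cst_continuous _ _ _) erefl erefl.

Lemma ph_cat x y z (f f' : pth x y) (g g' : pth y z) : ph f f' -> ph g g' ->
  ph (pcat f g) (pcat f' g').
Proof.
move=> [H [cH Ha Ha' Hs]] [K [cK Kb Kb' Ks]].
exists (fun p => if val p.2 <= 2^-1 then H (p.1, affI 2 0 p.2)
                 else K (p.1, affI 2 (-1) p.2)); split=> [|t|t|s]; cbn [fst snd].
- apply: half_continuous; first exact: snd_continuous.
  + apply: comp_continuous cH; apply: pair_continuous; first exact: fst_continuous.
    exact/affI_continuous/snd_continuous.
  + apply: comp_continuous cK; apply: pair_continuous; first exact: fst_continuous.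
    exact/affI_continuous/snd_continuous.
  + move=> [s t]; cbn [fst snd] => t2.
    rewrite affI1 ?affI0 ?(proj1 (Ks _)) ?(proj2 (Hs _)) //; rewrite t2; lra.
- by rewrite Ha Kb.
- by rewrite Ha' Kb'.
- split.
    by rewrite val_zero invr_ge0 ler0n affI0 ?(proj1 (Hs _)) // val_zero; lra.
  rewrite val_one ifF ?affI1 ?(proj2 (Ks _)) ?val_one //; first lra.
  by apply/negbTE; lra.
Qed.

Lemma ph_1cat x y (f : pth x y) : ph (pcat (pcst x) f) f.
Proof.
apply: (@ph_reparam _ _ _ _ f _ _ (affI 2 (-1)) id).
- exact/affI_continuous/cont_id.
- exact: cont_id.
- by rewrite affI0 // val_zero; lra.
- by rewrite affI1 // val_one; lra.
- move=> t; rewrite pcatE /comp; case: ifP => // t2.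
  by rewrite (@affI0 R 2 (-1)) ?pth0 //; lra.
- by [].
Qed.

Lemma ph_cat1 x y (f : pth x y) : ph (pcat f (pcst y)) f.
Proof.
apply: (@ph_reparam _ _ _ _ f _ _ (affI 2 0) id).
- exact/affI_continuous/cont_id.
- exact: cont_id.
- by rewrite affI0 // val_zero; lra.
- by rewrite affI1 // val_one; lra.
- move=> t; rewrite pcatE /comp; case: ifPn => //; rewrite -ltNge => t2.
  by rewrite (@affI1 R 2 0) ?pth1 //; lra.
- by [].
Qed.

Lemma ph_catV x y (f : pth x y) : ph (pcat f (prev f)) (pcst x).
Proof.
apply: (@ph_reparam _ _ _ _ f _ _ (@tent R) (fun=> zero)).
- by apply: pasteI_continuous; lra.
- exact: cst_continuous.
- by rewrite /tent val_zero invr_ge0 ler0n affI0 // val_zero; lra.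
- rewrite /tent val_one ifF; last by apply/negbTE; lra.
  by rewrite affI0 // val_one; lra.
- move=> t; rewrite pcatE prevE /comp /tent; case: ifPn => //.
  rewrite -ltNge => t2; have := I01 t => /andP[t0 t1].
  congr (pfun f _); apply: val_inj; rewrite !affI_val ?affI_val; lra.
- by move=> t; rewrite /= pth0.
Qed.

Lemma prevK x y (f : pth x y) : ph (prev (prev f)) f.
Proof.
apply: ph_eq => t; rewrite !prevE; congr (pfun f _); have := I01 t => /andP[t0 t1].
by apply: val_inj; rewrite !affI_val ?affI_val; lra.
Qed.

Lemma ph_Vcat x y (f : pth x y) : ph (pcat (prev f) f) (pcst y).
Proof.
apply: ph_trans (ph_catV (prev f)); apply: ph_cat; first exact: ph_refl.
exact/ph_sym/prevK.
Qed.

Lemma ph_catA x y z w (f : pth x y) (g : pth y z) (h : pth z w) :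
  ph (pcat f (pcat g h)) (pcat (pcat f g) h).
Proof.
pose phi (t : I) : I := if val t <= 2^-1 then affI 2^-1 0 t else
  (fun u : I => if val u <= 3 / 4 then affI 1 (- 4^-1) u else affI 2 (-1) u) t.
apply: (@ph_reparam _ _ _ _ (pcat (pcat f g) h) _ _ phi id).
- apply: pasting.
  + exact: I_val_continuous.
  + exact/affI_continuous/cont_id.
  + by apply: pasteI_continuous; lra.
  + by move=> t t2; rewrite t2 ifT; [rewrite /affI t2; congr clamp|]; lra.
- exact: cont_id.
- by rewrite /phi val_zero invr_ge0 ler0n affI0 // val_zero; lra.
- rewrite /phi val_one ifF; last by apply/negbTE; lra.
  rewrite ifF; last by apply/negbTE; lra.
  by rewrite affI1 // val_one; lra.
- move=> t; have /andP[t0 t1] := I01 t; rewrite /comp [LHS]pcatE [RHS]pcatE.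
  have [t2|t2] := leP (val t) 2^-1.
    have vp : val (phi t) = 2^-1 * val t by rewrite /phi t2 affI_val; lra.
    have -> : val (phi t) <= 2^-1 by rewrite vp; lra.
    have e2 : affI 2 0 (phi t) = t by apply: val_inj; rewrite affI_val vp; lra.
    by rewrite pcatE e2 t2.
  have v2 : val (affI 2 (-1) t) = 2 * val t - 1 by rewrite affI_val; lra.
  have [t4|t4] := leP (val t) (3 / 4).
    have vp : val (phi t) = val t - 4^-1.
      by rewrite /phi ifF ?ifT ?affI_val; try lra; apply/negbTE; lra.
    have -> : val (phi t) <= 2^-1 by rewrite vp; lra.
    have e2 : val (affI 2 0 (phi t)) = 2 * val t - 2^-1 by rewrite affI_val vp; lra.
    rewrite !pcatE v2 e2 ifT; last lra.
    rewrite ifF; last by apply/negbTE; lra.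
    congr (pfun g _); apply: val_inj.
    by rewrite (@affI_val R 2 0) ?v2 ?(@affI_val R 2 (-1)) ?e2; lra.
  have ep : phi t = affI 2 (-1) t by rewrite /phi ifF ?ifF //; apply/negbTE; lra.
  rewrite ep pcatE v2 ifF; last by apply/negbTE; lra.
  by rewrite ifF //; apply/negbTE; lra.
- by [].
Qed.

Section classes.
Variables (x0 : T) (beta : forall x, pth x0 x).
Hypothesis beta0 : ph (beta x0) (pcst x0).
Local Notation pi1 := (pi1 R x0).

Lemma pi_eq (a b : loop R x0) : ph (a : pth x0 x0) b -> \pi_pi1 a = \pi_pi1 b.
Proof. by move=> ab; apply/pi_pi1P. Qed.

(** The paths [beta] close every path up to a loop, which turns the fundamental groupoid into the
    fundamental group. *)
Definition cls x y (f : pth x y) : pi1 := \pi_pi1 (pcat (pcat (beta x) f) (prev (beta y)) : loop R x0).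

Lemma pi_pcat (a b : loop R x0) :
  \pi_pi1 (pcat (a : pth x0 x0) b : loop R x0) = (\pi_pi1 a * \pi_pi1 b)%g.
Proof.
transitivity (\pi_pi1 (concat a b)); first by apply: pi_eq; exact: ph_eq.
by rewrite -pi_concat.
Qed.

Lemma cls_ph x y (f g : pth x y) : ph f g -> cls f = cls g.
Proof. by move=> fg; apply: pi_eq; do 2!(apply: ph_cat; last exact: ph_refl || exact: fg); exact: ph_refl. Qed.

Lemma cls_cat x y z (f : pth x y) (g : pth y z) : cls (pcat f g) = (cls f * cls g)%g.
Proof.
rewrite /cls -pi_pcat; apply: pi_eq; apply: ph_sym.
set A := pcat (beta x) f; set B := beta y; set C := prev (beta z).
refine (ph_trans (ph_sym (ph_catA A (prev B) (pcat (pcat B g) C))) _).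
apply: (@ph_trans _ _ _ (pcat A (pcat g C))).
  apply: ph_cat; first exact: ph_refl.
  apply: ph_trans (ph_catA _ _ _) _; apply: ph_cat; last exact: ph_refl.
  apply: ph_trans (ph_catA _ _ _) _; apply: ph_trans (ph_1cat _).
  by apply: ph_cat (ph_refl _); exact: ph_Vcat.
apply: ph_trans (ph_catA _ _ _) _; apply: ph_cat (ph_refl _).
exact/ph_sym/ph_catA.
Qed.

Lemma cls_loop (a : loop R x0) : cls (a : pth x0 x0) = \pi_pi1 a.
Proof.
apply: pi_eq; apply: (@ph_trans _ _ _ (pcat (a : pth x0 x0) (pcst x0))); last exact: ph_cat1.
apply: ph_cat.
  by apply: ph_trans (ph_1cat _); apply: ph_cat (ph_refl _).
refine (ph_trans (ph_sym (ph_1cat (prev (beta x0)))) _).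
exact: ph_trans (ph_cat (ph_sym beta0) (ph_refl _)) (ph_catV (beta x0)).
Qed.

Lemma cls_cst x : cls (pcst x) = 1%g.
Proof.
transitivity (\pi_pi1 (const_loop R x0)); last by [].
apply: pi_eq; apply: ph_trans (ph_trans _ (ph_catV (beta x))) _; last exact: ph_eq.
by apply: ph_cat (ph_refl _); exact: ph_cat1.
Qed.

Lemma cls_beta x : cls (beta x) = 1%g.
Proof.
transitivity (\pi_pi1 (const_loop R x0)); last by [].
apply: pi_eq; apply: ph_trans (ph_trans _ (ph_catV (beta x))) _; last exact: ph_eq.
apply: ph_cat (ph_refl _); apply: ph_trans (ph_1cat _).
by apply: ph_cat (ph_refl _).
Qed.

Lemma cls_prev x y (f : pth x y) : cls (prev f) = ((cls f)^-1)%g.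
Proof.
apply/esym/mulg1_eq; rewrite -cls_cat -(cls_cst x); apply: cls_ph; exact: ph_catV.
Qed.

End classes.
End path_groupoid.

Section free.
Variables (R : realType) (T : topologicalType).
Local Notation I := (unit_itv R).
Implicit Types f g h : I -> T.

Lemma free_sym f g : free_homotopic f g -> free_homotopic g f.
Proof.
move=> [H [cH Ha Hb Hs]]; exists (fun p => H (affI (-1) 1 p.1, p.2)); split=> [|t|t|s]; cbn [fst snd].
- apply: comp_continuous cH; apply: pair_continuous; last exact: snd_continuous.
  exact/affI_continuous/fst_continuous.
- by rewrite affI1 // val_zero mulr0 add0r.
- by rewrite affI0 // val_one mulr1 addNr.
- exact: Hs.
Qed.

Lemma free_trans f g h : free_homotopic f g -> free_homotopic g h -> free_homotopic f h.
Proof.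
move=> [H [cH Ha Hb Hs]] [K [cK Kb Kc Ks]].
exists (fun p => if val p.1 <= 2^-1 then H (affI 2 0 p.1, p.2)
                 else K (affI 2 (-1) p.1, p.2)); split=> [|t|t|s]; cbn [fst snd].
- apply: half_continuous; first exact: fst_continuous.
  + apply: comp_continuous cH; apply: pair_continuous; last exact: snd_continuous.
    exact/affI_continuous/fst_continuous.
  + apply: comp_continuous cK; apply: pair_continuous; last exact: snd_continuous.
    exact/affI_continuous/fst_continuous.
  + move=> [s t]; cbn [fst snd] => s2; rewrite affI1 ?affI0 ?Hb ?Kb //; rewrite s2; lra.
- by rewrite val_zero invr_ge0 ler0n affI0 // val_zero; lra.
- by rewrite val_one ifF ?affI1 ?val_one //; [lra|apply/negbTE; lra].
- by case: ifP.
Qed.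

Lemma ph_free (x : T) (f g : pth R x x) : ph f g -> free_homotopic (pfun f) (pfun g).
Proof. by move=> [H [cH Ha Hb Hs]]; exists H; split=> // s; rewrite (Hs s).1 (Hs s).2. Qed.

(* Slide the base point of the conjugate along the conjugating path. *)
Lemma free_conj (x y : T) (b : pth R x y) (f : pth R y y) :
  free_homotopic (pfun (pcat (pcat b f) (prev b))) (pfun f).
Proof.
apply: (@free_trans _ (pfun (pcat (pcat (pcst R y) f) (prev (pcst R y))))); last first.
  apply: ph_free; apply: ph_trans (ph_cat1 _); apply: ph_cat; first exact: ph_1cat.
  exact: ph_eq.
pose L (p : I * I) : I := clamp (val p.1 + (1 - val p.1) * val p.2).
have cv := @I_val_continuous R.
have cL : continuous L.
  apply: clamp_comp_continuous.
  have c1 : continuous (fun p : I * I => val p.1 : R) by exact: comp_continuous (@fst_continuous _ _) cv.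
  have c2 : continuous (fun p : I * I => val p.2 : R) by exact: comp_continuous (@snd_continuous _ _) cv.
  apply: add_continuous => //; apply: mul_continuous => //; apply: sub_continuous => //.
  exact: cst_continuous.
have L0 t : L (zero, t) = t by rewrite /L; cbn [fst snd]; rewrite val_zero add0r subr0 mul1r clampK.
have L1 t : L (one, t) = one by rewrite /L; cbn [fst snd]; rewrite val_one subrr mul0r addr0.
have Lt s : L (s, one) = one by rewrite /L; cbn [fst snd]; rewrite val_one mulr1 addrC subrK.
pose bb p := pfun b (L p).
have cbb : continuous bb by exact: comp_continuous cL (@pth_continuous _ _ _ _ b).
have ca (m c : R) : continuous (fun p : I * I => (p.1, affI m c p.2)).
  apply: pair_continuous; first exact: fst_continuous.
  exact/affI_continuous/snd_continuous.
pose W (q : I * I) := if val q.2 <= 2^-1 then bb (q.1, affI 2 0 q.2) else pfun f (affI 2 (-1) q.2).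
have cW : continuous W.
  apply: half_continuous; first exact: snd_continuous.
  + exact: comp_continuous (ca 2 0) cbb.
  + apply: comp_continuous (@pth_continuous _ _ _ _ f); exact/affI_continuous/snd_continuous.
  + move=> [s t]; cbn [fst snd] => t2.
    rewrite affI1 ?affI0 ?pth0; [|rewrite t2; lra..].
    by rewrite /bb Lt pth1.
exists (fun p => if val p.2 <= 2^-1 then W (p.1, affI 2 0 p.2)
  else bb (p.1, affI (-1) 1 (affI 2 (-1) p.2))); split=> [|t|t|s]; rewrite /W; cbn [fst snd].
- apply: half_continuous; first exact: snd_continuous.
  + exact: comp_continuous (ca 2 0) cW.
  + apply: (comp_continuous (f := fun p : I * I => (p.1, affI (-1) 1 (affI 2 (-1) p.2))) _ cbb).
    apply: pair_continuous; first exact: fst_continuous.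
    exact/affI_continuous/affI_continuous/snd_continuous.
  + move=> [s t]; cbn [fst snd] => t2; have e1 : affI 2 0 t = one by rewrite affI1 // t2; lra.
    have e2 : affI 2 (-1) t = zero by rewrite affI0 // t2; lra.
    rewrite e1 e2 val_one ifF; last by apply/negbTE; lra.
    rewrite affI1 ?pth1; last by rewrite val_one; lra.
    by rewrite affI1 ?val_zero /bb ?Lt ?pth1 //; lra.
- by rewrite !pcatE prevE /bb !L0.
- by rewrite !pcatE prevE /bb !L1 pth1.
- have h0 : val (zero : I) <= 2^-1 by rewrite val_zero; lra.
  have h1 : (val (one : I) <= 2^-1) = false by rewrite val_one; apply/negbTE; lra.
  have e1 : affI 2 0 (zero : I) = zero by rewrite affI0 // val_zero; lra.
  have e2 : affI 2 (-1) (one : I) = one by rewrite affI1 // val_one; lra.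
  rewrite h0 h1 e1 e2 h0 e1; congr (bb (_, _)).
  by rewrite affI0 // val_one; lra.
Qed.

End free.

(** * The fundamental group is recovered by universal labels *)

Section convex_paths.
Variable (R : realType).
Local Notation I := (unit_itv R).
Local Notation pt := (R * R)%type.
Local Notation X := (sphere4 R).
Local Notation bp := (basepoint R).

Definition lerp (t : R) (p q : pt) : pt := ((1 - t) * p.1 + t * q.1, (1 - t) * p.2 + t * q.2).

Definition cvx (V : set pt) : Prop :=
  (forall p q t, 0 <= t <= 1 -> V p -> V q -> V (lerp t p q)) /\ V `<=` ~` @finite_punctures R.

Lemma chart_cvx c : cvx (chart c).
Proof.
split=> [p q t|p]; first exact: chart_convex.
exact: chart_sphere4.
Qed.

Definition to4 (p : pt) : X := insubd bp p.

Lemma to4E p : (~` @finite_punctures R) p -> val (to4 p) = p.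
Proof. by move=> h; rewrite /to4 val_insubd mem_set. Qed.

Lemma to4K (x : X) : to4 (val x) = x.
Proof. exact: valKd. Qed.

Lemma lerp0 p q : lerp 0 p q = p.
Proof. by case: p => a b; rewrite /lerp /= subr0 !mul1r !mul0r !addr0. Qed.

Lemma lerp1 p q : lerp 1 p q = q.
Proof. by case: q => a b; rewrite /lerp /= subrr !mul1r !mul0r !add0r. Qed.

Lemma to4_continuous (S : topologicalType) (F : S -> pt) : continuous F ->
  (forall s, (~` @finite_punctures R) (F s)) -> continuous (fun s => to4 (F s)).
Proof.
move=> cF h; apply: (@continuous_comp_initial X S pt (fun x => val x)).
by have -> : (fun x : X => val x) \o (fun s => to4 (F s)) = F by apply/funext => s; rewrite /= to4E.
Qed.

Lemma lerp_continuous (S : topologicalType) (t : S -> R) (F K : S -> pt) :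
  continuous t -> continuous F -> continuous K -> continuous (fun s => lerp (t s) (F s) (K s)).
Proof.
move=> ct cF cK; have c1 : continuous (fun s => 1 - t s).
  by apply: sub_continuous => //; exact: cst_continuous.
have [cF1 cF2] : continuous (fun s => (F s).1) /\ continuous (fun s => (F s).2).
  by split; [exact: comp_continuous cF (@fst_continuous _ _)|exact: comp_continuous cF (@snd_continuous _ _)].
have [cK1 cK2] : continuous (fun s => (K s).1) /\ continuous (fun s => (K s).2).
  by split; [exact: comp_continuous cK (@fst_continuous _ _)|exact: comp_continuous cK (@snd_continuous _ _)].
by apply: pair_continuous; apply: add_continuous; apply: mul_continuous.
Qed.

Lemma cvx_ph V (x y : X) (f g : pth R x y) : cvx V -> (forall t, V (val (pfun f t))) ->
  (forall t, V (val (pfun g t))) -> ph f g.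
Proof.
move=> [cV Vp] Vf Vg; have cv := @I_val_continuous R.
pose F (p : I * I) := lerp (val p.1) (val (pfun f p.2)) (val (pfun g p.2)).
have VF p : V (F p) by apply: cV => //; exact: I01.
exists (fun p => to4 (F p)); split=> [|t|t|s].
- apply: to4_continuous => [|p]; last exact/Vp/VF.
  apply: lerp_continuous.
  + exact: comp_continuous (@fst_continuous _ _) cv.
  + apply: (comp_continuous (f := fun p : I * I => pfun f p.2) _ (@sphere4_val_continuous R)).
    exact: comp_continuous (@snd_continuous _ _) (@pth_continuous _ _ _ _ f).
  + apply: (comp_continuous (f := fun p : I * I => pfun g p.2) _ (@sphere4_val_continuous R)).
    exact: comp_continuous (@snd_continuous _ _) (@pth_continuous _ _ _ _ g).
- by rewrite /F; cbn [fst snd]; rewrite val_zero lerp0 to4K.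
- by rewrite /F; cbn [fst snd]; rewrite val_one lerp1 to4K.
- rewrite /F; cbn [fst snd]; rewrite !pth0 !pth1.
  have e (p : pt) t : lerp t p p = p.
    by case: p => a b; rewrite /lerp /= -!mulrDl !subrK !mul1r.
  by rewrite !e !to4K.
Qed.

(** A substitute for being a straight segment: only membership in convex sets is ever used, never
    the parametrisation. *)
Definition geodesic (x y : X) (f : pth R x y) : Prop :=
  forall V, cvx V -> V (val x) -> V (val y) -> forall t, V (val (pfun f t)).

Lemma geodesic_exists V (x y : X) : cvx V -> V (val x) -> V (val y) ->
  exists f : pth R x y, geodesic f.
Proof.
move=> [cV Vp] Vx Vy; pose F (t : I) := lerp (val t) (val x) (val y).
have VF t : V (F t) by apply: cV => //; exact: I01.
have cF : continuous (fun t => to4 (F t)).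
  apply: to4_continuous => [|p]; last exact/Vp/VF.
  apply: lerp_continuous; [exact: I_val_continuous|exact: cst_continuous|exact: cst_continuous].
have F0 : to4 (F zero) = x by rewrite /F val_zero lerp0 to4K.
have F1 : to4 (F one) = y by rewrite /F val_one lerp1 to4K.
exists (mkpth cF F0 F1) => W [cW Wp] Wx Wy t; rewrite -[pfun _ _]/(to4 (F t)) to4E.
  by apply: cW => //; exact: I01.
exact/Vp/VF.
Qed.

Lemma cat_in (V : set pt) (x y z : X) (f : pth R x y) (g : pth R y z) : (forall t, V (val (pfun f t))) ->
  (forall t, V (val (pfun g t))) -> forall t, V (val (pfun (pcat f g) t)).
Proof. by move=> Vf Vg t; rewrite pcatE; case: ifP. Qed.

End convex_paths.

Section universal.
Variable (R : realType).
Local Notation I := (unit_itv R).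
Local Notation pt := (R * R)%type.
Local Notation X := (sphere4 R).
Local Notation bp := (basepoint R).
Local Notation pi1 := (pi1 R bp).

(* The lower half plane together with its boundary edge in the j-th strip. *)
Definition low_edge (j : nat) : set pt := [set p | p.2 < 0 \/ p.2 = 0 /\ chart j p].

Lemma low_edge_cvx j : (j < 4)%N -> cvx (low_edge j).
Proof.
move=> j4; split; last first.
  move=> p [p0|[_ /chart_sphere4//]].
  by apply: (@chart_sphere4 _ 4).
move=> p q t t01 Vp Vq; have [->|t0] := eqVneq t 0; first by rewrite lerp0.
have [->|t1] := eqVneq t 1; first by rewrite lerp1.
have {t0} t0 : 0 < t by rewrite lt_neqAle eq_sym t0; case/andP: t01.
have {t1} t1 : t < 1 by rewrite lt_neqAle t1; case/andP: t01.
case: p q Vp Vq => [a b] [c d]; rewrite /low_edge /lerp /= => -[b0|[b0 cb]] [d0|[d0 cd]].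
- by left; nra.
- by left; rewrite d0; nra.
- by left; rewrite b0; nra.
- right; split; first by rewrite b0 d0 !mulr0 addr0.
  exact: chart_convex cb cd.
Qed.

Definition edge_pt (j : nat) : R :=
  if j is 0%N then -2 else if j is 1%N then - 2^-1 else if j is 2%N then 2^-1 else 2.

Lemma edge_chart j y : (j < 4)%N -> chart j (edge_pt j, y).
Proof. by case: j => [|[|[|[|//]]]] _; rewrite /chart /edge_pt /=; lra. Qed.

Definition lo (j : nat) : X := to4 (edge_pt j, -1).
Definition hi (j : nat) : X := to4 (edge_pt j, 1).

Lemma loE j : val (lo j) = (edge_pt j, -1).
Proof. by apply: to4E; apply: (@chart_sphere4 _ 4); rewrite /chart /=; lra. Qed.
Lemma hiE j : val (hi j) = (edge_pt j, 1).
Proof. by apply: to4E; apply: (@chart_sphere4 _ 5); rewrite /chart /=; lra. Qed.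

Lemma cross_exists j : exists f : pth R (lo j) (hi j), geodesic f.
Proof.
suff h c : (c < 4)%N -> (forall y, chart c (edge_pt j, y)) ->
    exists f : pth R (lo j) (hi j), geodesic f.
  have [j4|j4] := ltnP j 4; first by apply: (h j j4) => y; exact: edge_chart.
  apply: (h 3%N isT) => y; case: j j4 {h} => [|[|[|[|j]]]] // _; rewrite /chart /edge_pt /=; lra.
move=> c4 hc; have [|| f gf] := @geodesic_exists R (chart c) (lo j) (hi j) (chart_cvx _ _).
- by rewrite loE.
- by rewrite hiE.
by exists f.
Qed.

Definition cross j : pth R (lo j) (hi j) := projT1 (cid (cross_exists j)).
Lemma cross_geodesic j : geodesic (cross j).
Proof. exact: projT2 (cid (cross_exists j)). Qed.

Lemma bp_low j : low_edge j (val bp).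
Proof. by left; rewrite /=; lra. Qed.

Lemma lo_low i j : low_edge j (val (lo i)).
Proof. by left; rewrite loE /=; lra. Qed.

Lemma hi_high j : chart 5 (val (hi j)).
Proof. by rewrite hiE /chart /=; lra. Qed.

Lemma low_point (x : X) : (val x).2 <= 0 -> exists2 j, (j < 4)%N & low_edge j (val x).
Proof.
rewrite le_eqVlt => /orP[/eqP x0|x0]; last by exists 0%N => //; left.
have [c hc] := chart_cover (@sphere4P _ x).
case: c hc => [|[|[|[|[|c]]]]] hc; try by [exists 0%N => //; right|exists 1%N => //; right
 |exists 2%N => //; right|exists 3%N => //; right].
  by move: hc; rewrite /chart /= x0; lra.
by move: hc; rewrite /chart /= x0; lra.
Qed.

(** The connecting paths form a tree: straight to points on or below the axis, and to points above
    it always by crossing in strip [0]. Hence paths within the lower or the upper half-plane get the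
    trivial class. *)
Lemma beta_exists (x : X) : exists f : pth R bp x,
  ((val x).2 <= 0 -> geodesic f) /\
  (0 < (val x).2 -> exists (g : pth R bp (lo 0)) (h : pth R (hi 0) x),
     [/\ geodesic g, geodesic h & f = pcat (pcat g (cross 0)) h]).
Proof.
have [x0|x0] := lerP (val x).2 0.
  have [j j4 jx] := low_point x0.
  have [f gf] := geodesic_exists (low_edge_cvx j4) (bp_low j) jx.
  by exists f; split.
have [g gg] := geodesic_exists (low_edge_cvx (isT : (0 < 4)%N)) (bp_low 0) (lo_low 0 0).
have [h gh] := geodesic_exists (chart_cvx R 5) (hi_high 0) (x0 : chart 5 (val x)).
exists (pcat (pcat g (cross 0)) h); split; last by move=> _; exists g, h.
by [].
Qed.

Definition beta (x : X) : pth R bp x := projT1 (cid (beta_exists x)).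
Lemma betaP (x : X) : ((val x).2 <= 0 -> geodesic (beta x)) /\
  (0 < (val x).2 -> exists (g : pth R bp (lo 0)) (h : pth R (hi 0) x),
     [/\ geodesic g, geodesic h & beta x = pcat (pcat g (cross 0)) h]).
Proof. exact: projT2 (cid (beta_exists x)). Qed.

Lemma beta_bp : ph (beta bp) (pcst R bp).
Proof.
have gb : geodesic (beta bp) by apply: (betaP bp).1; rewrite /=; lra.
have V4 : cvx (chart (R := R) 4) := chart_cvx R 4.
have b4 : chart 4 (val bp) by rewrite /chart /=; lra.
by apply: (cvx_ph V4) => [t|t //]; exact: gb.
Qed.

Local Notation cls := (cls beta).

Lemma cls_low j (x y : X) (p : pth R x y) : (j < 4)%N -> (forall t, low_edge j (val (pfun p t))) ->
  cls p = 1%g.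
Proof.
move=> j4 Vp; have Vx : low_edge j (val x) by rewrite -(pth0 p); exact: Vp.
have Vy : low_edge j (val y) by rewrite -(pth1 p); exact: Vp.
have neg z : low_edge j z -> z.2 <= 0 by case=> [/ltW//|[-> _]].
have gx := (betaP x).1 (neg _ Vx); have gy := (betaP y).1 (neg _ Vy).
have cV := low_edge_cvx j4.
have : cls (pcat (beta x) p) = cls (beta y).
  apply: cls_ph; apply: (cvx_ph cV); last exact: gy cV (bp_low j) Vy.
  by apply: cat_in => //; exact: gx cV (bp_low j) Vx.
by rewrite cls_cat ?(cls_beta beta_bp) ?mul1g.
Qed.

Lemma cls_high (x y : X) (p : pth R x y) : (forall t, chart 5 (val (pfun p t))) -> cls p = 1%g.
Proof.
move=> Vp; have Vx : chart 5 (val x) by rewrite -(pth0 p); exact: Vp.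
have Vy : chart 5 (val y) by rewrite -(pth1 p); exact: Vp.
have [g [h [gg gh ex]]] := (betaP x).2 Vx; have [g' [h' [gg' gh' ey]]] := (betaP y).2 Vy.
have cV := chart_cvx R 5.
have e : cls (pcat h p) = cls h'.
  apply: cls_ph; apply: (cvx_ph cV); last exact: gh' cV (hi_high 0) Vy.
  by apply: cat_in => //; exact: gh cV (hi_high 0) Vx.
have g1 (f : pth R bp (lo 0)) : geodesic f -> cls f = 1%g.
  move=> gf; apply: (@cls_low 0) => // t; apply: gf (low_edge_cvx (isT : (0 < 4)%N)) (bp_low 0) (lo_low 0 0) t.
have hx := cls_beta beta_bp x; have hy := cls_beta beta_bp y.
rewrite ex !cls_cat ?(g1 g gg) ?mul1g // in hx.
rewrite ey !cls_cat ?(g1 g' gg') ?mul1g // in hy.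
move: e; rewrite cls_cat // => e.
by apply: (mulgI (cls h)); rewrite e mulg1; apply: (mulgI (cls (cross 0))); rewrite hx hy.
Qed.

(** The loop that crosses the axis upwards in strip [j] and comes back down through strip [0]. *)
Definition kappa (j : nat) : pi1 := cls (cross j).

(** Convexity allows replacing the path by any other in the chart. In a strip, an upward path
    becomes a detour through the reference crossing [cross c], whose two outer parts lie in
    half-planes and have trivial class. *)
Lemma cls_chart c (x y : X) (p : pth R x y) : (forall t, chart c (val (pfun p t))) ->
  cls p = tau kappa (val x) (val y).
Proof.
move=> Vp; have Vx : chart c (val x) by rewrite -(pth0 p); exact: Vp.
have Vy : chart c (val y) by rewrite -(pth1 p); exact: Vp.
have [c4|c4] := ltnP c 4; last first.
  case: (ltngtP c 4) c4 => // [c5|ec] _; last first.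
    rewrite (@cls_low 0) // => [|t]; last by left; move: (Vp t); rewrite ec.
    have h (z : pt) : chart c z -> (0 < z.2) = false by rewrite ec => /lt_gtF.
    by rewrite /tau !h.
  have h (z : pt) : chart c z -> 0 < z.2 by case: c c5 {Vp Vx Vy} => [|[|[|[|[|c]]]]].
  have -> : tau kappa (val x) (val y) = 1%g by rewrite /tau (h _ Vx) (h _ Vy).
  by apply: cls_high => t; exact: h (Vp t).
have sx := chart_strip c4 Vx; have sy := chart_strip c4 Vy.
have cV := chart_cvx R c.
have up_case (a b : X) (f : pth R a b) : (forall t, chart c (val (pfun f t))) ->
    (val a).2 <= 0 -> 0 < (val b).2 -> cls f = kappa c.
  move=> Vf a0 b0; have Va : chart c (val a) by rewrite -(pth0 f); exact: Vf.
  have Vb : chart c (val b) by rewrite -(pth1 f); exact: Vf.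
  have La : low_edge c (val a).
    by move: a0; rewrite le_eqVlt => /orP[/eqP|]; [right|left].
  have lc : chart c (val (lo c)) by rewrite loE; exact: edge_chart.
  have hc : chart c (val (hi c)) by rewrite hiE; exact: edge_chart.
  have [g1 gg1] := geodesic_exists cV Va lc.
  have [g3 gg3] := geodesic_exists cV hc Vb.
  have -> : cls f = cls (pcat g1 (pcat (cross c) g3)).
    apply: cls_ph; apply: (cvx_ph cV) => //; apply: cat_in; first exact: gg1.
    apply: cat_in; last exact: gg3.
    exact: cross_geodesic.
  rewrite !cls_cat (@cls_low c _ _ g1) // ?mul1g.
    rewrite (@cls_high _ _ g3) ?mulg1 // => t.
    by apply: (gg3 _ (chart_cvx R 5)) => //; exact: hi_high.
  by move=> t; apply: (gg1 _ (low_edge_cvx c4)) => //; exact: lo_low.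
have [q gq] := geodesic_exists cV Vx Vy.
have pq : cls p = cls q by apply: cls_ph; apply: (cvx_ph cV) => //; exact: gq.
rewrite /tau; have [x0|x0] := ltrP 0 (val x).2; have [y0|y0] := ltrP 0 (val y).2 => /=.
- by rewrite pq cls_high // => t; apply: (gq _ (chart_cvx R 5)).
- rewrite -[LHS]invgK -cls_prev; congr (_^-1)%g; rewrite sx; apply: up_case => // t.
  exact: Vp.
- by rewrite sy; exact: up_case.
- rewrite pq (@cls_low c) // => t; apply: (gq _ (low_edge_cvx c4)).
    by move: x0; rewrite le_eqVlt => /orP[/eqP|]; [right|left].
  by move: y0; rewrite le_eqVlt => /orP[/eqP|]; [right|left].
Qed.

Lemma sub_continuous_path (x y : X) (f : pth R x y) (r s : R) :
  continuous (fun t : I => pfun f (clamp (r + (s - r) * val t))).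
Proof.
apply: (comp_continuous (f := fun t : I => clamp (r + (s - r) * val t)) _ (@pth_continuous _ _ _ _ f)).
apply: clamp_comp_continuous; apply: add_continuous; first exact: cst_continuous.
by apply: mul_continuous; [exact: cst_continuous|exact: I_val_continuous].
Qed.

Lemma sub0 (x y : X) (f : pth R x y) r s : pfun f (clamp (r + (s - r) * val (zero : I))) = pfun f (clamp r).
Proof. by rewrite val_zero mulr0 addr0. Qed.

Lemma sub1 (x y : X) (f : pth R x y) r s : pfun f (clamp (r + (s - r) * val (one : I))) = pfun f (clamp s).
Proof. by rewrite val_one mulr1 addrC subrK. Qed.

Definition subpath (x y : X) (f : pth R x y) (r s : R) : pth R (pfun f (clamp r)) (pfun f (clamp s)) :=
  mkpth (@sub_continuous_path x y f r s) (sub0 f r s) (sub1 f r s).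

Lemma subpath_cat (x y : X) (f : pth R x y) (r s u : R) :
  ph (subpath f r u) (pcat (subpath f r s) (subpath f s u)).
Proof.
pose psi (t : I) : I := if val t <= 2^-1 then clamp (r + (s - r) * val (affI 2 0 t))
  else clamp (s + (u - s) * val (affI 2 (-1) t)).
have cc (a b m c : R) : continuous (fun t : I => clamp (a + b * val (affI m c t)) : I).
  apply: clamp_comp_continuous; apply: add_continuous; first exact: cst_continuous.
  apply: mul_continuous; first exact: cst_continuous.
  apply: (comp_continuous (f := affI m c)); last exact: I_val_continuous.
  exact/affI_continuous/cont_id.
apply: (@ph_reparam _ _ _ _ _ _ f _ _ (fun t => clamp (r + (u - r) * val t)) psi).
- apply: clamp_comp_continuous; apply: add_continuous; first exact: cst_continuous.
  by apply: mul_continuous; [exact: cst_continuous|exact: I_val_continuous].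
- apply: (@half_continuous R I I id); [exact: cont_id|exact: cc|exact: cc|].
  move=> t t2; rewrite affI1 ?affI0 ?val_one ?val_zero; try (rewrite t2; lra).
  by rewrite mulr1 mulr0 addr0 addrC subrK.
- have h0 : val (zero : I) <= 2^-1 by rewrite val_zero; lra.
  by rewrite /psi h0 affI0 ?val_zero ?mulr0 ?addr0 //; lra.
- have h1 : (val (one : I) <= 2^-1) = false by rewrite val_one; apply/negbTE; lra.
  rewrite /psi h1 affI1 ?val_one; last lra.
  by rewrite !mulr1 ![_ + (u - _)]addrC !subrK.
- by [].
- by move=> t; rewrite pcatE /psi /=; case: ifP.
Qed.

Lemma cls_ext (x y x' y' : X) (f : pth R x y) (g : pth R x' y') : pfun f =1 pfun g -> cls f = cls g.
Proof.
move=> fg; have ex : x = x' by rewrite -(pth0 f) fg pth0.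
have ey : y = y' by rewrite -(pth1 f) fg pth1.
by subst; apply: cls_ph; exact: ph_eq.
Qed.

(** This plays the role of van Kampen's theorem: a fine subdivision cuts the path into pieces in
    charts, where class and transport agree by [cls_chart]. With the labels [kappa], holonomy is
    therefore a complete invariant. *)
Theorem cls_hol (x y : X) (f : pth R x y) : cls f = hol kappa (pfun f).
Proof.
have [n fn] := fine_exists (@pth_continuous _ _ _ _ f).
rewrite (holE kappa fn) /gridprod; case: fn => n0 fn.
have -> : cls f = cls (subpath f (0%:R / n%:R) (n%:R / n%:R)).
  apply: cls_ext => t; rewrite -[RHS]/(pfun f (clamp (0%:R / n%:R + (n%:R / n%:R - 0%:R / n%:R) * val t))).
  by rewrite mul0r add0r subr0 divff ?mul1r ?clampK // pnatr_eq0 -lt0n.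
suff h i : (i <= n)%N -> cls (subpath f (0%:R / n%:R) (i%:R / n%:R)) =
    tprod kappa (fun i => curve (pfun f) (i%:R / n%:R)) i by exact: h.
elim: i => [_|i IH ltin].
  have -> : cls (subpath f (0%:R / n%:R) (0%:R / n%:R)) = cls (pcst R (pfun f (clamp (0%:R / n%:R)))).
    apply: cls_ext => t.
    move: (0%:R / n%:R) => z.
    by rewrite -[LHS]/(pfun f (clamp (z + (z - z) * val t))) subrr mul0r addr0.
  exact: cls_cst.
have -> : cls (subpath f (0%:R / n%:R) (i.+1%:R / n%:R)) =
    cls (pcat (subpath f (0%:R / n%:R) (i%:R / n%:R)) (subpath f (i%:R / n%:R) (i.+1%:R / n%:R))).
  by apply: cls_ph; exact: subpath_cat.
rewrite cls_cat.
rewrite (IH (ltnW ltin)).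
rewrite -[RHS]/(tprod kappa (fun i => curve (pfun f) (i%:R / n%:R)) i *
  tau kappa (curve (pfun f) (i%:R / n%:R)) (curve (pfun f) (i.+1%:R / n%:R)))%g.
congr (_ * _)%g.
have [c hc] := fn i ltin; apply: (@cls_chart c) => t; apply: hc.
have /andP[t0 t1] := I01 t.
have le1 : (i%:R / n%:R : R) <= i.+1%:R / n%:R.
  by rewrite ler_pM2r ?invr_gt0 ?ltr0n // ler_nat leqnSn.
by nra.
Qed.

End universal.

Section conjugacy.
Variable (R : realType).
Local Notation I := (unit_itv R).
Local Notation X := (sphere4 R).
Local Notation bp := (basepoint R).
Local Notation pi1 := (pi1 R bp).

Lemma hol_pi (a : loop R bp) : \pi_pi1 a = hol (@kappa R) (loop_fun a).
Proof. by rewrite -(cls_loop (@beta_bp R) a) cls_hol. Qed.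

Lemma based_loop (f : I -> X) : continuous f -> f zero = f one ->
  exists a : loop R bp, free_homotopic (loop_fun a) f /\ \pi_pi1 a = hol (@kappa R) f.
Proof.
move=> cf f01; pose p : pth R (f one) (f one) := mkpth cf f01 erefl.
exists (pcat (pcat (@beta R (f one)) p) (prev (@beta R (f one)))); split.
  exact: (free_conj (@beta R (f one)) p).
by rewrite -[RHS](cls_hol p).
Qed.

(** The converse of [hol_free] for universal labels: conjugate classes of based loops mean free
    homotopy, the conjugating loop being removed by sliding the base point. *)
Lemma free_of_conj (f g : I -> X) (h : pi1) : continuous f -> continuous g ->
  f zero = f one -> g zero = g one -> hol (@kappa R) f = (hol (@kappa R) g ^ h)%g ->
  free_homotopic f g.
Proof.
move=> cf cg f01 g01 e.
have [a [fa ea]] := based_loop cf f01; have [b [fb eb]] := based_loop cg g01.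
apply: free_trans (free_sym fa) _; apply: free_trans fb.
pose d : loop R bp := repr (h^-1)%g.
have ed : \pi_pi1 d = (h^-1)%g by rewrite reprK.
apply: free_trans (free_conj (d : pth R bp bp) (b : pth R bp bp)).
suff : \pi_pi1 a = \pi_pi1 (pcat (pcat (d : pth R bp bp) b) (prev (d : pth R bp bp)) : loop R bp).
  by move/pi_pi1P; exact: ph_free.
rewrite !pi_pcat ed ea eb e.
have -> : \pi_pi1 (prev (d : pth R bp bp) : loop R bp) = h.
  by rewrite -(cls_loop (@beta_bp R)) (cls_prev (@beta R)) (cls_loop (@beta_bp R)) ed invgK.
by rewrite conjgE mulgA.
Qed.

End conjugacy.

(** * Replacing a simple closed curve by a simple lattice cycle *)

Section lattice_points.
Variable (R : realType).
Local Notation pt := (R * R)%type.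
Variable N : nat.
Hypothesis N0 : (0 < N)%N.

(** Odd multiples of [1 / (2 N)], so that no vertex lies on the real axis or on a vertical line
    through a puncture. *)
Definition lattice_pt (v : vert) : pt :=
  ((2 * v.1%:~R + 1) / (2 * N%:R), (2 * v.2%:~R + 1) / (2 * N%:R)).

Definition lattice_cell (p : pt) : vert := (Num.floor (N%:R * p.1), Num.floor (N%:R * p.2)).

Let NR : 0 < N%:R :> R. Proof. by rewrite ltr0n. Qed.
Let N2 : 0 < 2 * N%:R :> R. Proof. by rewrite mulr_gt0. Qed.

Lemma lattice_cell_near (x : R) :
  `|(2 * (Num.floor (N%:R * x))%:~R + 1) / (2 * N%:R) - x| <= (N%:R)^-1 / 2.
Proof.
have /andP[] := floor_itv (N%:R * x); move: (Num.floor _) => a.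
rewrite intrD => h1 h2; have iN : N%:R * (N%:R)^-1 = 1 :> R by rewrite divff ?lt0r_neq0.
rewrite invfM; move: (N%:R^-1) iN (invr_gt0 (N%:R : R)) => i iN; rewrite NR => i0.
have ex : x = N%:R * x * i by rewrite mulrAC iN mul1r.
rewrite ler_norml; move: (N%:R * x) ex h1 h2 => y -> h1 h2.
by apply/andP; split; nra.
Qed.

Lemma lattice_cell_step (x y : R) : `|x - y| < (N%:R)^-1 ->
  `|Num.floor (N%:R * x) - Num.floor (N%:R * y)| <= 1.
Proof.
move=> h; have {}h : `|N%:R * x - N%:R * y| < 1.
  by rewrite -mulrBr normrM gtr0_norm // mulrC -ltr_pdivlMr // div1r.
have /andP[a1 a2] := floor_itv (N%:R * x); have /andP[b1 b2] := floor_itv (N%:R * y).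
move: a1 a2 b1 b2 h; move: (Num.floor _) (Num.floor _) => a b; rewrite ltr_norml !intrD => a1 a2 b1 b2 h.
have h1 : (b%:~R : R) < (a + 2)%:~R by rewrite intrD; lra.
have h2 : (a%:~R : R) < (b + 2)%:~R by rewrite intrD; lra.
rewrite !ltr_int in h1 h2; rewrite ler_norml; move: h1 h2; clear; lia.
Qed.

Lemma strip_lattice (a : int) : strip ((2 * a%:~R + 1) / (2 * N%:R) : R) = col_index N a.
Proof.
have key (c : int) : ((2 * a%:~R + 1) / (2 * N%:R) < c%:~R :> R) = (a < c * N%:Z).
  rewrite ltr_pdivrMr //.
  have -> : 2 * a%:~R + 1 = (2 * a + 1)%:~R :> R by rewrite intrD intrM.
  have -> : c%:~R * (2 * N%:R) = (c * (2 * N%:Z))%:~R :> R by rewrite !intrM.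
  by rewrite ltr_int; lia.
rewrite /strip /col_index; have := key (-1); rewrite mulN1r => ->.
by have := key 0; rewrite mul0r => ->; have := key 1; rewrite mul1r => ->.
Qed.

Lemma high_lattice (v : vert) : (0 < (lattice_pt v).2) = high v.
Proof.
rewrite /high /= pmulr_lgt0 ?invr_gt0 //; have -> : 2 * v.2%:~R + 1 = (2 * v.2 + 1)%:~R :> R by rewrite intrD intrM.
by rewrite ltr0z; move: (v.2); lia.
Qed.

Lemma llab_tau (G : groupType) (k : nat -> G) x y : llab N k x y = tau k (lattice_pt x) (lattice_pt y).
Proof. by rewrite /llab /tau !high_lattice !strip_lattice. Qed.

End lattice_points.

Section loop_erasure.
Variable (R : realType).
Local Notation pt := (R * R)%type.
Variable N : nat.
Hypothesis N0 : (0 < N)%N.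
Local Notation tvert := (vert * nat)%type.
Local Notation lp := (@lattice_pt R N).

Definition step (a b : tvert) : bool := (a.1 == b.1) || adj a.1 b.1.

Definition hlist (G : groupType) (k : nat -> G) (s : seq tvert) : G :=
  chol (fun a b => llab N k a.1 b.1) s.

Lemma phol_chart (G : groupType) (k : nat -> G) c (x : tvert) (s : seq tvert) :
  (forall a, a \in x :: s -> chart c (lp a.1)) ->
  phol (fun a b => llab N k a.1 b.1) x s = llab N k x.1 (last x s).1.
Proof.
elim: s x => [|y s IH] x h /=; first by rewrite llab1.
rewrite IH; last by move=> a ay; apply: h; rewrite inE ay orbT.
rewrite !(llab_tau R N0) (@tau_chart _ _ k c) //; apply: h.
- exact: mem_head.
- by rewrite !inE eqxx orbT.
- by rewrite inE mem_last orbT.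
Qed.

Lemma hlist_map (G : groupType) (k : nat -> G) s : hlist k s = chol (llab N k) [seq a.1 | a <- s].
Proof.
rewrite /hlist; case: s => //= x s; rewrite -map_rcons.
by move: (rcons s x) => t; elim: t x => //= y t IH x; rewrite IH.
Qed.

Lemma repeat_split (s : seq tvert) : ~~ uniq [seq a.1 | a <- s] ->
  exists A a B b D, s = A ++ a :: B ++ b :: D /\ a.1 = b.1.
Proof.
elim: s => [//|x s IH] /=; rewrite negb_and negbK => /orP[/mapP[b bs e]|/IH].
  by case/splitPr: bs => B D; exists [::], x, B, b, D.
by case=> A [a [B [b [D [-> e]]]]]; exists (x :: A), a, B, b, D.
Qed.

Lemma step_head a b s : a.1 = b.1 -> path step a s = path step b s.
Proof. by case: s => //= y s e; rewrite /step e. Qed.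

Lemma step_last x s a b : a.1 = b.1 -> path step x (rcons s a) = path step x (rcons s b).
Proof. by move=> e; rewrite !rcons_path /step e. Qed.

Lemma phol_head (G : groupType) (k : nat -> G) (a b : tvert) s : a.1 = b.1 ->
  phol (fun a b => llab N k a.1 b.1) a s = phol (fun a b => llab N k a.1 b.1) b s.
Proof. by case: s => //= y s ->. Qed.

Lemma phol_last (G : groupType) (k : nat -> G) (x a b : tvert) s : a.1 = b.1 ->
  phol (fun a b => llab N k a.1 b.1) x (rcons s a) = phol (fun a b => llab N k a.1 b.1) x (rcons s b).
Proof. by move=> e; rewrite !phol_rcons e. Qed.

Variable near_time : tvert -> Prop.
(* Repeated vertices occur at times that are cyclically close, and the part of
   the walk between two close times stays in a chart. *)
Hypothesis rep_close : forall a b, near_time a -> near_time b -> a.1 = b.1 -> (a.2 <= b.2)%N ->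
  (exists c, forall d, near_time d -> (a.2 <= d.2 <= b.2)%N -> chart c (lp d.1)) \/
  (exists c, forall d, near_time d -> (d.2 <= a.2)%N || (b.2 <= d.2)%N -> chart c (lp d.1)).

(** Loop erasure by induction on the length. Two visits to the same vertex cut the closed walk into
    two closed parts; the one that stays in a chart has trivial holonomy by [phol_chart] and is
    dropped, which changes the holonomy at most by conjugation. The times carried by the vertices
    tell which part is the short one. *)
Lemma erase (s : seq tvert) : s != [::] -> (forall a, a \in s -> near_time a) ->
  sorted (fun a b => a.2 <= b.2)%N s -> cycle step s ->
  exists C, [/\ uniq C, cycle adj C &
    forall (G : groupType) (k : nat -> G), exists g, hlist k s = (chol (llab N k) C ^ g)%g].
Proof.
have [n] := ubnP (size s); elim: n s => // n IH s sn s0 ns ss cs.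
have [us|/repeat_split[A [a [B [b [D [es e]]]]]]] := boolP (uniq [seq a.1 | a <- s]).
  case: s s0 sn ns ss cs us => [//|x [|y s]] _ sn ns ss cs us.
    exists [::]; split=> // G k; exists 1%g.
    by rewrite /hlist /= llab1 mulg1 conj1g.
  exists [seq a.1 | a <- [:: x, y & s]]; split=> // [|G k]; last first.
    by exists 1%g; rewrite conjg1 hlist_map.
  have nn : forall u t, uniq [seq a.1 | a <- u :: t] -> path step u t -> path adj u.1 [seq a.1 | a <- t].
    move=> u t; elim: t u => //= z t IH' u /andP[uz ut] /andP[uzs zt]; rewrite IH' // andbT.
    by case/orP: uzs => // /eqP e; move: uz; rewrite e inE eqxx.
  move: (cs); rewrite /= rcons_path => /and3P[xy ys lx].
  have pxy : path step x (y :: s) by rewrite /= xy.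
  change (path adj x.1 (rcons [seq a.1 | a <- y :: s] x.1)).
  rewrite rcons_path (nn _ _ us pxy) last_map.
  case/orP: lx => // /eqP elx.
  move: us => /= /andP[+ _]; rewrite -elx -map_cons => /negP; case.
  by apply: map_f; exact: mem_last.
have tr : transitive (fun a b : tvert => a.2 <= b.2)%N by move=> y x z; exact: leq_trans.
have ab : (a.2 <= b.2)%N.
  move: ss; rewrite es sorted_cat_cons // => /andP[_]; rewrite (path_sortedE tr) => /andP[/allP h _].
  by apply: h; rewrite mem_cat mem_head orbT.
have na : near_time a by apply: ns; rewrite es mem_cat mem_head orbT.
have nb : near_time b by apply: ns; rewrite es mem_cat inE mem_cat mem_head !orbT.
have cs2 : cycle step (a :: B ++ b :: D ++ A).
  have -> : a :: B ++ b :: D ++ A = (a :: B ++ b :: D) ++ A by rewrite /= -catA.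
  by rewrite -rot_size_cat rot_cycle -es.
have [p1 p2] : path step a (rcons B b) /\ path step b (rcons (D ++ A) a).
  move: cs2; rewrite /cycle rcons_cat rcons_cons -cat_rcons cat_path last_rcons.
  by case/andP.
have [h Hs] : exists h : True, forall (G : groupType) (k : nat -> G), exists g, hlist k s =
    ((phol (fun a b => llab N k a.1 b.1) a (rcons B b) *
      phol (fun a b => llab N k a.1 b.1) b (rcons (D ++ A) a)) ^ g)%g.
  exists I => G k; have [g eg] := chol_rot (fun a b => llab N k a.1 b.1) A (a :: B ++ b :: D).
  exists g; rewrite /hlist es eg; congr (_ ^ g)%g.
  by rewrite /= -catA cat_cons rcons_cat rcons_cons phol_cat.
have inE' d : d \in s = [|| d \in A, d == a, d \in B, d == b | d \in D].
  by rewrite es mem_cat inE mem_cat inE.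
have ss2 := ss; rewrite es in ss2; have := ss2; rewrite (sorted_pairwise tr) pairwise_cat /=.
rewrite pairwise_cat /= allrel_consr allrel_catr allrel_consr all_cat /=.
case/and3P=> /and3P[/allP Aa _ _] _ /andP[/and3P[/allP aB _ _]] /and4P[].
rewrite allrel_consr => /andP[/allP Bb _] _ /allP bD _.
case: (rep_close na nb e ab) => -[c hc].
- have [|||||C [uC cC HC]] := IH (A ++ a :: D).
  + move: sn; rewrite es !size_cat /= size_cat /=; lia.
  + by case: (A).
  + move=> d; rewrite mem_cat inE => h'; apply: ns; rewrite inE'.
    by case/or3P: h' => ->; rewrite ?orbT.
  + refine (subseq_sorted tr _ ss2); rewrite subseq_cat2l -cat1s -[a :: _ ++ _]cat1s.
    rewrite subseq_cat2l; apply: subseq_trans (subseq_cons _ b) _; exact: suffix_subseq.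
  + by rewrite -(rot_cycle (size A)) rot_size_cat /= (step_head _ e).
  exists C; split=> // G k; have [g1 e1] := Hs G k; have [g2 e2] := HC G k.
  have [g3 e3] := chol_rot (fun a b => llab N k a.1 b.1) A (a :: D).
  have t1 : phol (fun a b => llab N k a.1 b.1) a (rcons B b) = 1%g.
    rewrite (@phol_chart _ _ c) ?last_rcons ?e ?llab1 // => d.
    rewrite -rcons_cons mem_rcons !inE => dd; apply: hc.
      by apply: ns; rewrite inE'; case/or3P: dd => ->; rewrite ?orbT.
    by case/or3P: dd => [/eqP ->|/eqP ->|dB]; rewrite ?ab ?leqnn ?aB ?Bb.
  exists (g2 * g3^-1 * g1)%g; rewrite !conjgM -e2 e1 t1 mul1g /hlist e3 conjgK.
  by congr (_ ^ _)%g; rewrite /= (phol_head _ _ e).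
have [|||||C [uC cC HC]] := IH (a :: B).
- move: sn; rewrite es !size_cat /= size_cat /=; lia.
- by [].
- move=> d; rewrite inE => h'; apply: ns; rewrite inE'.
  by case/orP: h' => ->; rewrite ?orbT.
- refine (subseq_sorted tr _ ss2); apply: subseq_trans (suffix_subseq A _).
  by rewrite -cat_cons; exact: prefix_subseq.
- by rewrite /= (step_last _ _ e).
exists C; split=> // G k; have [g1 e1] := Hs G k; have [g2 e2] := HC G k.
have t1 : phol (fun a b => llab N k a.1 b.1) b (rcons (D ++ A) a) = 1%g.
  rewrite (@phol_chart _ _ c) ?last_rcons ?e ?llab1 // => d.
  rewrite -rcons_cons mem_rcons inE => dd; apply: hc.
    apply: ns; rewrite inE'; move: dd; rewrite !inE mem_cat.
    by case/or4P => ->; rewrite ?orbT.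
  move: dd; rewrite !inE mem_cat => /or4P[/eqP ->|/eqP ->|dD|dA]; rewrite ?leqnn ?orbT //.
    by rewrite bD ?orbT.
  by rewrite Aa.
exists (g2 * g1)%g; rewrite conjgM -e2 e1 t1 mulg1.
by congr (_ ^ _)%g; rewrite /hlist /= (phol_last _ _ _ e).
Qed.

End loop_erasure.

Section discretization.
Variable (R : realType).
Local Notation I := (unit_itv R).
Local Notation pt := (R * R)%type.
Local Notation X := (sphere4 R).
Variable g : I -> X.
Hypothesis sg : simple_closed_curve g.
Local Notation gam := (curve g).

Let cg : continuous g. Proof. by case: sg. Qed.
Let cgam : continuous gam. Proof. exact: curve_continuous. Qed.

Lemma curve01 : gam 0 = gam 1.
Proof. by rewrite /curve -[clamp 0]/(zero : I) -[clamp 1]/(one : I); case: sg => _ ->. Qed.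

Lemma curve_inj (s t : R) : 0 <= s <= 1 -> 0 <= t <= 1 -> gam s = gam t -> s = t \/ `|s - t| = 1.
Proof.
move=> s01 t01 /val_inj e; case: sg => _ _ /(_ _ _ e).
case=> [/(congr1 val)|[/(congr1 val) + /(congr1 val)]|[/(congr1 val) + /(congr1 val)]];
  rewrite ?val_zero ?val_one !clampE //; [by left|move=> -> ->|move=> -> ->]; right.
  by rewrite sub0r normrN normr1.
by rewrite subr0 normr1.
Qed.

Lemma ball_pt (p q : pt) e : ball p e q = (ball p.1 e q.1 /\ ball p.2 e q.2) :> Prop.
Proof. by []. Qed.

Lemma curve_unif (e : R) : 0 < e -> exists2 d, 0 < d &
  forall r s, 0 <= r <= 1 -> `|r - s| < d -> ball (gam r) e (gam s).
Proof.
move=> e0; have [| |d d0 hd] := @lebesgue_number R R `[0, 1]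
    (fun A => forall r s, A r -> A s -> ball (gam r) e (gam s)) _ (@segment_compact _ _ _).
- by move=> A B AB h r s /AB Br /AB; exact: h.
- move=> r _; have : nbhs r (gam @^-1` ball (gam r) (e / 2)).
    by apply: cgam; apply: nbhsx_ballx; rewrite divr_gt0.
  move=> /nbhs_ballP[d d0 hd]; exists d => // s t /hd h1 /hd h2.
  by apply: ball_splitr h2; exact: h1.
exists d => // r s r01 rs; apply: (hd r) => //; first exact: ballxx.
Qed.

(** On the compact set of pairs of times with [d <= |s - t| <= 1 - d] the difference of the two
    points never vanishes, because the curve is simple; so it stays away from 0. *)
Lemma curve_sep (d : R) : 0 < d -> exists2 e, 0 < e &
  forall s t, 0 <= s <= 1 -> 0 <= t <= 1 -> ball (gam s) e (gam t) ->
    `|s - t| < d \/ 1 - d < `|s - t|.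
Proof.
move=> d0; pose D (p : pt) : R := `|p.1 - p.2|; pose K := [set p : pt | 0 <= p.1 <= 1 /\ 0 <= p.2 <= 1] `&` 
   [set p : pt | d <= `|p.1 - p.2| <= 1 - d].
pose F (p : pt) : pt := ((gam p.1).1 - (gam p.2).1, (gam p.1).2 - (gam p.2).2).
have cF : continuous F.
  have c1 : continuous (fun p : pt => gam p.1).
    exact: comp_continuous (@fst_continuous _ _) cgam.
  have c2 : continuous (fun p : pt => gam p.2).
    exact: comp_continuous (@snd_continuous _ _) cgam.
  apply: pair_continuous; apply: sub_continuous.
  - exact: comp_continuous c1 (@fst_continuous _ _).
  - exact: comp_continuous c2 (@fst_continuous _ _).
  - exact: comp_continuous c1 (@snd_continuous _ _).
  - exact: comp_continuous c2 (@snd_continuous _ _).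
have cD : continuous D.
  move=> p; apply: cvg_norm; apply: cvgB; [exact: cvg_fst|exact: cvg_snd].
have cK : compact K.
  pose B : set pt := (`[0, 1]%classic : set R) `*` (`[0, 1]%classic : set R).
  have cB : compact B by apply: compact_setX; exact: segment_compact.
  apply: (@subclosed_compact pt K B) => //.
  - have -> : K = B `&` [set p : pt | d <= D p] `&` [set p : pt | D p <= 1 - d].
      apply/seteqP; split=> p; rewrite /K /B /= !in_itv /=.
        by case=> [[-> ->]] /andP[-> ->].
      by case=> [[[-> ->] ->] ->].
    apply: closedI; first apply: closedI.
    + by apply: compact_closed cB; exact: norm_hausdorff.
    + by apply: (@preimage_closed _ _ D [set y | d <= y]); [move=> x _; exact: cD|exact: closed_ge].
    + by apply: (@preimage_closed _ _ D [set y | y <= 1 - d]); [move=> x _; exact: cD|exact: closed_le].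
  - by move=> p [[h1 h2] _]; rewrite /B /= !in_itv /= h1 h2.
have cFK : compact (F @` K).
  by apply: continuous_compact => //; exact: continuous_subspaceT.
have clFK : closed (F @` K) by apply: compact_closed => //; exact: norm_hausdorff.
have n0 : (~` (F @` K)) (0, 0).
  move=> [[s t] [[/= s01 t01] /andP[h1 h2]] []] e1 e2.
  have [|es|es] := @curve_inj s t s01 t01; last by move: h2; rewrite es; lra.
    have -> : gam s = ((gam s).1, (gam s).2) by case: (gam s).
    by case: (gam t) e1 e2 => x y /= e1 e2; congr (_, _); lra.
  by move: h1; rewrite es subrr normr0; lra.
have : nbhs ((0, 0) : pt) (~` (F @` K)) by apply: open_nbhs_nbhs; split=> //; exact: closed_openC.
move=> /nbhs_ballP[e e0 he]; exists e => // s t s01 t01 st.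
have [|h1] := ltrP `|s - t| d; first by left.
have [|h2] := ltrP (1 - d) `|s - t|; first by right.
exfalso; apply: (he (F (s, t))); last by exists (s, t) => //; split=> //=; rewrite h1 h2.
move: st; rewrite !ball_pt /F /ball /= => -[b1 b2].
by rewrite !sub0r !normrN.
Qed.


Section walk.
Variable N : nat.
Hypothesis N0 : (0 < N)%N.
Variable n : nat.
Hypothesis n0 : (0 < n)%N.
Local Notation lp := (@lattice_pt R N).
Local Notation tvert := (vert * nat)%type.

Definition sample (i : nat) : pt := gam (i%:R / n%:R).
Definition cell (i : nat) : vert := lattice_cell N (sample i).
(** An intermediate vertex that breaks a possibly diagonal move between consecutive cells into a
    vertical and a horizontal step. *)
Definition turning (i : nat) : vert := ((cell i.+1).1, (cell i).2).

Fixpoint walk (m : nat) : seq tvert :=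
  if m is m'.+1 then rcons (rcons (walk m') (turning m', m')) (cell m, m) else [::].

Hypothesis fine_steps : forall i, (i < n)%N -> ball (sample i) (N%:R)^-1 (sample i.+1).

Definition near_time (a : tvert) : Prop :=
  (a.2 <= n)%N /\ ball (sample a.2) (2 / N%:R) (lp a.1).

Lemma last_walk m : last (cell 0, 0%N) (walk m) = (cell m, m).
Proof. by case: m => //= m; rewrite last_rcons. Qed.

Lemma walk_rcons m : (0 < m)%N -> walk m = rcons (rcons (walk m.-1) (turning m.-1, m.-1)) (cell m, m).
Proof. by case: m. Qed.

Let NR : 0 < (N%:R)^-1 :> R. Proof. by rewrite invr_gt0 ltr0n. Qed.

Lemma cell_near i : (i <= n)%N -> near_time (cell i, i).
Proof.
move=> ni; split=> //; rewrite ball_pt /ball /= !(distrC (sample i).1) !(distrC (sample i).2).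
by split; (apply: le_lt_trans; first exact: lattice_cell_near); move: NR; lra.
Qed.

Lemma turning_near i : (i < n)%N -> near_time (turning i, i).
Proof.
move=> ni; split; first exact: ltnW.
have [_] := cell_near (ltnW ni); have [_] := cell_near ni; have := fine_steps ni.
rewrite !ball_pt /ball /= => -[h1 _] _ [_ h2]; split=> //.
have := lattice_cell_near N0 (sample i.+1).1; rewrite -/(cell _).
move: h1; rewrite /cell /= => h1 h3.
rewrite distrC; apply: le_lt_trans (ler_distD (sample i.+1).1 _ _) _.
by rewrite [X in _ + X]distrC; move: NR; lra.
Qed.

Lemma walk_near m : (m <= n)%N -> forall a, a \in (cell 0, 0%N) :: walk m -> near_time a.
Proof.
elim: m => [_ a|m IH mn a].
  by rewrite inE => /eqP ->; exact: cell_near.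
rewrite /= inE mem_rcons inE mem_rcons inE => /or4P[/eqP ->|/eqP ->|/eqP ->|am].
- exact: cell_near.
- exact: cell_near.
- exact: turning_near.
- by apply: IH; [exact: ltnW|rewrite inE am orbT].
Qed.

Lemma walk_sorted m : path (fun a b : tvert => a.2 <= b.2)%N (cell 0, 0%N) (walk m).
Proof. by elim: m => //= m IH; rewrite !rcons_path IH last_walk last_rcons /= leqnn leqnSn. Qed.

Lemma int_dist1 (a b : int) : `|a - b| <= 1 -> [|| a == b, a == b + 1 | b == a + 1].
Proof. rewrite ler_norml; lia. Qed.

Lemma walk_step m : (m <= n)%N -> path step (cell 0, 0%N) (walk m).
Proof.
elim: m => [//|m IH] mn /=; rewrite !rcons_path IH ?(ltnW mn) //= last_walk last_rcons.
have := fine_steps mn; rewrite ball_pt /ball /= => -[/(lattice_cell_step N0) h1 /(lattice_cell_step N0) h2].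
rewrite /step /turning /= /adj /rt /up /= /cell /lattice_cell /= !xpair_eqE; move: h1 h2.
move: (Num.floor _) (Num.floor _) (Num.floor _) (Num.floor _) => a a' b b' /int_dist1 h1 /int_dist1 h2.
rewrite !eqxx !andbT /=; apply/andP; split.
  by case/or3P: h1 => /eqP ->; rewrite eqxx ?orbT.
by case/or3P: h2 => /eqP ->; rewrite eqxx ?orbT.
Qed.

Variable rho : R.
Hypothesis rho_chart : forall i, (i <= n)%N -> exists c, ball (sample i) rho `<=` chart c.
Hypothesis N_rho : 8 / N%:R <= rho.

(** Consecutive samples and the vertices near them lie in a common chart, so by [tau_chart] the
    short transports between walk and curve telescope. *)
Lemma walk_hol (G : groupType) (k : nat -> G) m : (m <= n)%N ->
  (phol (fun a b => llab N k a.1 b.1) (cell 0, 0%N) (walk m) * tau k (lp (cell m)) (sample m) =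
   tau k (lp (cell 0)) (sample 0) * tprod k sample m)%g.
Proof.
elim: m => [|m IH] mn; first by rewrite /= mul1g mulg1.
have [c hc] := rho_chart (ltnW mn).
have in_c (p : pt) : ball (sample m) (8 / N%:R) p -> chart c p.
  by move=> /(le_ball N_rho)/hc.
have s1 : ball (sample m) (8 / N%:R) (sample m.+1).
  by apply: le_ball (fine_steps mn); move: NR; lra.
have near_in (a : tvert) : near_time a -> ball (sample m) (N%:R)^-1 (sample a.2) -> chart c (lp a.1).
  move=> [_ h1] h2; apply: in_c.
  have := ball_triangle h2 h1; apply: le_ball; move: NR; lra.
have b0 : ball (sample m) (N%:R)^-1 (sample m) by exact: ballxx.
have cm := near_in _ (cell_near (ltnW mn)) b0.
have cw := near_in _ (turning_near mn) b0.
have cm1 := near_in _ (cell_near mn) (fine_steps mn).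
have sm : chart c (sample m) by apply: in_c; apply: ballxx; move: NR; lra.
have sm1 : chart c (sample m.+1) by exact: in_c.
rewrite /= !phol_rcons last_rcons last_walk /= !(llab_tau R N0) -!mulgA.
rewrite (tau_chart k cw cm1 sm1) (tau_chart k cm cw sm1) -(tau_chart k cm sm sm1).
by rewrite mulgA IH ?mulgA // ltnW.
Qed.

Variables (d e : R).
Hypothesis d_unif : forall r s, 0 <= r <= 1 -> `|r - s| < d -> ball (gam r) (rho / 4) (gam s).
Hypothesis e_sep : forall s t, 0 <= s <= 1 -> 0 <= t <= 1 -> ball (gam s) e (gam t) ->
    `|s - t| < d \/ 1 - d < `|s - t|.
Hypothesis N_e : 4 / N%:R <= e.

Lemma sample_time i : (i <= n)%N -> 0 <= (i%:R / n%:R : R) <= 1.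
Proof.
by move=> ni; rewrite divr_ge0 //= ler_pdivrMr ?ltr0n // mul1r ler_nat.
Qed.

(** Equal vertices force the two samples to be within [4 / N], hence within [e], so by separation
    the times differ by less than [d] directly or around the circle. The curve between them stays
    within [rho / 4] of one point, and the walk within [rho], where [rho_chart] applies. *)
Lemma near_close a b : near_time a -> near_time b -> a.1 = b.1 -> (a.2 <= b.2)%N ->
  (exists c, forall d, near_time d -> (a.2 <= d.2 <= b.2)%N -> chart c (lp d.1)) \/
  (exists c, forall d, near_time d -> (d.2 <= a.2)%N || (b.2 <= d.2)%N -> chart c (lp d.1)).
Proof.
move=> [an na] [bn nb] ab a_b.
have h : ball (sample a.2) e (sample b.2).
  by apply: le_ball N_e _ _; rewrite -ab in nb; have := ball_triangle na (ball_sym nb);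
     apply: le_ball; lra.
have mono i j : (i <= j)%N -> i%:R / n%:R <= j%:R / n%:R :> R.
  by move=> ij; rewrite ler_pM2r ?invr_gt0 ?ltr0n // ler_nat.
have cl c r (x : tvert) : ball (gam r) rho `<=` chart c -> 0 <= r <= 1 ->
    `|r - x.2%:R / n%:R| < d -> near_time x -> chart c (lp x.1).
  move=> hc r01 rx [_ nx]; apply: hc; have := ball_triangle (d_unif r01 rx) nx.
  apply: le_ball; move: N_rho NR; lra.
have := sample_time an; have := sample_time bn; have := mono _ _ a_b.
move=> ab1 /andP[b0 b1] /andP[a0 a1].
case: (e_sep _ _ h); rewrite ?sample_time //; rewrite ler0_norm ?subr_le0 // => dab.
- left; have [c hc] := rho_chart an; exists c => x nx /andP[/mono ax /mono xb].
  apply: (cl c (a.2%:R / n%:R)) => //; first exact: sample_time.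
  by rewrite ler0_norm ?subr_le0 //; lra.
- right; have [c hc] := rho_chart (leq0n n); exists c => x nx xab.
  have := sample_time nx.1 => /andP[x0 x1]; case/orP: xab => /mono ax.
    apply: (cl c 0) => //; rewrite ?lexx ?ler01 //.
      by move: hc; rewrite /sample mul0r.
    by rewrite sub0r normrN ger0_norm //; lra.
  apply: (cl c 1) => //; rewrite ?lexx ?ler01 //.
    by move: hc; rewrite /sample mul0r curve01.
  by rewrite ger0_norm ?subr_ge0 //; lra.
Qed.

End walk.

Theorem simple_lattice : exists (N : nat) (C : seq vert), [/\ (0 < N)%N, uniq C, cycle adj C &
  forall (G : groupType) (k : nat -> G), exists h, hol k g = (chol (llab N k) C ^ h)%g].
Proof.
have [| | |rho rho0 hrho] := @lebesgue_number R pt (gam @` `[0, 1])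
    (fun A => exists c, A `<=` chart c).
- by move=> A B AB [c h]; exists c => p /AB/h.
- by apply: continuous_compact; [exact: continuous_subspaceT|exact: segment_compact].
- move=> _ [r _ <-]; have [c hc] := chart_cover (@sphere4P R (g (clamp r))).
  have : nbhs (gam r) (chart c) by apply: open_nbhs_nbhs; split=> //; exact: chart_open.
  by move=> /nbhs_ballP[d d0 hd]; exists d => //; exists c.
have [d d0 hd] := @curve_unif (rho / 4) ltac:(lra).
have [e e0 he] := curve_sep d0.
(* The scales are fixed in the order [rho] (charts), [d] (continuity), [e] (simplicity), mesh
   [1 / N], number [n] of samples. The mesh must be small against both [rho] and [e]; [n] makes
   consecutive samples closer than one mesh. *)
have [N N0 hN] := @inv_nat_lt R (Num.min (rho / 8) (e / 4)) ltac:(rewrite lt_min; lra).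
have [/ltac:(move=> N1) N2] : (N%:R)^-1 < rho / 8 /\ (N%:R)^-1 < e / 4.
  by move: hN; rewrite lt_min => /andP.
have NR : 0 < (N%:R)^-1 :> R by rewrite invr_gt0 ltr0n.
have [d' d'0 hd'] := curve_unif NR.
have [m m0 hm] := inv_nat_lt d'0.
have [n0 fn0] := fine_exists cg.
have fn := fine_mul fn0 m0; have nn := fn.1; set n := (n0 * m)%N in fn nn.
have nR : 0 < n%:R :> R by rewrite ltr0n.
have rc i : (i <= n)%N -> exists c, ball (sample n i) rho `<=` chart c.
  move=> ni; apply: hrho; exists (i%:R / n%:R) => //.
  by rewrite /= in_itv /=; exact: sample_time.
have fs i : (i < n)%N -> ball (sample n i) (N%:R)^-1 (sample n i.+1).
  move=> ni; apply: hd'; first by apply: sample_time => //; exact: ltnW.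
  rewrite distrC -mulrBl -natr1 addrAC subrr add0r div1r ger0_norm ?invr_ge0 //.
  apply: le_lt_trans hm; rewrite lef_pV2 ?posrE ?ltr0n // ler_nat /n.
  by rewrite leq_pmull // fn0.1.
have Nrho : 8 / N%:R <= rho by lra.
have Ne : 4 / N%:R <= e by lra.
have c0n : cell N n n = cell N n 0.
  by rewrite /cell /sample mul0r divff ?lt0r_neq0 // curve01.
have s0n : sample n n = sample n 0.
  by rewrite /sample mul0r divff ?lt0r_neq0 // curve01.
pose x : vert * nat := (cell N n 0, 0%N).
pose s := rcons (walk N n n.-1) (turning N n n.-1, n.-1).
have eW : walk N n n = rcons s (cell N n n, n) by rewrite walk_rcons.
have [||||C [uC cC HC]] := erase N0 (near_close N0 nn rc Nrho hd he Ne) (s := x :: s).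
- by [].
- move=> a ax; apply: (walk_near N0 fs (leqnn n)).
  by rewrite eW -rcons_cons mem_rcons inE ax orbT.
- by have := walk_sorted N n n; rewrite eW rcons_path => /andP[].
- by have := walk_step N0 nn fs (leqnn n); rewrite eW (step_last _ _ (b := x)) //= c0n.
exists N, C; split=> // G k; have [h1 e1] := HC G k.
have := walk_hol N0 fs rc Nrho k (leqnn n).
rewrite c0n s0n eW (phol_last N k _ _ (b := x)) ?c0n //.
rewrite -[phol _ _ _]/(hlist N k (x :: s)) e1 => e2.
rewrite (holE k fn) /gridprod -/(sample n); set t := tau _ _ _ in e2.
exists (h1 * t)%g; rewrite conjgM {2}/conjg.
by apply: (mulgI t); rewrite mulgA mulgV mul1g e2.
Qed.

End discretization.

(** * The conjugacy classes of non-peripheral simple closed curves *)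

Section simple_words.
Variable (R : realType).
Local Notation I := (unit_itv R).
Local Notation X := (sphere4 R).
Local Notation bp := (basepoint R).
Local Notation pi1 := (pi1 R bp).
Local Notation kappa := (@kappa R).

Lemma hol_rep_kappa (x : pi1) : hol_rep kappa x = x.
Proof. by rewrite -[x]reprK hol_repE hol_pi. Qed.

Lemma gap_kappa m : (m < 3)%N -> gap kappa m \in [:: c1 R; c2 R; c3 R].
Proof.
rewrite -[c1 R]hol_rep_kappa -[c2 R]hol_rep_kappa -[c3 R]hol_rep_kappa.
rewrite hol_c1 hol_c2 hol_c3 /gap; case: m => [|[|[|//]]] _; by rewrite !inE eqxx ?orbT.
Qed.

Lemma c4_kappa : (kappa 3 / kappa 0 = (c4 R)^-1)%g.
Proof. by rewrite -[c4 R]hol_rep_kappa hol_c4 invgF. Qed.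

Lemma circle_closed (b : I -> X) : puncture_circle b -> b zero = b one.
Proof.
case=> p [r [e [_ _ bE]]]; apply: val_inj; rewrite !bE val_zero val_one mulr0 mulr1.
by rewrite mulr_natl cos0 sin0 cos2pi sin2pi.
Qed.

(** With the labels [kappa] the holonomy is the class itself. In three of the four cases of
    [simple_class], [free_of_conj] makes the curve homotopic to a point or to a model circle, which
    is excluded; the remaining case is the asserted form. *)
Theorem simple_word (g : I -> X) (a : loop R bp) : simple_closed_curve g ->
  ~ null_homotopic g -> ~ peripheral g -> free_homotopic (loop_fun a) g ->
  exists c u w, c \in [:: c1 R; c2 R; c3 R] /\
    (\pi_pi1 a = ((c ^ w) * c4 R) ^ u \/ (\pi_pi1 a)^-1 = ((c ^ w) * c4 R) ^ u)%g.
Proof.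
move=> sg nn np ag; have [cg g01 _] := sg.
have [N [C [N0 uC cC hC]]] := simple_lattice sg.
have [h hg] := hC _ kappa.
have cls_g : simple_class kappa (hol kappa g) \/ simple_class kappa (hol kappa g)^-1%g.
  rewrite hg -conjVg; case: (lattice_simple kappa N0 uC cC) => s; [left|right];
  exact: simple_classJ.
have [h' ha] := hol_free kappa ag.
rewrite hol_pi ha.
have gK1 f : hol kappa g = (1 ^ f)%g -> False.
  move=> eg; apply: nn; exists bp; apply: (@free_of_conj R g (cst bp) f) => //.
    exact: cst_continuous.
  by rewrite hol_const.
have circle m (e : R) (f : pi1) : e = 1 \/ e = -1 -> (m < 3)%N ->
    hol kappa g = ((if e == 1%R then gap kappa m else (gap kappa m)^-1) ^ f)%g -> False.
  move=> e1 m3 eg; apply: np; have [b [pb cb hb]] := @circle_exists R m e m3 e1.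
  exists b => //; apply: (@free_of_conj R g b f) => //; last by rewrite hb.
  exact: circle_closed.
have big (e : R) (f : pi1) : e = 1 \/ e = -1 ->
    hol kappa g = ((if e == 1%R then kappa 3 / kappa 0 else (kappa 3 / kappa 0)^-1) ^ f)%g -> False.
  move=> e1 eg; apply: np; have [b [pb cb hb]] := @big_circle_exists R e e1.
  exists b => //; apply: (@free_of_conj R g b f) => //; last by rewrite hb.
  exact: circle_closed.
have N1 : (-1 == 1 :> R) = false by apply/eqP; lra.
have P1 : 1 = 1 :> R \/ 1 = -1 :> R by left.
have P2 : -1 = 1 :> R \/ -1 = -1 :> R by right.
have word x : simple_class kappa x -> hol kappa g = x \/ hol kappa g = x^-1%g ->
    exists c u w, c \in [:: c1 R; c2 R; c3 R] /\ (x^-1 = ((c ^ w) * c4 R) ^ u)%g.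
  case=> [->|[m [f [m3 ->]]]|[f ->]|[m [f [f' [m3 ->]]]]] hx.
  - by exfalso; case: hx => eg; apply: (gK1 1%g); rewrite eg ?invg1 conj1g.
  - exfalso; case: hx => eg; first by apply: (circle m 1 f) => //; rewrite eqxx.
    by apply: (circle m (-1) f) => //; rewrite N1 eg conjVg.
  - exfalso; case: hx => eg; first by apply: (big 1 f) => //; rewrite eqxx.
    by apply: (big (-1) f) => //; rewrite N1 eg conjVg.
  exists (gap kappa m), f, (f' * f^-1)%g; split; first exact: gap_kappa.
  by rewrite c4_kappa conjMg -conjgM mulgVK invgM -!conjVg !invgK.
case: cls_g => /word[|c [u [w [hc ec]]]]; [by left| |by right; rewrite invgK|].
  by exists c, (u * h')%g, w; split=> //; right; rewrite -conjVg ec conjgM.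
by exists c, (u * h')%g, w; split=> //; left; rewrite conjgM -ec invgK.
Qed.

End simple_words.

(** * The family of representations and its hyperbolic simple curves *)

Section matrices.
Variable R : comRingType.

Definition mx2 (a b c d : R) : 'M[R]_2 :=
  \matrix_(i, j) (if i == 0 then if j == 0 then a else b else if j == 0 then c else d).

Lemma ord2 (P : 'I_2 -> Prop) : P 0 -> P 1 -> forall i, P i.
Proof.
move=> P0 P1 [[|[|//]] h]; first by rewrite (_ : Ordinal h = 0) //; exact: val_inj.
by rewrite (_ : Ordinal h = 1) //; exact: val_inj.
Qed.

Lemma mx2_eta (A : 'M[R]_2) : A = mx2 (A 0 0) (A 0 1) (A 1 0) (A 1 1).
Proof. by apply/matrixP; elim/ord2; elim/ord2; rewrite mxE. Qed.

Lemma mx2M a b c d a' b' c' d' : mx2 a b c d *m mx2 a' b' c' d' =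
  mx2 (a * a' + b * c') (a * b' + b * d') (c * a' + d * c') (c * b' + d * d').
Proof. by apply/matrixP; elim/ord2; elim/ord2; rewrite !mxE !big_ord_recl big_ord0 !mxE /= addr0. Qed.

Lemma mx2_1 : mx2 1 0 0 1 = 1%:M.
Proof. by apply/matrixP; elim/ord2; elim/ord2; rewrite !mxE. Qed.

Lemma mx2N a b c d : - mx2 a b c d = mx2 (- a) (- b) (- c) (- d).
Proof. by apply/matrixP; elim/ord2; elim/ord2; rewrite !mxE. Qed.

Lemma mx2_inj a b c d a' b' c' d' : mx2 a b c d = mx2 a' b' c' d' -> [/\ a = a', b = b', c = c' & d = d'].
Proof.
move/matrixP => h; split; [have := h 0 0|have := h 0 1|have := h 1 0|have := h 1 1]; by rewrite !mxE.
Qed.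

Lemma mx2_tr a b c d : \tr (mx2 a b c d) = a + d.
Proof. by rewrite /mxtrace !big_ord_recl big_ord0 !mxE /= addr0. Qed.

Lemma mx2_det a b c d : \det (mx2 a b c d) = a * d - b * c.
Proof.
rewrite (expand_det_row _ 0) !big_ord_recl big_ord0 addr0 /cofactor !det_mx11 !mxE /=.
by rewrite addn0 expr0 expr1 mul1r mulN1r mulrN.
Qed.

End matrices.

Section psl2.
Variable R : realType.
Local Notation SL2 := (SL2 R).
Local Notation PSL2 := (PSL2 R).

Lemma mx2_adj (a b c d : R) : a * d - b * c = 1 -> invmx (mx2 a b c d) = mx2 d (- b) (- c) a.
Proof.
move=> h; have u : mx2 a b c d \in unitmx by rewrite unitmxE mx2_det h unitr1.
rewrite -[LHS]mulmx1 -mx2_1.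
have -> : mx2 1 0 0 1 = mx2 a b c d *m mx2 d (- b) (- c) a by rewrite mx2M; congr mx2; lra.
by rewrite mulmxA mulVmx // mul1mx.
Qed.

Lemma pi_mulg (A B : SL2) : (\pi_PSL2 A * \pi_PSL2 B)%g = \pi_PSL2 (sl2_mul A B).
Proof. exact: pi_SL2M. Qed.

Lemma pi_one : \pi_PSL2 (sl2_one R) = 1%g. Proof. by []. Qed.

Lemma pi_invg (A : SL2) : ((\pi_PSL2 A)^-1)%g = \pi_PSL2 (sl2_inv A).
Proof.
apply: (mulgI (\pi_PSL2 A)); rewrite mulgV pi_mulg -pi_one; apply/pi_PSL2P; left.
by rewrite /= mulmxV // SL2_unit.
Qed.

Lemma psl2_abstr_pi (A : SL2) : psl2_abstr (\pi_PSL2 A) = `|\tr (val A)|.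
Proof.
rewrite /psl2_abstr; have /pi_PSL2P[->//|->] : \pi_PSL2 (repr (\pi_PSL2 A)) = \pi_PSL2 A by rewrite reprK.
by rewrite raddfN normrN.
Qed.

Lemma psl2_abstrJ (g h : PSL2) : psl2_abstr (g ^ h)%g = psl2_abstr g.
Proof.
elim/quotW: g => A; elim/quotW: h => B.
rewrite conjgE pi_invg (pi_mulg A B) (pi_mulg _ (sl2_mul A B)) !psl2_abstr_pi /= mxtrace_mulC.
by rewrite -mulmxA mulmxV ?mulmx1 // SL2_unit.
Qed.

Lemma psl2_abstrV (g : PSL2) : psl2_abstr (g^-1)%g = psl2_abstr g.
Proof.
elim/quotW: g => A; rewrite pi_invg !psl2_abstr_pi /=; congr `|_|.
have := SL2_det A; rewrite /=; move: (sval A) => M; rewrite [M]mx2_eta mx2_det => h.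
by rewrite mx2_adj // !mx2_tr addrC.
Qed.

Lemma hyperbolicJ (g h : PSL2) : hyperbolic (g ^ h)%g = hyperbolic g.
Proof. by rewrite /hyperbolic psl2_abstrJ. Qed.

Lemma hyperbolicV (g : PSL2) : hyperbolic (g^-1)%g = hyperbolic g.
Proof. by rewrite /hyperbolic psl2_abstrV. Qed.

Lemma parabolicJ (g h : PSL2) : parabolic g -> parabolic (g ^ h)%g.
Proof.
move=> [g1 g2]; split; last by rewrite psl2_abstrJ.
by move=> /eqP; rewrite conjg_eq1 => /eqP.
Qed.

Lemma parabolicV (g : PSL2) : parabolic g -> parabolic (g^-1)%g.
Proof.
move=> [g1 g2]; split; last by rewrite psl2_abstrV.
by move=> /eqP; rewrite invg_eq1 => /eqP.
Qed.

End psl2.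

Section family.
Variables (R : realType) (eta m : R).
Hypothesis eta1 : eta = 1 \/ eta = -1.
Hypothesis m0 : 0 < m.
Local Notation SL2 := (SL2 R).
Local Notation PSL2 := (PSL2 R).
Local Notation bp := (basepoint R).

Let etaE : eta * eta = 1. Proof. by case: eta1 => ->; lra. Qed.

(** For [eta = 1] this sends [u] to [u + s (x u_2 - y u_1) (x, y)], a unipotent map fixing the
    direction of [(x, y)]. In general it is conjugated by the diagonal matrix with entries [eta] and
    1, a reflection if [eta = -1]. *)
Definition shear_mx (s x y : R) : 'M[R]_2 :=
  mx2 (1 - s * x * y) (eta * (s * x ^+ 2)) (- (eta * (s * y ^+ 2))) (1 + s * x * y).

Lemma shear_det (s x y : R) : \det (shear_mx s x y) = 1.
Proof.
rewrite mx2_det; have -> : eta * (s * x ^+ 2) * - (eta * (s * y ^+ 2)) =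
  eta * eta * (s * x ^+ 2 * - (s * y ^+ 2)) by ring.
by rewrite etaE; ring.
Qed.

Definition shear (s x y : R) : SL2 := mkSL2 (shear_det s x y).

(** The values solve [gen_prod]. What matters is their signs, positive for [c1], [c2], [c3] and
    negative for [c4], and that the denominator [3 m + 4] becomes odd at [m = 1]. *)
Definition scale (i : nat) : R :=
  match i with
  | 0 => 2 | 1 => 2 * (m + 1) / (3 * m + 4) | 2 => 2 / (3 * m + 4) | _ => - (2 * m)
  end.

Definition vx (i : nat) : R := match i with 0 => 0 | 1 => 2 | 2 => - (2 + 3 * m) | _ => 1 end.
Definition vy (i : nat) : R := match i with 0 | 1 | 2 => 1 | _ => 0 end.

Definition gen (i : nat) : SL2 := shear (scale i) (vx i) (vy i).

Lemma gen_prod : val (gen 0) *m val (gen 1) *m val (gen 2) *m val (gen 3) = - 1%:M.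
Proof.
have q0 : 3 * m + 4 != 0 by rewrite lt0r_neq0 // addr_gt0 // mulr_gt0.
rewrite -mx2_1 mx2N /= /shear_mx !mx2M /=; case: eta1 => ->; congr mx2; field; exact: q0.
Qed.

(** Labels whose successive quotients are the wanted images of [c1], [c2], [c3]; the image of [c4]
    is then forced by [gen_relation]. *)
Definition gen_label (j : nat) : PSL2 :=
  match j with
  | 0 => 1%g | 1 => \pi_PSL2 (gen 2) | 2 => (\pi_PSL2 (gen 1) * \pi_PSL2 (gen 2))%g
  | _ => (\pi_PSL2 (gen 0) * (\pi_PSL2 (gen 1) * \pi_PSL2 (gen 2)))%g
  end.

Definition family_rep : rep R := hol_rep gen_label.

Lemma family_c1 : family_rep (c1 R) = \pi_PSL2 (gen 0).
Proof. by rewrite [LHS]hol_c1 /= mulgK. Qed.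

Lemma family_c2 : family_rep (c2 R) = \pi_PSL2 (gen 1).
Proof. by rewrite [LHS]hol_c2 /= mulgK. Qed.

Lemma family_c3 : family_rep (c3 R) = \pi_PSL2 (gen 2).
Proof. by rewrite [LHS]hol_c3 /= invg1 mulg1. Qed.

Lemma gen_relation :
  (\pi_PSL2 (gen 0) * (\pi_PSL2 (gen 1) * \pi_PSL2 (gen 2)) * \pi_PSL2 (gen 3) = 1)%g.
Proof.
rewrite (pi_mulg (gen 1) (gen 2)) (pi_mulg (gen 0)) (pi_mulg _ (gen 3)) -pi_one.
by apply/pi_PSL2P; right; rewrite -gen_prod /= !mulmxA.
Qed.

Lemma family_c4 : family_rep (c4 R) = \pi_PSL2 (gen 3).
Proof.
rewrite [LHS]hol_c4 /= mul1g; apply: (mulgI (gen_label 3)).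
by rewrite mulgV -gen_relation.
Qed.

End family.

Lemma hol_in (R : realType) (G : groupType) (k : nat -> G) (S : G -> Prop) f :
  S 1%g -> (forall x y, S x -> S y -> S (x * y)%g) -> (forall x, S x -> S (x^-1)%g) ->
  (forall j, S (k j)) -> S (@hol R G k f).
Proof.
move=> S1 SM SV Sk; rewrite /hol /gridprod; move: (xget _ _) (fun i => _) => n x.
elim: n => //= n IH; apply: SM => //; rewrite /tau.
by case: ifP => // _; case: ifP => _ //; exact: SV.
Qed.

Section multiplicative.
Variables (G H : groupType) (f : {multiplicative G -> H}).

Lemma mult1 : f 1%g = 1%g.
Proof. by apply: (mulgI (f 1%g)); rewrite -gmulfM !mulg1. Qed.

Lemma multV x : f (x^-1)%g = (f x)^-1%g.
Proof. by apply: (mulgI (f x)); rewrite -gmulfM !mulgV mult1. Qed.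

Lemma multJ x y : f (x ^ y)%g = (f x ^ f y)%g.
Proof. by rewrite !conjgE !gmulfM multV. Qed.

End multiplicative.

Section family.
Variables (R : realType) (eta m : R).
Hypothesis eta1 : eta = 1 \/ eta = -1.
Hypothesis m0 : 0 < m.
Local Notation SL2 := (SL2 R).
Local Notation PSL2 := (PSL2 R).
Local Notation bp := (basepoint R).
Local Notation gen := (gen m eta1).
Local Notation lab := (gen_label m eta1).
Local Notation rho := (family_rep m eta1).

Lemma scale_neq0 i : scale m i != 0.
Proof.
have q0 : 0 < 3 * m + 4 by rewrite addr_gt0 // mulr_gt0.
have ? : 0 < m := m0.
case: i => [|[|[|i]]] //=; rewrite ?oppr_eq0 ?pnatr_eq0 //; rewrite lt0r_neq0 //.
- by rewrite divr_gt0 // mulr_gt0 // addr_gt0.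
- by rewrite divr_gt0.
- by rewrite mulr_gt0.
Qed.

Lemma gen_parabolic i : parabolic (\pi_PSL2 (gen i)).
Proof.
have e0 : eta != 0 by case: eta1 => ->; rewrite ?oppr_eq0 oner_eq0.
split; last by rewrite psl2_abstr_pi /= mx2_tr ger0_norm; lra.
move=> h; have /pi_PSL2P[] : \pi_PSL2 (gen i) = \pi_PSL2 (sl2_one R) by [].
  clear h; rewrite /= -mx2_1 => /mx2_inj[_ h1 h2 _].
  move/eqP: h1; rewrite !mulf_eq0 (negbTE e0) (negbTE (scale_neq0 i)) orbb /= => /eqP x0.
  move/eqP: h2; rewrite oppr_eq0 !mulf_eq0 (negbTE e0) (negbTE (scale_neq0 i)) orbb /= => /eqP y0.
  by move: x0 y0; case: i => [|[|[|i]]] /=; lra.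
by clear h; rewrite /= -mx2_1 mx2N => /mx2_inj[h1 _ _ h2]; lra.
Qed.

Lemma gap_gen i : (i < 3)%N -> gap lab i = \pi_PSL2 (gen (2 - i)).
Proof. by rewrite /gap; case: i => [|[|[|]]] //= _; rewrite ?invg1 ?mulg1 ?mulgK. Qed.

Lemma gap_gen3 : (lab 3 / lab 0)%g = (\pi_PSL2 (gen 3))^-1%g.
Proof. by rewrite /= invg1 mulg1; apply: (mulIg (\pi_PSL2 (gen 3))); rewrite mulVg gen_relation. Qed.

Lemma family_type_preserving : type_preserving rho.
Proof.
move=> a [b pb ab]; rewrite [rho _]hol_repE; have [h ->] := hol_free lab ab.
apply: parabolicJ; case: (hol_circle lab pb) => [[i i3]|]; rewrite ?gap_gen // ?gap_gen3.
  by case=> ->; [|apply: parabolicV]; exact: gen_parabolic.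
by case=> ->; rewrite ?invgK; [apply: parabolicV|]; exact: gen_parabolic.
Qed.

Definition ev (p : {poly int}) : R := (map_poly intr p).[m].
(** Reduction modulo 2 with [m] sent to 1. It is applied to the polynomial and not to its value at
    [m], so it is defined for every real [m]; transcendence enters only later, through [m_trans]. *)
Definition par (p : {poly int}) : 'F_2 := (p.[1])%:~R.

Lemma evD p q : ev (p + q) = ev p + ev q. Proof. by rewrite /ev rmorphD hornerD. Qed.
Lemma evN p : ev (- p) = - ev p. Proof. by rewrite /ev rmorphN hornerN. Qed.
Lemma evM p q : ev (p * q) = ev p * ev q. Proof. by rewrite /ev rmorphM hornerM. Qed.
Lemma evC c : ev c%:P = c%:~R. Proof. by rewrite /ev map_polyC hornerC. Qed.
Lemma evX : ev 'X = m. Proof. by rewrite /ev map_polyX hornerX. Qed.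
Lemma parD p q : par (p + q) = par p + par q. Proof. by rewrite /par hornerD rmorphD. Qed.
Lemma parN p : par (- p) = - par p. Proof. by rewrite /par hornerN rmorphN. Qed.
Lemma parM p q : par (p * q) = par p * par q. Proof. by rewrite /par hornerM rmorphM. Qed.
Lemma parC c : par c%:P = c%:~R. Proof. by rewrite /par hornerC. Qed.
Lemma parX : par 'X = 1. Proof. by rewrite /par hornerX. Qed.

Definition evE := (evD, evN, evM, evC, evX).
Definition parE := (parD, parN, parM, parC, parX).

(* Clearing denominators, the matrices of the image of rho have entries in Z[m]
   and are congruent to a multiple of the identity modulo 2. *)
Definition parity_mx (B : SL2) : Prop := exists r p1 p2 p3 p4 : {poly int},
  [/\ par r = 1, par p1 = 1 /\ par p4 = 1, par p2 = 0 /\ par p3 = 0 &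
      ev r *: val B = mx2 (ev p1) (eta * ev p2) (eta * ev p3) (ev p4)].

Let etaE : eta * eta = 1. Proof. by case: eta1 => ->; lra. Qed.

Lemma mx2Z (c a1 a2 a3 a4 : R) : c *: mx2 a1 a2 a3 a4 = mx2 (c * a1) (c * a2) (c * a3) (c * a4).
Proof. by apply/matrixP; elim/ord2; elim/ord2; rewrite !mxE. Qed.

Lemma parity_one : parity_mx (sl2_one R).
Proof.
exists 1%:P, 1%:P, 0%:P, 0%:P, 1%:P; split; rewrite ?parE //.
by rewrite /= -mx2_1 mx2Z !evE !mulr0 !mulr1.
Qed.

Lemma parity_mul A B : parity_mx A -> parity_mx B -> parity_mx (sl2_mul A B).
Proof.
case=> r [p1 [p2 [p3 [p4 [hr [h1 h4] [h2 h3] hA]]]]].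
case=> r' [p1' [p2' [p3' [p4' [hr' [h1' h4'] [h2' h3'] hB]]]]].
exists (r * r'), (p1 * p1' + p2 * p3'), (p1 * p2' + p2 * p4'), (p3 * p1' + p4 * p3'), (p3 * p2' + p4 * p4').
split; rewrite ?parE ?hr ?hr' ?h1 ?h2 ?h3 ?h4 ?h1' ?h2' ?h3' ?h4' ?(mulr0, mul0r, mulr1, addr0, add0r) //.
rewrite evM -scalerA /= scalemxAr scalemxAl hA hB mx2M !evE.
by case: eta1 => ->; congr mx2; ring.
Qed.

Lemma parity_inv A : parity_mx A -> parity_mx (sl2_inv A).
Proof.
case=> r [p1 [p2 [p3 [p4 [hr [h1 h4] [h2 h3] hA]]]]].
exists r, p4, (- p2), (- p3), p1; split; rewrite ?parE ?h2 ?h3 ?oppr0 //.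
move: hA; have := SL2_det A; rewrite /=; move: (sval A) => M; rewrite [M]mx2_eta mx2_det => d.
by rewrite mx2_adj // !mx2Z !evE !mulrN => /mx2_inj[-> -> -> ->].
Qed.

Let q0 : 3 * m + 4 != 0. Proof. by rewrite lt0r_neq0 // addr_gt0 // mulr_gt0. Qed.

Lemma parity_gen i : (i < 3)%N -> parity_mx (gen i).
Proof.
have [q eq pq] : exists2 q : {poly int}, ev q = 3 * m + 4 & par q = 1.
  by exists (3%:P * 'X + 4%:P); rewrite ?evE // !parE mulr1; exact/val_inj.
have p2 : par 2%:P = 0 by rewrite parC; exact/val_inj.
have pp c : par (2%:P * c) = 0 by rewrite parM p2 mul0r.
case: i => [|[|[|//]]] _.
- exists 1%:P, 1%:P, (2%:P * 0%:P), (2%:P * (-1)%:P), 1%:P; split; rewrite ?pp ?parC //.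
  rewrite /= /shear_mx mx2Z !evE /=; congr mx2; ring.
- exists q, (q - 2%:P * (2%:P * ('X + 1%:P))), (2%:P * (4%:P * ('X + 1%:P))), (2%:P * - ('X + 1%:P)),
    (q + 2%:P * (2%:P * ('X + 1%:P))); split; rewrite ?pp ?parD ?parN ?pp ?pq ?oppr0 ?addr0 //.
  rewrite /= /shear_mx mx2Z /= !(evN, evD) eq !evE; congr mx2; field; exact: q0.
- exists q, (q + 2%:P * (2%:P + 3%:P * 'X)), (2%:P * (2%:P + 3%:P * 'X) * (2%:P + 3%:P * 'X)), (2%:P * - 1%:P),
    (q - 2%:P * (2%:P + 3%:P * 'X)); split; rewrite -?mulrA ?pp ?parD ?parN ?pp ?pq ?oppr0 ?addr0 //.
  rewrite /= /shear_mx mx2Z /= !(evN, evD) eq !evE; congr mx2; field; exact: q0.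
Qed.

Lemma parity_rep (x : pi1 R bp) : exists2 B, parity_mx B & rho x = \pi_PSL2 B.
Proof.
pose S (g : PSL2) := exists2 B, parity_mx B & g = \pi_PSL2 B.
have S1 : S 1%g by exists (sl2_one R) => //; exact: parity_one.
have SM x' y' : S x' -> S y' -> S (x' * y')%g.
  by move=> [A pA ->] [B pB ->]; exists (sl2_mul A B); [exact: parity_mul|rewrite pi_mulg].
have SV x' : S x' -> S (x'^-1)%g.
  by move=> [A pA ->]; exists (sl2_inv A); [exact: parity_inv|rewrite pi_invg].
have Sg i : (i < 3)%N -> S (\pi_PSL2 (gen i)) by move=> i3; exists (gen i) => //; exact: parity_gen.
apply: (@hol_in R PSL2 lab S) => // -[|[|[|j]]] //=; first exact: Sg.
  by apply: SM; exact: Sg.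
by apply: (SM); [exact: Sg|apply: SM; exact: Sg].
Qed.

Hypothesis m_trans : forall p : {poly int}, p != 0 -> ev p != 0.

Lemma word_hyperbolic i w : (i < 3)%N ->
  hyperbolic ((\pi_PSL2 (gen i)) ^ rho w * \pi_PSL2 (gen 3))%g.
Proof.
move=> i3; have [B pB ->] := parity_rep w.
rewrite conjgE pi_invg (pi_mulg (gen i)) (pi_mulg _ (sl2_mul _ _)) (pi_mulg _ (gen 3)).
rewrite /hyperbolic psl2_abstr_pi; set t : R := \tr _.
have s0 : 0 < scale m i.
  have ? : 0 < m := m0.
  have q1 : 0 < 3 * m + 4 by rewrite addr_gt0 // mulr_gt0.
  by case: (i) i3 => [|[|[|//]]] _ //=; rewrite divr_gt0 // mulr_gt0 // addr_gt0.
(* The trace of a product of two shears is 2 minus the product of the strengths times the squared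
   wedge of their vectors. Here [y] is that wedge, namely the second coordinate of the inverse of
   [B] applied to the fixed vector of [gen i], since [gen 3] fixes the direction [(1, 0)] and has
   strength [- 2 m]. *)
suff [y y0 ->] : exists2 y, y != 0 & t = 2 + 2 * (m * scale m i * y ^+ 2).
  have : 0 < m * scale m i * y ^+ 2 by rewrite mulr_gt0 ?exprn_even_gt0 // mulr_gt0.
  by move=> h; rewrite gtr0_norm; lra.
case: pB => r [p1 [p2 [p3 [p4 [hr [h1 h4] [h2 h3]]]]]].
have := SL2_det B; rewrite {}/t /=; move: (sval B) => M; rewrite [M]mx2_eta mx2_det => d.
rewrite mx2_adj // mx2Z => /mx2_inj[e1 _ e3 _]; move: d e1 e3.
move: (M 0 0) (M 0 1) (M 1 0) (M 1 1) => a b c d' d e1 e3.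
pose vxp : {poly int} := match i with 0 => 0%:P | 1 => 2%:P | _ => - (2%:P + 3%:P * 'X) end.
have evx : ev vxp = vx m i by rewrite /vxp; case: (i) i3 => [|[|[|//]]] _; rewrite !evE.
exists (a - eta * c * vx m i).
  (* Up to the factor [ev r] this is the value at [m] of the polynomial [p1 - p3 * vxp], whose
     parity is 1 because [p1] is odd and [p3] even; so the polynomial is not zero. *)
  have : ev r * (a - eta * c * vx m i) != 0.
    have -> : ev r * (a - eta * c * vx m i) = ev (p1 - p3 * vxp).
      rewrite !evE evx -e1; have -> : ev p3 = eta * (eta * ev p3) by rewrite mulrA etaE mul1r.
      by rewrite -e3; ring.
    apply: m_trans; apply/eqP => /(congr1 par); rewrite !parE h1 h3 mul0r subr0.
    by move/eqP; rewrite mulr0z oner_eq0.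
  by rewrite mulf_eq0 negb_or => /andP[].
have ey : vy R i = 1 by case: (i) i3 => [|[|[|//]]].
rewrite /shear_mx ey /= !mx2M mx2_tr.
have -> : 2 = 2 * (a * d' - b * c) :> R by rewrite d mulr1.
by case: eta1 => ->; ring.
Qed.

Lemma family_simple_hyperbolic : simple_hyperbolic rho.
Proof.
move=> g sg nn np a ag; have [c [u [w [hc ha]]]] := simple_word sg nn np ag.
suff h : hyperbolic (rho ((c ^ w * c4 R) ^ u)%g).
  case: ha => ea; first by rewrite ea.
  by rewrite -hyperbolicV -multV ea.
rewrite multJ hyperbolicJ gmulfM multJ family_c4 //.
move: hc; rewrite !inE => /or3P[]/eqP ->; rewrite ?family_c1 ?family_c2 ?family_c3.
- exact: word_hyperbolic.
- exact: word_hyperbolic.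
- exact: word_hyperbolic.
Qed.

End family.

(** * Zariski density *)

Section density.
Variables (R : realType).
Local Notation SL2 := (SL2 R).
Local Notation ep P A := (mpoly.meval (mxvec A 0) P).

Lemma meval_line (P : mpoly.mpoly (2 * 2) R) (A B : 'M[R]_2) :
  exists p : {poly R}, forall t, ep P (A + t *: B) = p.[t].
Proof.
pose q (i : 'I_(2 * 2)) : {poly R} := (mxvec A 0 i)%:P + (mxvec B 0 i)%:P * 'X.
exists (\sum_(u <- mpoly.msupp P) (mpoly.mcoeff u P)%:P *
  \prod_(i < 2 * 2) q i ^+ mpoly.fun_of_multinom u i) => t.
rewrite mpoly.mevalE horner_sum; apply: eq_bigr => u _.
rewrite hornerM hornerC horner_prod; congr (_ * _); apply: eq_bigr => i _.
rewrite horner_exp; congr (_ ^+ _).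
by rewrite linearD linearZ /= !mxE !hornerE mulrC.
Qed.

Lemma poly_nat_roots (p : {poly R}) c : c != 0 -> (forall n : nat, p.[n%:R * c] = 0) -> p = 0.
Proof.
move=> c0 h; apply/eqP/negP => /negP p0.
have /max_poly_roots : p != 0 by [].
move=> /(_ [seq n%:R * c | n <- iota 0 (size p)]); rewrite size_map size_iota ltnn => hp.
suff : false by []; apply: hp.
  by apply/allP => _ /mapP[n _ ->]; rewrite /root h.
rewrite map_inj_uniq ?iota_uniq // => n n' /(mulIf c0)/eqP.
by rewrite eqr_nat => /eqP.
Qed.

Lemma meval_line0 P (A B : 'M[R]_2) c : c != 0 ->
  (forall n : nat, ep P (A + (n%:R * c) *: B) = 0) -> forall t, ep P (A + t *: B) = 0.
Proof.
move=> c0 h t; have [p hp] := meval_line P A B.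
have p0 : p = 0 by apply: (poly_nat_roots c0) => n; rewrite -hp.
by rewrite hp p0 horner0.
Qed.

Lemma upper_det t : \det (mx2 1 t 0 1 : 'M[R]_2) = 1. Proof. by rewrite mx2_det; ring. Qed.
Lemma lower_det t : \det (mx2 1 0 t 1 : 'M[R]_2) = 1. Proof. by rewrite mx2_det; ring. Qed.
Definition upper t : SL2 := mkSL2 (upper_det t).
Definition lower t : SL2 := mkSL2 (lower_det t).

Lemma upper_line (A B : 'M[R]_2) t : A *m val (upper t) *m B = A *m B + t *: (A *m mx2 0 1 0 0 *m B).
Proof.
have -> : val (upper t) = 1%:M + t *: mx2 0 1 0 0 by rewrite -mx2_1; apply/matrixP; elim/ord2; elim/ord2; rewrite !mxE /=; ring.
by rewrite mulmxDr mulmx1 mulmxDl -scalemxAr -scalemxAl.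
Qed.

Lemma lower_line (A B : 'M[R]_2) t : A *m val (lower t) *m B = A *m B + t *: (A *m mx2 0 0 1 0 *m B).
Proof.
have -> : val (lower t) = 1%:M + t *: mx2 0 0 1 0 by rewrite -mx2_1; apply/matrixP; elim/ord2; elim/ord2; rewrite !mxE /=; ring.
by rewrite mulmxDr mulmx1 mulmxDl -scalemxAr -scalemxAl.
Qed.

Lemma SL2_gen (A : SL2) : exists t1 t2 t3 t4,
  val A = val (upper t1) *m val (lower t2) *m val (upper t3) *m val (lower t4).
Proof.
have := SL2_det A; rewrite /=; move: (sval A) => M; rewrite [M]mx2_eta mx2_det.
move: (M 0 0) (M 0 1) (M 1 0) (M 1 1) => a b c d det.
have [c0|c0] := eqVneq c 0.
  have d0 : d != 0 by apply/eqP => d0; move: det; rewrite c0 d0; lra.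
  (* Multiplying on the right by [lower 1] makes the lower left entry equal to [d], which is not 0,
     and reduces to the generic three-factor decomposition below; the factor [lower (-1)] undoes
     this. *)
  exists ((a + b - 1) / d), d, ((d - 1) / d), (-1); rewrite !mx2M.
  have -> : a = d^-1 by apply: (mulIf d0); rewrite mulVf // -det c0; ring.
  by rewrite c0; congr mx2; field; rewrite ?d0.
exists ((a - 1) / c), c, ((d - 1) / c), 0; rewrite !mx2M.
have -> : b = (a * d - 1) / c by rewrite -det; field; rewrite c0.
by congr mx2; field; rewrite ?c0.
Qed.

(** A polynomial that vanishes at infinitely many points of a line vanishes on all of it, so
    multiples of [c] and [d] may be replaced by arbitrary reals, one of the four factors of
    [SL2_gen] at a time. *)
Lemma zariski_dense_shears (S : set (PSL2 R)) c d : c != 0 -> d != 0 ->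
  (forall x y, S x -> S y -> S (x * y)%g) -> S 1%g ->
  S (\pi_(PSL2 R) (upper c)) -> S (\pi_(PSL2 R) (lower d)) -> zariski_dense S.
Proof.
move=> c0 d0 SM S1 Sc Sd P hP A.
have SU (n : nat) : S (\pi_(PSL2 R) (upper (n%:R * c))).
  elim: n => [|n IH].
    suff -> : \pi_(PSL2 R) (upper (0%:R * c)) = 1%g by [].
    by apply/pi_PSL2P; left; rewrite /= mul0r mx2_1.
  have -> : \pi_(PSL2 R) (upper (n.+1%:R * c)) = (\pi_(PSL2 R) (upper (n%:R * c)) * \pi_(PSL2 R) (upper c))%g.
    by rewrite pi_mulg; apply/pi_PSL2P; left; rewrite /= mx2M -natr1; congr mx2; ring.
  exact: SM.
have SL (n : nat) : S (\pi_(PSL2 R) (lower (n%:R * d))).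
  elim: n => [|n IH].
    suff -> : \pi_(PSL2 R) (lower (0%:R * d)) = 1%g by [].
    by apply/pi_PSL2P; left; rewrite /= mul0r mx2_1.
  have -> : \pi_(PSL2 R) (lower (n.+1%:R * d)) = (\pi_(PSL2 R) (lower (n%:R * d)) * \pi_(PSL2 R) (lower d))%g.
    by rewrite pi_mulg; apply/pi_PSL2P; left; rewrite /= mx2M -natr1; congr mx2; ring.
  exact: SM.
have [t1 [t2 [t3 [t4 ->]]]] := SL2_gen A.
have h0 (n1 n2 n3 n4 : nat) : ep P (val (upper (n1%:R * c)) *m val (lower (n2%:R * d)) *m
    val (upper (n3%:R * c)) *m val (lower (n4%:R * d))) = 0.
  set U1 := upper _; set L2 := lower _; set U3 := upper _; set L4 := lower _.
  apply: (hP (sl2_mul (sl2_mul (sl2_mul U1 L2) U3) L4)).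
  rewrite -(pi_mulg _ L4) -(pi_mulg _ U3) -(pi_mulg U1).
  by apply: (SM); [apply: (SM); [apply: SM; [exact: SU|exact: SL]|exact: SU]|exact: SL].
rewrite -(mulmx1 (_ *m val (lower t4))) lower_line; apply: (meval_line0 d0) => n4.
rewrite -lower_line mulmx1 upper_line; apply: (meval_line0 c0) => n3.
rewrite -upper_line -[X in mxvec X]mulmxA lower_line; apply: (meval_line0 d0) => n2.
rewrite -lower_line -(mul1mx (val (upper t1))) -[X in mxvec X]mulmxA upper_line; apply: (meval_line0 c0) => n1.
by rewrite -upper_line mul1mx !mulmxA.
Qed.

End density.

Section family.
Variables (R : realType) (eta m : R).
Hypothesis eta1 : eta = 1 \/ eta = -1.
Hypothesis m0 : 0 < m.

Lemma family_non_elementary : non_elementary (family_rep m eta1).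
Proof.
have e0 : eta != 0 by case: eta1 => ->; rewrite ?oppr_eq0 oner_eq0.
apply: (@zariski_dense_shears _ _ (- (2 * m) * eta) (- (eta * 2))).
- by rewrite mulf_neq0 // oppr_eq0 mulf_neq0 ?lt0r_neq0.
- by rewrite oppr_eq0 mulf_neq0.
- by move=> _ _ [x _ <-] [y _ <-]; exists (x * y)%g => //; rewrite gmulfM.
- by exists 1%g => //; rewrite mult1.
- exists (c4 R) => //; rewrite family_c4 //; apply/pi_PSL2P; left.
  by rewrite /= /shear_mx; congr mx2; ring.
- exists (c1 R) => //; rewrite family_c1; apply/pi_PSL2P; left.
  by rewrite /= /shear_mx; congr mx2; ring.
Qed.

End family.

(** * Lifts to the universal cover of the circle, and the relative Euler class *)

Section shear_lift.
Variable R : realType.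

Lemma dirE (t : R) : dir t = \col_i (if i == 0 then sin t else cos t). Proof. by []. Qed.

Lemma mx2_dir (a b c d t : R) :
  mx2 a b c d *m dir t = \col_i (if i == 0 then a * sin t + b * cos t else c * sin t + d * cos t).
Proof.
apply/matrixP => i j; rewrite !mxE !big_ord_recl big_ord0 !mxE /= addr0.
by case: (i == 0).
Qed.

Variables (s x y : R).
Hypothesis s0 : s != 0.

(** The wedge of the shear vector and [dir t], zero exactly at the fixed direction. The image of
    [dir t] has component [dir_dot] along [dir t] and [dir_wedge] across it; [turn] is its argument
    by the half-angle formula, which is continuous because no direction is sent to the opposite one
    ([stretch_dot]). *)
Definition cross_dir (t : R) : R := x * cos t - y * sin t.
Definition dir_dot (t : R) : R := 1 + s * cross_dir t * (x * sin t + y * cos t).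
Definition dir_wedge (t : R) : R := s * cross_dir t ^+ 2.
Definition stretch (t : R) : R := Num.sqrt (dir_dot t ^+ 2 + dir_wedge t ^+ 2).
Definition turn (t : R) : R := 2 * atan (dir_wedge t / (stretch t + dir_dot t)).
Definition shear_lift (t : R) : R := t + turn t.

Lemma stretch_sq t : stretch t ^+ 2 = dir_dot t ^+ 2 + dir_wedge t ^+ 2.
Proof. by rewrite sqr_sqrtr // addr_ge0 ?sqr_ge0. Qed.

Lemma wedge_eq0 t : dir_wedge t = 0 -> cross_dir t = 0.
Proof. by move/eqP; rewrite mulf_eq0 (negbTE s0) sqrf_eq0 => /eqP. Qed.

Lemma stretch_dot t : 0 < stretch t /\ 0 < stretch t + dir_dot t.
Proof.
have := stretch_sq t; have : 0 <= stretch t := sqrtr_ge0 _.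
have [w0|] := eqVneq (dir_wedge t) 0.
  by rewrite w0 expr0n addr0 /dir_dot (wedge_eq0 w0) mulr0 mul0r addr0; nra.
move: (stretch t) (dir_dot t) (dir_wedge t) => n a b b0 n0 e.
have b2 : 0 < b ^+ 2 by rewrite exprn_even_gt0.
by split; nra.
Qed.

Lemma turn_cos_sin t : cos (turn t) = dir_dot t / stretch t /\ sin (turn t) = dir_wedge t / stretch t.
Proof.
have [n0 na0] := stretch_dot t; have n2 := stretch_sq t; rewrite /turn.
move: (stretch t) (dir_dot t) (dir_wedge t) n0 na0 n2 => n a b n0 na0 n2.
set u := b / (n + a); have c0 : 0 < cos (atan u).
  by apply: cos_gt0_pihalf; rewrite atan_gtNpi2 atan_ltpi2.
have su : sin (atan u) = u * cos (atan u).
  by rewrite -[X in X * _]atanK /tan divfK // lt0r_neq0.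
have eb : b = u * (n + a) by rewrite divfK // lt0r_neq0.
have cs := cos2Dsin2 (atan u); rewrite mulr_natl mulr2n cosD sinD su in cs *.
move: (cos (atan u)) c0 cs => c c0 cs; move: u eb cs {su} => u eb cs.
have h1 : (n + a) * (1 + u ^+ 2) = 2 * n.
  apply: (mulfI (lt0r_neq0 na0)); have n3 : (u * (n + a)) ^+ 2 = n ^+ 2 - a ^+ 2 by rewrite -eb n2; ring.
  transitivity ((n + a) ^+ 2 + (u * (n + a)) ^+ 2); first by ring.
  by rewrite n3; ring.
have h2 : 2 * n * c ^+ 2 = n + a.
  rewrite -h1; transitivity ((n + a) * (c ^+ 2 + (u * c) ^+ 2)); first by ring.
  by rewrite cs mulr1.
have nn := lt0r_neq0 n0; split; apply: (mulIf nn); rewrite divfK //; last rewrite eb; nra.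
Qed.

Lemma shear_liftE t :
  mx2 (1 - s * x * y) (s * x ^+ 2) (- (s * y ^+ 2)) (1 + s * x * y) *m dir t =
  stretch t *: dir (shear_lift t).
Proof.
have [ct st] := turn_cos_sin t; have [/lt0r_neq0 n0 _] := stretch_dot t.
rewrite mx2_dir; apply/matrixP => i j; rewrite !mxE.
have -> : sin (shear_lift t) = (sin t * dir_dot t + cos t * dir_wedge t) / stretch t.
  by rewrite sinD ct st; ring.
have -> : cos (shear_lift t) = (cos t * dir_dot t - sin t * dir_wedge t) / stretch t.
  by rewrite cosD ct st; ring.
have := cos2Dsin2 t; rewrite /dir_dot /dir_wedge /cross_dir; move: (cos t) (sin t) => c s' cs.
case: (i == 0); rewrite [RHS]mulrC divfK //.
  transitivity (s' + s * (x * c - y * s') * x * (c ^+ 2 + s' ^+ 2)); last by ring.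
  by rewrite cs; ring.
transitivity (c + s * (x * c - y * s') * y * (c ^+ 2 + s' ^+ 2)); last by ring.
by rewrite cs; ring.
Qed.

Lemma shear_lift_continuous : continuous shear_lift.
Proof.
have cc (c : R) : continuous (fun _ : R => c) by move=> ?; exact: cvg_cst.
have cs := @continuous_sin R; have cC := @continuous_cos R.
have ccr : continuous cross_dir by apply: sub_continuous; apply: mul_continuous.
have cdot : continuous dir_dot.
  apply: add_continuous => //; apply: mul_continuous; first exact: mul_continuous.
  by apply: add_continuous; apply: mul_continuous.
have cw : continuous dir_wedge by apply: mul_continuous => //; apply: mul_continuous.
have cst : continuous stretch.
  apply: (@comp_continuous _ _ _ (fun t => dir_dot t ^+ 2 + dir_wedge t ^+ 2) Num.sqrt); last exact: sqrt_continuous.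
  by apply: add_continuous; apply: mul_continuous.
apply: add_continuous; first by move=> ?; exact: cvg_id.
apply: mul_continuous => //.
apply: (@comp_continuous _ _ _ (fun t => dir_wedge t / (stretch t + dir_dot t)) atan); last exact: continuous_atan.
apply: mul_continuous => // t; apply: cvgV; first by rewrite lt0r_neq0 // (stretch_dot t).2.
exact: (add_continuous cst cdot).
Qed.

Lemma shear_lift_fixed t : cross_dir t = 0 -> shear_lift t = t.
Proof.
by move=> c0; rewrite /shear_lift /turn /dir_wedge c0 expr0n mulr0 mul0r atan0 mulr0 addr0.
Qed.

(** A positive strength makes [dir_wedge] non-negative, so directions only turn forwards, by less
    than half a turn of the vector. *)
Lemma shear_lift_range t : 0 < s -> t <= shear_lift t < t + pi.
Proof.
move=> sp; have [n0 na0] := stretch_dot t; have := atan_ltpi2 (dir_wedge t / (stretch t + dir_dot t)).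
rewrite /shear_lift /turn; set u := _ / _ => h.
have u0 : 0 <= u by rewrite /u /dir_wedge divr_ge0 ?(ltW na0) // mulr_ge0 ?sqr_ge0 // ltW.
suff : 0 <= atan u by lra.
have a1 := atan_gtNpi2 u.
rewrite leNgt; apply/negP => an.
have c0 : 0 < cos (atan u) by apply: cos_gt0_pihalf; rewrite a1 h.
have su : sin (atan u) = u * cos (atan u).
  by rewrite -[X in X * _]atanK /tan divfK // lt0r_neq0.
have : 0 < sin (- atan u) by apply: sin_gt0_pi; have := pi_gt0 R; lra.
by rewrite sinN su; nra.
Qed.

End shear_lift.

Section winding.
Variable R : realType.

Lemma sin_cos_full (d : R) : - pi <= d < pi -> cos d = 1 -> d = 0.
Proof.
move=> /andP[d1 d2] cd; have pi0 := pi_gt0 R.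
have : `|d| = 0.
  apply: cos_inj.
  - by rewrite in_itv /= normr_ge0 ler_norml d1 ltW.
  - by rewrite in_itv /= lexx ltW.
  by rewrite cos0; case: (ger0P d) => _; rewrite ?cosN.
by move/normr0_eq0.
Qed.

(** The values are multiples of [2 pi]; a continuous function that left 0 would take a nonzero value
    of absolute value at most [pi / 2]. *)
Lemma continuous_full_turns (D : R -> R) (a b : R) : continuous D ->
  (forall t, cos (D t) = 1) -> D a = 0 -> D b = 0.
Proof.
move=> cD h Da; have pi0 := pi_gt0 R.
have ivt v : Num.min (D a) (D b) <= v <= Num.max (D a) (D b) -> exists c, D c = v.
  have [ab|/ltW ab] := leP a b => hv.
    by have [|c _ e] := IVT ab _ hv; [exact: continuous_subspaceT|exists c].
  have [||c _ e] := @IVT R D b a v ab; [exact: continuous_subspaceT| |by exists c].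
  by rewrite minC maxC.
have [//|] := eqVneq (D b) 0; rewrite Da in ivt; rewrite neq_lt => /orP[] Db.
  have [v [v1 v2 v3]] : exists v, [/\ D b <= v, v < 0 & - (pi / 2) <= v].
    have [l|l] := lerP (D b) (- (pi / 2)); [exists (- (pi / 2))|exists (D b)]; split; lra.
  have [|c e] := ivt v; first by rewrite (min_idPr (ltW Db)) (max_idPl (ltW Db)) v1 ltW.
  have v0 : v = 0 by apply: sin_cos_full; [apply/andP; split; lra|rewrite -e h].
  by rewrite v0 ltxx in v2.
have [v [v1 v2 v3]] : exists v, [/\ v <= D b, 0 < v & v <= pi / 2].
  have [l|l] := lerP (D b) (pi / 2); [exists (D b)|exists (pi / 2)]; split; lra.
have [|c e] := ivt v; first by rewrite (min_idPl (ltW Db)) (max_idPr (ltW Db)) v1 ltW.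
have v0 : v = 0 by apply: sin_cos_full; [apply/andP; split; lra|rewrite -e h].
by rewrite v0 ltxx in v2.
Qed.

Lemma dir_opp (r t u : R) : 0 < r -> - dir t = r *: dir u -> cos (u - t - pi) = 1.
Proof.
move=> r0 /matrixP h; have := h 0 0; have := h 1 0; rewrite !mxE /= => e1 e2.
have r1 : r = 1.
  have : r ^+ 2 * (cos u ^+ 2 + sin u ^+ 2) = cos t ^+ 2 + sin t ^+ 2.
    by rewrite mulrDr -!exprMn -e1 -e2 !sqrrN.
  by rewrite !cos2Dsin2; nra.
have -> : cos (u - t - pi) = - cos (u - t) by rewrite -[in RHS](subrK pi (u - t)) cosDpi opprK.
rewrite cosB.
rewrite r1 !mul1r in e1 e2; rewrite -e1 -e2 !mulNr -opprD opprK -!expr2.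
exact: cos2Dsin2.
Qed.

End winding.

Section euler.
Variables (R : realType) (m : R).
Hypothesis m0 : 0 < m.
Local Notation bp := (basepoint R).
Local Notation f i := (shear_lift (scale m i) (vx m i) (vy R i)).

Lemma base_lift (i : nat) t : exists2 r, 0 < r &
  val (gen m (or_introl erefl : (1 : R) = 1 \/ 1 = -1) i) *m dir t = r *: dir (f i t).
Proof.
exists (stretch (scale m i) (vx m i) (vy R i) t).
  by have [] := stretch_dot (vx m i) (vy R i) (scale_neq0 m0 i) t.
by rewrite -shear_liftE ?scale_neq0 //= /shear_mx !mul1r.
Qed.

(** The matrices multiply to [-1], so the composite differs from the identity by a constant odd
    multiple of [pi]. The constant is found at [pi / 2], which the lift of [gen 3] fixes, by
    bounding the total rotation of the other three. *)
Lemma base_turn t : f 0 (f 1 (f 2 (f 3 t))) = t + pi.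
Proof.
have s0 i : scale m i != 0 := scale_neq0 m0 i.
have cf i : continuous (f i) by exact: shear_lift_continuous.
pose G t := f 0 (f 1 (f 2 (f 3 t))).
have cG : continuous G by do !apply: comp_continuous => //.
suff : G t - t - pi = 0 by rewrite /G; lra.
have full u : cos (G u - u - pi) = 1.
  have [r0 p0 e0] := base_lift 0 (f 1 (f 2 (f 3 u))).
  have [r1 p1 e1] := base_lift 1 (f 2 (f 3 u)).
  have [r2 p2 e2] := base_lift 2 (f 3 u).
  have [r3 p3 e3] := base_lift 3 u.
  apply: (@dir_opp _ (r3 * r2 * r1 * r0)); first by rewrite !mulr_gt0.
  have -> : - dir u = - 1%:M *m dir u by rewrite mulNmx mul1mx.
  rewrite -(gen_prod (or_introl erefl) m0) -!mulmxA e3 -!scalemxAr e2 -!scalemxAr e1 -!scalemxAr e0.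
  by rewrite !scalerA.
apply: (@continuous_full_turns R (fun u => G u - u - pi) (pi / 2) t) => //.
  apply: sub_continuous; last by move=> ?; exact: cvg_cst.
  by apply: sub_continuous => // ?; exact: cvg_id.
apply: sin_cos_full => //.
have f3 : f 3 (pi / 2) = pi / 2.
  by apply: shear_lift_fixed; rewrite /cross_dir /= cos_pihalf mulr0 mul0r subr0.
have pi0 := pi_gt0 R; have ? : 0 < m := m0.
have q0 : 0 < 3 * m + 4 by lra.
have sp0 : 0 < scale m 0 by [].
have sp1 : 0 < scale m 1 by rewrite /= divr_gt0 // mulr_gt0 // addr_gt0.
have sp2 : 0 < scale m 2 by rewrite /= divr_gt0.
rewrite /G f3; set t2 := f 2 (pi / 2); set t1 := f 1 t2.
have /andP[a2 b2] : pi / 2 <= t2 < pi / 2 + pi := shear_lift_range _ _ (s0 2) _ sp2.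
have /andP[a1 b1] : t2 <= t1 < t2 + pi := shear_lift_range _ _ (s0 1) _ sp1.
have /andP[a0 b0] : t1 <= f 0 t1 < t1 + pi := shear_lift_range _ _ (s0 0) _ sp0.
have [r2 p2 e2] := base_lift 2 (pi / 2); rewrite -/t2 in e2.
have [r1 p1 e1] := base_lift 1 t2; rewrite -/t1 in e1.
(* The image under [gen 2] of the direction at [pi / 2] has a positive first coordinate, that is a
   positive sine. *)
have t2pi : t2 < pi.
  rewrite ltNge; apply/negP => h.
  have : sin t2 <= 0.
    by rewrite -[t2](subrK pi) sinDpi oppr_le0; apply: sin_ge0_pi; lra.
  move/matrixP: e2 => /(_ 0 0); rewrite /= /shear_mx mx2_dir !mxE /= cos_pihalf sin_pihalf mulr1 mulr0 addr0.
  set z := (X in X = _); have -> : z = 1 + 2 / (3 * m + 4) * (2 + 3 * m) by rewrite /z; ring.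
  have : 0 < 2 / (3 * m + 4) * (2 + 3 * m) by rewrite mulr_gt0 // ?divr_gt0 //; lra.
  nra.
(* This bound suffices: the last lift adds less than [pi], so the angle reached is in
   [[pi / 2, 5 pi / 2)], where [3 pi / 2] is the only possible value. The bound itself holds because
   the second coordinate after [gen 1] and [gen 2] is [-2]. *)
suff : t1 < 3 * (pi / 2) by move=> ?; apply/andP; split; lra.
rewrite ltNge; apply/negP => h.
have c1 : 0 <= cos t1.
  by rewrite -cosN -(@cosD2pi _ (- t1)); apply: cos_ge0_pihalf; lra.
have : val (gen m (or_introl erefl : (1 : R) = 1 \/ 1 = -1) 1) *m val (gen m (or_introl erefl : (1 : R) = 1 \/ 1 = -1) 2) *m dir (pi / 2) =
  (r2 * r1) *: dir t1.
  by rewrite -mulmxA e2 -scalemxAr e1 scalerA.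
move/matrixP => /(_ 1 0); rewrite /= /shear_mx mx2M mx2_dir !mxE /= cos_pihalf sin_pihalf mulr1 mulr0 addr0.
set z := (X in X = _); have -> : z = -2 by rewrite /z; field; exact: lt0r_neq0.
have : 0 <= r2 * r1 * cos t1 by rewrite !mulr_ge0 // ltW.
lra.
Qed.

Variable (eta : R).
Hypothesis eta1 : eta = 1 \/ eta = -1.

Lemma gen_lift i t : exists r,
  val (gen m eta1 i) *m dir t = r *: dir (eta * f i (eta * t)).
Proof.
have [r _ e] := base_lift i (eta * t); exists r; move: e.
rewrite /= /shear_mx !mx2_dir => /matrixP h; apply/matrixP => j k; have := h j k.
rewrite !mxE !mul1r; case: (j == 0); case: eta1 => ->; rewrite ?mul1r // !mulN1r ?sinN ?cosN; lra.
Qed.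

Lemma gen_parabolic_lift i : parabolic_lift (\pi_(PSL2 R) (gen m eta1 i)) (fun t => eta * f i (eta * t)).
Proof.
have s0 := scale_neq0 m0 i; have cc (c : R) : continuous (fun _ : R => c) by move=> ?; exact: cvg_cst.
split; first split.
- apply: mul_continuous => //; apply: (@comp_continuous _ _ _ ( *%R eta)); last exact: shear_lift_continuous.
  by apply: mul_continuous => // ?; exact: cvg_id.
- move=> t; have [r er] := gen_lift i t.
  have /pi_PSL2P[->|->] : \pi_(PSL2 R) (repr (\pi_(PSL2 R) (gen m eta1 i))) = \pi_(PSL2 R) (gen m eta1 i) by rewrite reprK.
    by exists r.
  by exists (- r); rewrite mulNmx er scaleNr.
have [t ht] : exists t, cross_dir (vx m i) (vy R i) t = 0.
  have key y : exists t, cross_dir y 1 t = 0.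
    exists (atan y); rewrite /cross_dir -{1}[y]atanK /tan divfK ?mul1r ?subrr //.
    by rewrite lt0r_neq0 // cos_gt0_pihalf // atan_gtNpi2 atan_ltpi2.
  case: i {s0} => [|[|[|i]]]; try exact: key.
  by exists (pi / 2); rewrite /cross_dir cos_pihalf mulr0 mul0r subr0.
exists (eta * t); have ee : eta * (eta * t) = t by case: eta1 => ->; ring.
by rewrite ee shear_lift_fixed.
Qed.

Lemma family_euler (e : int) : eta = e%:~R -> relative_euler_class (family_rep m eta1) e.
Proof.
move=> he; exists (fun t => eta * f 0 (eta * t)), (fun t => eta * f 1 (eta * t)),
  (fun t => eta * f 2 (eta * t)), (fun t => eta * f 3 (eta * t)).
split; rewrite ?family_c1 ?family_c2 ?family_c3 ?family_c4 //; try exact: gen_parabolic_lift.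
have ee t : eta * (eta * t) = t by case: eta1 => ->; ring.
by move=> t; rewrite !ee base_turn mulrDr ee -he.
Qed.

End euler.

(** * Uncountably many conjugacy classes *)

Section transcendental.
Variable R : realType.

Lemma root_finite (p : {poly R}) : p != 0 -> finite_set [set x | root p x].
Proof.
move=> p0; apply: contrapT => /(@infinite_set_fset _ _ (size p))[B hB sB].
have := max_poly_roots p0 (rs := enum_fset B) _ (fset_uniq B).
rewrite ltnNge sB; suff -> : all (root p) (enum_fset B) by move/(_ isT).
by apply/allP => x xB; apply: (hB x).
Qed.

Definition transcendental : set R := [set m | 0 < m /\ forall p : {poly int}, p != 0 -> ev m p != 0].

(** Integer polynomials are countably many with finitely many roots each, so otherwise the interval
    []0, 1[] would be countable and have measure 0. *)
Lemma transcendental_uncountable : ~ countable transcendental.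
Proof.
move=> cT; pose roots (p : {poly int}) : set R := [set x | p != 0 /\ root (map_poly intr p) x].
pose A : set R := \bigcup_(o in [set: option {poly int}]) (if o is Some p then roots p else transcendental).
have cA : countable A.
  apply: bigcup_countable; first exact: countableP.
  case=> [p|] _ //; have [p0|p0] := eqVneq p 0.
    by rewrite (_ : roots p = set0) // -subset0 => x [/eqP].
  apply: finite_set_countable; apply: sub_finite_set (root_finite (p := map_poly intr p) _).
    by move=> x [].
  by rewrite map_poly_eq0_id0 // intr_eq0 lead_coef_eq0.
have : countable (`]0, 1[%classic : set R).
  apply: sub_countable cA; apply: subset_card_le => m; rewrite /= in_itv /= => /andP[m0 _].
  have [h|h] := pselect (transcendental m); first by exists None.
  have [[p p0 e]|h'] := pselect (exists2 p : {poly int}, p != 0 & root (map_poly intr p) m).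
    by exists (Some p).
  exfalso; apply: h; split=> // p p0.
  by apply/negP => /eqP e; apply: h'; exists p => //; apply/eqP.
move=> /countable_lebesgue_measure0; rewrite lebesgue_measure_itv /= lte_fin ltr01.
by rewrite -EFinB subr0 => /eqP; rewrite eqe oner_eq0.
Qed.

End transcendental.

Section classes.
Variables (R : realType) (e : int).
Hypothesis he : e = 1 \/ e = -1.

Let eta : R := e%:~R.
Let eta1 : eta = 1 \/ eta = -1.
Proof. by rewrite /eta; case: he => ->; [left|right]. Qed.

(** The absolute trace of the image of [c4 * c1] is a conjugacy invariant, equal to [2 + 4 m]. *)
Lemma family_class_inj (m m' : R) : 0 < m -> 0 < m' ->
  conjugacy_class (family_rep m eta1) = conjugacy_class (family_rep m' eta1) -> m = m'.
Proof.
move=> m0 m0' ec; have : conjugacy_class (family_rep m' eta1) (family_rep m' eta1).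
  by exists 1%g => x; rewrite conjg1.
rewrite -ec => -[g hg]; have := hg (c4 R * c1 R)%g.
rewrite !gmulfM !family_c4 // !family_c1 => /(congr1 (@psl2_abstr R)).
rewrite psl2_abstrJ !pi_mulg !psl2_abstr_pi /= /shear_mx !mx2M !mx2_tr.
have tr (a : R) :
  (1 - - (2 * a) * 1 * 0) * (1 - 2 * 0 * 1) + eta * (- (2 * a) * 1 ^+ 2) * - (eta * (2 * 1 ^+ 2)) +
  (- (eta * (- (2 * a) * 0 ^+ 2)) * (eta * (2 * 0 ^+ 2)) + (1 + - (2 * a) * 1 * 0) * (1 + 2 * 0 * 1)) = 2 + 4 * a.
  by case: eta1 => ->; ring.
Show. rewrite !tr. rewrite !ger0_norm; lra.
Qed.

Theorem uncountable_classes :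
  ~ countable [set conjugacy_class rho | rho in
     [set rho : rep R | [/\ non_elementary rho, type_preserving rho,
                   relative_euler_class rho e & simple_hyperbolic rho]]].
Proof.
move=> cX; apply: (@transcendental_uncountable R).
pose F m := conjugacy_class (family_rep m eta1).
have iF : {in @transcendental R &, injective F}.
  by move=> m m' /set_mem[m0 _] /set_mem[m0' _]; exact: family_class_inj.
rewrite -(eq_countable (inj_card_eq iF)).
apply: sub_countable cX; apply: subset_card_le => _ [m [m0 mt] <-].
exists (family_rep m eta1) => //; split.
- exact: family_non_elementary.
- exact: family_type_preserving.
- exact: family_euler.
- exact: family_simple_hyperbolic.
Qed.

End classes.

(** * Shimizu's lemma for discrete subgroups *)

Section shimizu.
Variable R : realType.
Local Notation SL2 := (SL2 R).
Local Notation PSL2 := (PSL2 R).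

Lemma isolated_entries (S : set PSL2) (P : SL2) : isolated S (\pi_PSL2 P) ->
  exists2 e : R, 0 < e & forall Q : SL2, S (\pi_PSL2 Q) ->
    (forall i j, `|val P i j - val Q i j| < e) -> \pi_PSL2 Q = \pi_PSL2 P.
Proof.
case=> _ [V nV VS].
have : nbhs (val P : 'M[R]_2) (fun A => forall Q : SL2, val Q = A -> V (\pi_PSL2 Q)).
  have : nbhs P (\pi_PSL2 @^-1` V) by apply: (@pi_continuous SL2 PSL2).
  rewrite nbhsE => -[U [[W oW WU] UP] UV].
  apply: (@filterS _ _ _ W); last by apply: open_nbhs_nbhs; split=> //; move: UP; rewrite -WU.
  by move=> A WA Q QA; apply: UV; rewrite -WU; move: WA; rewrite -QA.
move=> /nbhs_ballP[e e0 he]; exists e => // Q SQ PQ.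
suff : (V `&` S) (\pi_PSL2 Q) by rewrite VS.
by split=> //; apply: (he (val Q)) => //; split.
Qed.

(** The shear with [eta = 1], now as a normal form for all matrices of determinant 1 and trace 2
    ([trace2_tv]), the identity included with [s = 0]. *)
Definition tv (s x y : R) : 'M[R]_2 := mx2 (1 - s * x * y) (s * x ^+ 2) (- (s * y ^+ 2)) (1 + s * x * y).

Lemma tv_det s x y : \det (tv s x y) = 1.
Proof. by rewrite mx2_det; ring. Qed.

Definition tvSL s x y : SL2 := mkSL2 (tv_det s x y).

Lemma trace2_tv (A : 'M[R]_2) : \det A = 1 -> \tr A = 2 -> exists s x y, A = tv s x y.
Proof.
rewrite [A]mx2_eta mx2_det mx2_tr; move: (A 0 0) (A 0 1) (A 1 0) (A 1 1) => a b c d hd ht.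
have ed : d = 2 - a by lra.
have [c0|c0] := eqVneq c 0.
  have a1 : a = 1 by move: hd; rewrite c0 ed; nra.
  by exists b, 1, 0; rewrite ed a1 c0 /tv; congr mx2; ring.
exists (- c), ((a - 1) / c), 1; rewrite ed /tv.
have eb : b = - (a - 1) ^+ 2 / c by apply: (mulIf c0); rewrite divfK //; move: hd; rewrite ed; nra.
by rewrite eb; congr mx2; field.
Qed.

Lemma tv_tr s x y : \tr (tv s x y) = 2. Proof. by rewrite mx2_tr; ring. Qed.

Lemma tv_trM s x y s' x' y' : \tr (tv s x y *m tv s' x' y') = 2 - s * s' * (x' * y - y' * x) ^+ 2.
Proof. by rewrite mx2M mx2_tr; ring. Qed.

Lemma tv_conj s x y s' x' y' (w := x' * y - y' * x) :
  tv s' x' y' *m tv s x y *m invmx (tv s' x' y') = tv s (x + s' * w * x') (y + s' * w * y').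
Proof.
have d := tv_det s' x' y'; rewrite /tv mx2_det in d.
by rewrite mx2_adj // !mx2M /w; congr mx2; ring.
Qed.

Lemma tv_commute s x y s' x' y' : \tr (tv s x y *m tv s' x' y') = 2 ->
  tv s x y *m tv s' x' y' = tv s' x' y' *m tv s x y.
Proof.
rewrite tv_trM => h; have : s * s' * (x' * y - y' * x) ^+ 2 = 0 by lra.
move/eqP; rewrite mulf_eq0 sqrf_eq0 => /orP[|/eqP e]; last first.
  have w0 : x' * y = y' * x by lra.
  by rewrite !mx2M; congr mx2; ring: w0.
rewrite mulf_eq0 => /orP[]/eqP ->; rewrite !mx2M; congr mx2; ring.
Qed.

Lemma geometric_cvg (Z : nat -> R) (z C k : R) : 0 <= k < 1 ->
  (forall n, `|Z n.+1 - z| <= C * k ^+ n) -> Z @ \oo --> z.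
Proof.
move=> /andP[k0 k1] h; rewrite -cvg_shiftS; apply/subr_cvg0.
have g0 : (fun n => C * k ^+ n) @ \oo --> (0 : R) by apply: cvg_geometric; rewrite ger0_norm.
apply: (@squeeze_cvgr _ _ _ _ (fun n => - (C * k ^+ n)) (fun n => C * k ^+ n)) => //.
  by near=> n; have := h n; rewrite ler_norml.
by rewrite -oppr0; apply: cvgN.
Unshelve. all: by end_near.
Qed.

Section iteration.
Variables (s x y X0 Y0 : R).

(** By [tv_conj], the vectors of the shears obtained by iterating [T |-> T P T^-1], where [P] is the
    shear of strength [s] along [(x, y)]. Conjugation preserves the strength, so only the vector has
    to be followed. *)
Fixpoint tv_orbit (n : nat) : R * R :=
  if n is n'.+1 then
    let v := tv_orbit n' in let c := v.1 * y - v.2 * x in (x + s * c * v.1, y + s * c * v.2)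
  else (X0, Y0).

Definition tv_speed n := s * ((tv_orbit n).1 * y - (tv_orbit n).2 * x).

Lemma tv_speedS n : tv_speed n.+1 = tv_speed n ^+ 2.
Proof. by rewrite /tv_speed /=; ring. Qed.

Hypothesis slow : `|tv_speed 0| < 1.
Let k : R := `|tv_speed 0|.

Let kX n : k * k ^+ n <= k.
Proof. by apply: ler_piMr; rewrite ?exprn_ile1 ?normr_ge0 // ltW. Qed.

Lemma tv_speed_le n : `|tv_speed n| <= k ^+ n.+1.
Proof.
elim: n => [|n IH]; first by rewrite expr1.
rewrite tv_speedS normrX expr2 exprS ler_pM //.
by apply: le_trans IH _; rewrite exprS.
Qed.

Lemma tv_coord_cvg (Z : nat -> R) (z : R) :
  (forall n, Z n.+1 = z + tv_speed n * Z n) -> Z @ \oo --> z.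
Proof.
move=> hZ; have k0 : 0 <= k := normr_ge0 _; have k1 : 0 < 1 - k by rewrite subr_gt0.
(* Large enough to bound [Z 0] and to satisfy [|z| + k M <= M], so that the recursion keeps [Z]
   bounded by [M]. *)
pose M := `|Z 0%N| + `|z| / (1 - k).
have hM : `|z| + k * M <= M.
  have : (1 - k) * M = (1 - k) * `|Z 0%N| + `|z| by rewrite /M mulrDr [_ * (_ / _)]mulrC divfK ?lt0r_neq0.
  by have := normr_ge0 (Z 0%N); nra.
have sk n : `|tv_speed n| <= k.
  by apply: le_trans (tv_speed_le n) _; rewrite exprS.
have bZ n : `|Z n| <= M.
  elim: n => [|n IH]; first by rewrite lerDl divr_ge0 // ltW.
  rewrite hZ; apply: le_trans hM; apply: le_trans (ler_normD _ _) _.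
  by rewrite lerD2l normrM ler_pM.
apply: (@geometric_cvg _ _ (M * k) k); first by rewrite k0.
move=> n; rewrite hZ addrAC subrr add0r normrM mulrC -mulrA -exprS.
by rewrite ler_pM // tv_speed_le.
Qed.

Lemma tv_orbit_cvg : (fun n => (tv_orbit n).1) @ \oo --> x /\ (fun n => (tv_orbit n).2) @ \oo --> y.
Proof. by split; apply: tv_coord_cvg => n /=; rewrite /tv_speed; ring. Qed.

End iteration.

(** With [T_0 = Q P Q^-1] and [T_(n+1) = T_n P T_n^-1], the quantity [tv_speed] starts at
    [2 - tr (P Q)] and is squared at each step. If its absolute value is strictly between 0 and 1,
    the [T_n] converge to [P] without ever commuting with it, against isolation of [P]. *)
Theorem shimizu (S : set PSL2) (P Q : SL2) : S `<=` isolated S ->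
  (forall g h, S g -> S h -> S (g * h)%g) -> (forall g, S g -> S (g^-1)%g) ->
  S (\pi_PSL2 P) -> S (\pi_PSL2 Q) -> \tr (val P) = 2 -> \tr (val Q) = 2 ->
  \tr (val P *m val Q) = 2 \/ 1 <= `|\tr (val P *m val Q) - 2|.
Proof.
move=> iS SM SV SP SQ trP trQ.
have [s [x [y eP]]] := trace2_tv (SL2_det P) trP.
have [s' [x' [y' eQ]]] := trace2_tv (SL2_det Q) trQ.
have eP' : P = tvSL s x y by apply: val_inj.
have eQ' : Q = tvSL s' x' y' by apply: val_inj.
have [h|slow] := lerP 1 `|\tr (val P *m val Q) - 2|; first by right.
left; apply: contrapT => nt; pose w := x' * y - y' * x.
pose v n := tv_orbit s x y (x + s' * w * x') (y + s' * w * y') n.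
pose u n := tv_speed s x y (x + s' * w * x') (y + s' * w * y') n.
have tr2 : \tr (val P *m val Q) - 2 = - u 0%N.
  by rewrite eP eQ tv_trM /u /tv_speed /= /w; ring.
have u0 n : u n != 0.
  elim: n => [|n IH]; last by rewrite /u tv_speedS expf_neq0.
  by rewrite -oppr_eq0 -tr2 subr_eq0; apply/eqP.
have slow' : `|u 0%N| < 1 by rewrite -normrN -tr2.
have Sv n : S (\pi_PSL2 (tvSL s (v n).1 (v n).2)).
  elim: n => [|n IH].
    have -> : \pi_PSL2 (tvSL s (v 0%N).1 (v 0%N).2) = (\pi_PSL2 Q * \pi_PSL2 P * (\pi_PSL2 Q)^-1)%g.
      rewrite pi_invg (pi_mulg Q) (pi_mulg _ (sl2_inv Q)) eP' eQ'; apply/pi_PSL2P; left.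
      by rewrite /= tv_conj.
    by apply: (SM); [exact: SM|exact: SV].
  set T := tvSL s (v n).1 (v n).2.
  have -> : \pi_PSL2 (tvSL s (v n.+1).1 (v n.+1).2) = (\pi_PSL2 T * \pi_PSL2 P * (\pi_PSL2 T)^-1)%g.
    rewrite pi_invg (pi_mulg T) (pi_mulg _ (sl2_inv T)) eP'; apply/pi_PSL2P; left.
    by rewrite /= tv_conj.
  by apply: (SM); [exact: SM|exact: SV].
have [e e0 he] := isolated_entries (iS _ SP).
have [cx cy] := tv_orbit_cvg slow'.
have cc (c : R) : (fun _ : nat => c) @ \oo --> c by exact: cvg_cst.
have e1 : (fun n => 1 - s * (v n).1 * (v n).2) @ \oo --> 1 - s * x * y.
  by apply: cvgB => //; apply: cvgM => //; apply: cvgM.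
have e2 : (fun n => s * (v n).1 ^+ 2) @ \oo --> s * x ^+ 2.
  by apply: cvgM => //; apply: cvgM.
have e3 : (fun n => - (s * (v n).2 ^+ 2)) @ \oo --> - (s * y ^+ 2).
  by apply: cvgN; apply: cvgM => //; apply: cvgM.
have e4 : (fun n => 1 + s * (v n).1 * (v n).2) @ \oo --> 1 + s * x * y.
  by apply: cvgD => //; apply: cvgM => //; apply: cvgM.
have [n [n1 n2 n3 n4]] : exists n, [/\ `|1 - s * x * y - (1 - s * (v n).1 * (v n).2)| < e,
    `|s * x ^+ 2 - s * (v n).1 ^+ 2| < e, `|- (s * y ^+ 2) - - (s * (v n).2 ^+ 2)| < e &
    `|1 + s * x * y - (1 + s * (v n).1 * (v n).2)| < e].
  have : \forall n \near \oo, [/\ `|1 - s * x * y - (1 - s * (v n).1 * (v n).2)| < e,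
    `|s * x ^+ 2 - s * (v n).1 ^+ 2| < e, `|- (s * y ^+ 2) - - (s * (v n).2 ^+ 2)| < e &
    `|1 + s * x * y - (1 + s * (v n).1 * (v n).2)| < e].
    near=> n; split; near: n.
    - by move/cvgrPdist_lt: e1; apply.
    - by move/cvgrPdist_lt: e2; apply.
    - by move/cvgrPdist_lt: e3; apply.
    - by move/cvgrPdist_lt: e4; apply.
  by case=> N _ h; exists N; apply: (h N) => /=.
(* Isolation forces equality up to sign. The traces exclude the sign -1, and equality makes the
   speed vanish because [P * P] has trace 2. *)
have /pi_PSL2P : \pi_PSL2 (tvSL s (v n).1 (v n).2) = \pi_PSL2 P.
  by apply: he => //; rewrite eP; elim/ord2; elim/ord2; rewrite !mxE.
case=> [e5|/(congr1 mxtrace)]; last by rewrite raddfN /= trP tv_tr; lra.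
have : \tr (val P *m val P) = 2 by rewrite eP tv_trM; ring.
rewrite -{2}e5 eP tv_trM => h; have : u n ^+ 2 = 0.
  transitivity (s * s * ((v n).1 * y - (v n).2 * x) ^+ 2); last lra.
  by rewrite /u /tv_speed -/(v n); ring.
by move/eqP; rewrite sqrf_eq0 (negbTE (u0 n)).
Unshelve. all: by end_near.
Qed.

End shimizu.

(** * The sign of the product of the four lifts *)

Section lifts.
Variable R : realType.
Local Notation SL2 := (SL2 R).
Local Notation PSL2 := (PSL2 R).

Lemma continuous_nonzero_pos (D : R -> R) (a b : R) : continuous D ->
  (forall t, D t != 0) -> 0 < D a -> 0 < D b.
Proof.
move=> cD h Da; rewrite ltNge; apply/negP => Db.
have [c c0] : exists c, D c = 0.
  have [ab|/ltW ab] := leP a b.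
    have [||c _ e] := @IVT R D a b 0 ab; [exact: continuous_subspaceT| |by exists c].
    by rewrite ge_min le_max Db (ltW Da) ?orbT.
  have [||c _ e] := @IVT R D b a 0 ab; [exact: continuous_subspaceT| |by exists c].
  by rewrite ge_min le_max Db (ltW Da) ?orbT.
by move: (h c); rewrite c0 eqxx.
Qed.

Lemma dir_neq0 (t : R) : dir t <> 0.
Proof.
move=> /matrixP h; have := h 0 0; have := h 1 0; rewrite !mxE /= => e1 e2.
by have := cos2Dsin2 t; rewrite e1 e2 expr0n addr0 => /eqP; rewrite eq_sym oner_eq0.
Qed.

Lemma tv_eigen (s x y r t : R) : tv s x y *m dir t = r *: dir t -> r = 1.
Proof.
rewrite mx2_dir => /matrixP h; have := h 0 0; have := h 1 0; rewrite !mxE /= => e1 e2.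
have f1 : s * x * (x * cos t - y * sin t) = (r - 1) * sin t by lra.
have f2 : s * y * (x * cos t - y * sin t) = (r - 1) * cos t by lra.
have : (r - 1) * (x * cos t - y * sin t) = 0.
  have -> : (r - 1) * (x * cos t - y * sin t) = x * ((r - 1) * cos t) - y * ((r - 1) * sin t) by ring.
  by rewrite -f1 -f2; ring.
move/eqP; rewrite mulf_eq0 subr_eq0 => /orP[/eqP //|/eqP c0].
rewrite c0 !mulr0 in f1 f2; have : (r - 1) * (cos t ^+ 2 + sin t ^+ 2) = 0.
  have -> : (r - 1) * (cos t ^+ 2 + sin t ^+ 2) = (r - 1) * cos t * cos t + (r - 1) * sin t * sin t by ring.
  by rewrite -f1 -f2 !mul0r addr0.
by rewrite cos2Dsin2 mulr1; lra.
Qed.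

(** The factor [r] is a continuous function of the angle that never vanishes, and at the fixed angle
    of [f] it is an eigenvalue of a unipotent matrix, hence 1. Trace 2 lifts thus correspond to
    lifts with fixed points. *)
Lemma parabolic_lift_pos (A : SL2) f t : parabolic_lift (\pi_PSL2 A) f -> \tr (val A) = 2 ->
  exists2 r, 0 < r & val A *m dir t = r *: dir (f t).
Proof.
move=> [[cf lf] [t0 ft0]] trA.
have {}lf u : exists r, val A *m dir u = r *: dir (f u).
  have [r er] := lf u.
  have /pi_PSL2P[e|e] : \pi_PSL2 (repr (\pi_PSL2 A)) = \pi_PSL2 A by rewrite reprK.
    by exists r; rewrite -er e.
  by exists (- r); rewrite scaleNr -er e mulNmx opprK.
pose D u := (val A *m dir u) 0 0 * sin (f u) + (val A *m dir u) 1 0 * cos (f u).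
have DE u : val A *m dir u = D u *: dir (f u).
  have [r er] := lf u; rewrite er; congr (_ *: _); rewrite /D er !mxE /=.
  by rewrite -[LHS]mulr1 -(cos2Dsin2 (f u)); ring.
have cD : continuous D.
  have -> : D = (fun u => (val A 0 0 * sin u + val A 0 1 * cos u) * sin (f u) +
      (val A 1 0 * sin u + val A 1 1 * cos u) * cos (f u)).
    by apply/funext => u; rewrite /D [in LHS](mx2_eta (val A)) mx2_dir !mxE.
  have cc (c : R) : continuous (fun _ : R => c) by move=> ?; exact: cvg_cst.
  have cs := @continuous_sin R; have cC := @continuous_cos R.
  by apply: add_continuous; apply: mul_continuous;
    try (by apply: add_continuous; apply: mul_continuous); exact: (comp_continuous cf).
exists (D t) => //; apply: (@continuous_nonzero_pos D t0) => //.
  move=> u; apply/eqP => D0; apply: (@dir_neq0 u).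
  by rewrite -[LHS]mul1mx -(mulVmx (SL2_unit A)) -mulmxA DE D0 scale0r mulmx0.
have [s [x [y eA]]] := trace2_tv (SL2_det A) trA.
have e0 := DE t0; rewrite ft0 eA in e0.
by rewrite (tv_eigen e0).
Qed.

Lemma c1c2c3c4 : (c1 R * c2 R * c3 R * c4 R = 1)%g.
Proof.
rewrite -[c1 R]hol_rep_kappa -[c2 R]hol_rep_kappa -[c3 R]hol_rep_kappa -[c4 R]hol_rep_kappa.
by rewrite hol_c1 hol_c2 hol_c3 hol_c4 !mulgA !mulgVK mulgV.
Qed.

(** The product is [1] or [-1] because [c1 * c2 * c3 * c4 = 1]. By [parabolic_lift_pos] it moves the
    vector at angle 0 to a positive multiple of the one at angle [e * pi], which is opposite when
    [e] is odd. *)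
Lemma euler_relation (rho : rep R) (e : int) (A1 A2 A3 A4 : SL2) : e = 1 \/ e = -1 ->
  relative_euler_class rho e ->
  rho (c1 R) = \pi_PSL2 A1 -> rho (c2 R) = \pi_PSL2 A2 ->
  rho (c3 R) = \pi_PSL2 A3 -> rho (c4 R) = \pi_PSL2 A4 ->
  \tr (val A1) = 2 -> \tr (val A2) = 2 -> \tr (val A3) = 2 -> \tr (val A4) = 2 ->
  val A1 *m val A2 *m val A3 *m val A4 = - 1%:M.
Proof.
move=> e1 [f1 [f2 [f3 [f4 [L1 L2 L3 L4 hf]]]]] r1 r2 r3 r4 t1 t2 t3 t4.
have : \pi_PSL2 (sl2_mul (sl2_mul (sl2_mul A1 A2) A3) A4) = \pi_PSL2 (sl2_one R).
  by rewrite -(pi_mulg _ A4) -(pi_mulg _ A3) -(pi_mulg A1) -r1 -r2 -r3 -r4 -!gmulfM c1c2c3c4 mult1.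
case/pi_PSL2P => //= eI; exfalso.
rewrite r1 in L1; rewrite r2 in L2; rewrite r3 in L3; rewrite r4 in L4.
have [s4 p4 d4] := parabolic_lift_pos 0 L4 t4.
have [s3 p3 d3] := parabolic_lift_pos (f4 0) L3 t3.
have [s2 p2 d2] := parabolic_lift_pos (f3 (f4 0)) L2 t2.
have [s1 p1 d1] := parabolic_lift_pos (f2 (f3 (f4 0))) L1 t1.
have : 1%:M *m dir (0 : R) = (s4 * s3 * s2 * s1) *: dir (e%:~R * pi).
  by rewrite -eI -!mulmxA d4 -!scalemxAr d3 -!scalemxAr d2 -!scalemxAr d1 !scalerA hf add0r.
rewrite mul1mx => /matrixP/(_ 1 0); rewrite !mxE /= cos0.
have -> : cos (e%:~R * pi) = -1 :> R.
  by case: e1 => ->; rewrite ?mulN1r ?cosN ?mul1r cospi.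
have : 0 < s4 * s3 * s2 * s1 by rewrite !mulr_gt0.
lra.
Qed.

End lifts.

(** * Geometric loops: the generators and the product [c1 * c2] *)

Section petals.
Variable R : realType.
Local Notation I := (unit_itv R).
Local Notation bp := (basepoint R).
Local Notation pi1 := (pi1 R bp).
Local Notation kappa := (@kappa R).

Lemma petal_peripheral (m w : R) (mw : petal_ok m w) (b : I -> sphere4 R) : puncture_circle b -> continuous b ->
  \pi_pi1 (petal mw) = hol kappa b -> peripheral (loop_fun (petal mw)).
Proof.
move=> pb cb e; exists b => //; apply: (@free_of_conj R _ b 1%g) => //.
- exact: loop_continuous.
- by rewrite loop0 loop1.
- exact: circle_closed.
- by rewrite -hol_pi conjg1.
Qed.

Lemma generators_parabolic (rho : rep R) : type_preserving rho ->
  [/\ parabolic (rho (c1 R)), parabolic (rho (c2 R)), parabolic (rho (c3 R)) & parabolic (rho (c4 R))].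
Proof.
move=> tp; have P1 : 1 = 1 :> R \/ 1 = -1 :> R by left.
have P2 : -1 = 1 :> R \/ -1 = -1 :> R by right.
have [b1 [p1 q1 h1]] := @circle_exists R 2 1 isT P1.
have [b2 [p2 q2 h2]] := @circle_exists R 1 1 isT P1.
have [b3 [p3 q3 h3]] := @circle_exists R 0 1 isT P1.
have [b4 [p4 q4 h4]] := @big_circle_exists R (-1) P2.
have N1 : (-1 == 1 :> R) = false by apply/eqP; lra.
split; apply: tp.
- by apply: (petal_peripheral p1) => //; rewrite h1 eqxx -[LHS]hol_rep_kappa hol_c1.
- by apply: (petal_peripheral p2) => //; rewrite h2 eqxx -[LHS]hol_rep_kappa hol_c2.
- by apply: (petal_peripheral p3) => //; rewrite h3 eqxx -[LHS]hol_rep_kappa hol_c3.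
- by apply: (petal_peripheral p4) => //; rewrite h4 N1 -[LHS]hol_rep_kappa hol_c4 invgF.
Qed.

(** This petal sweeps the directions from 3/2 to -1/2 and so surrounds the punctures [(1, 0)] and
    [(0, 0)], but not [(-1, 0)]. *)
Lemma petal_ok12 : petal_ok (2^-1 : R) 1.
Proof. by split; apply/eqP; lra. Qed.

Local Notation g := (loop_fun (petal petal_ok12)).

Lemma hol_petal12 (G : groupType) (k : nat -> G) : hol k g = (k 3 / k 1%N)%g.
Proof.
apply: hol_petal => // r hr; rewrite /chart /petal_fun /=.
  by have := petal_height (or_introl hr); move: (8 * r * (1 - r)) => s hs; nra.
by have := petal_height (or_intror hr); move: (8 * r * (1 - r)) => s hs; nra.
Qed.

Lemma petal12E : \pi_pi1 (petal petal_ok12) = (c1 R * c2 R)%g.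
Proof.
rewrite hol_pi hol_petal12 -[c1 R]hol_rep_kappa -[c2 R]hol_rep_kappa hol_c1 hol_c2.
by rewrite mulgA mulgVK.
Qed.

Lemma petal_simple (m w : R) (mw : petal_ok m w) : w != 0 -> simple_closed_curve (loop_fun (petal mw)).
Proof.
move=> w0; split; [exact: loop_continuous|by rewrite loop0 loop1|].
move=> s t /(congr1 val) e; have {}e : petal_fun m w (val s) = petal_fun m w (val t) := e.
have v0 (u : I) : val u = 0 -> u = zero by move=> u0; apply: val_inj; rewrite u0 val_zero.
have v1 (u : I) : val u = 1 -> u = one by move=> u0; apply: val_inj; rewrite u0 val_one.
have inj (a b : I) : val a = val b -> a = b by exact: val_inj.
case: e => e1 e2; move: (inj s t) (v0 s) (v0 t) (v1 s) (v1 t) e1 e2; rewrite /=; move: (sval s) (sval t) => a b.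
move=> iab a0 b0 a1 b1 e1 e2.
have : (a - b) * (1 - a - b) = 0 by rewrite (_ : _ * _ = (8 * a * (1 - a) - 1 - (8 * b * (1 - b) - 1)) / 8); [rewrite e2 subrr mul0r|field].
move/eqP; rewrite mulf_eq0 subr_eq0 => /orP[/eqP ab|/eqP ab]; first by constructor 1; exact: iab.
have {}ab : b = 1 - a by lra.
rewrite ab in e1.
have : w * (a * (1 - a) * (1 - 2 * a)) = 0 by lra.
move/eqP; rewrite !mulf_eq0 (negbTE w0) /= => /orP[/orP[]|] /eqP h.
- by constructor 2; split; [exact: a0|apply: b1; lra].
- by constructor 3; split; [apply: a1; lra|apply: b0; lra].
- by constructor 1; apply: iab; lra.
Qed.

Lemma abelian_conj (a b : intg) : (a ^ b)%g = a.
Proof. by rewrite conjgE !intgM intgV; ring. Qed.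

(** The peripheral holonomies are 1, 2, 4 and 7 up to sign, whereas the petal around two punctures
    has holonomy 6; this shows that it is neither null-homotopic nor peripheral. *)
Definition test_label (j : nat) : intg := match j with 0 => 0 | 1 => 1 | 2 => 3 | _ => 7 end.

Lemma petal12_hyperbolic (rho : rep R) : simple_hyperbolic rho -> hyperbolic (rho (c1 R * c2 R)%g).
Proof.
move=> sh; rewrite -petal12E; apply: (sh g).
- by apply: petal_simple; rewrite oner_neq0.
- by move=> [x /(hol_free test_label)[h]]; rewrite hol_const hol_petal12 conj1g.
- move=> [b pb /(hol_free test_label)[h]]; rewrite hol_petal12 abelian_conj.
  case: (hol_circle test_label pb) => [[[|[|[|//]]] _ []]|[]] ->; by [].
- exists (g \o snd); split=> //=.
    exact: comp_continuous (@snd_continuous _ _) (@loop_continuous _ _ _ _).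
  by move=> s; exact: (etrans (loop0 (petal petal_ok12)) (esym (loop1 (petal petal_ok12)))).
Qed.

End petals.

(** * Trace identities, descent, and the absence of Fuchsian representations *)

Section traces.
Variable R : realType.
Implicit Types A B C : 'M[R]_2.

Definition unip A := \det A = 1 /\ \tr A = 2.

Lemma unip_tv A : unip A -> exists s x y, A = tv s x y.
Proof. by case; exact: trace2_tv. Qed.

Lemma tv_inv (s x y : R) : invmx (tv s x y) = tv (- s) x y.
Proof.
have d := tv_det s x y; rewrite /tv mx2_det in d; rewrite /tv mx2_adj //.
by congr mx2; ring.
Qed.

(** By [tv_trM] the traces are [2 - p], [2 - q], [2 - r]. The trace of the triple product adds a
    term [w], the product of the three strengths and the three wedges, with [w ^+ 2 = p * q * r];
    eliminating [w] gives the cubic. *)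
Lemma cayley_cubic A B C : unip A -> unip B -> unip C -> \tr (A *m B *m C) = -2 ->
  \tr (A *m B) ^+ 2 + \tr (B *m C) ^+ 2 + \tr (A *m C) ^+ 2 +
  \tr (A *m B) * \tr (B *m C) * \tr (A *m C) = 4.
Proof.
move=> /unip_tv[s1 [x1 [y1 ->]]] /unip_tv[s2 [x2 [y2 ->]]] /unip_tv[s3 [x3 [y3 ->]]].
rewrite !tv_trM !mx2M mx2_tr => h.
set p := s1 * s2 * _; set q := s2 * s3 * _; set r := s1 * s3 * _.
pose w := s1 * s2 * s3 * (x2 * y1 - y2 * x1) * (x3 * y2 - y3 * x2) * (x3 * y1 - y3 * x1).
have e1 : 2 - p - q - r + w = -2 \/ 2 - p - q - r - w = -2.
  by first [left; rewrite -h /p /q /r /w; ring | right; rewrite -h /p /q /r /w; ring].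
have e2 : w ^+ 2 = p * q * r by rewrite /w /p /q /r; ring.
have e3 : w ^+ 2 = (p + q + r - 4) ^+ 2.
  by case: e1 => e1; [have -> : w = p + q + r - 4 by lra|have -> : w = - (p + q + r - 4) by lra]; ring.
have -> : 4 = 4 + ((p + q + r - 4) ^+ 2 - p * q * r) by rewrite -e3 e2; ring.
by ring.
Qed.

(** The cubic is quadratic in [tr (A C)], and the right-hand side is its other root. The triple
    [(A, B C B^-1, B)] has the same product as [(A, B, C)], which makes this a change of generators;
    [vieta1] and [vieta2] do the same for the other two traces. *)
Lemma vieta3 A B C : unip A -> unip B -> unip C -> \tr (A *m B *m C) = -2 ->
  \tr (A *m (B *m C *m invmx B)) = - \tr (A *m C) - \tr (A *m B) * \tr (B *m C).
Proof.
move=> /unip_tv[s1 [x1 [y1 ->]]] /unip_tv[s2 [x2 [y2 ->]]] /unip_tv[s3 [x3 [y3 ->]]] h.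
rewrite tv_conj !tv_trM; apply/eqP; rewrite -subr_eq0; apply/eqP.
transitivity (2 * (\tr (tv s1 x1 y1 *m tv s2 x2 y2 *m tv s3 x3 y3) + 2)); last by rewrite h; ring.
by rewrite !mx2M mx2_tr; ring.
Qed.

Lemma vieta1 A B C : unip A -> unip B -> unip C -> \tr (A *m B *m C) = -2 ->
  \tr (A *m (invmx C *m B *m C)) = - \tr (A *m B) - \tr (B *m C) * \tr (A *m C).
Proof.
move=> /unip_tv[s1 [x1 [y1 ->]]] /unip_tv[s2 [x2 [y2 ->]]] /unip_tv[s3 [x3 [y3 ->]]] h.
rewrite tv_inv -{2}(opprK s3) -(tv_inv (- s3)) tv_conj !tv_trM; apply/eqP; rewrite -subr_eq0; apply/eqP.
transitivity (2 * (\tr (tv s1 x1 y1 *m tv s2 x2 y2 *m tv s3 x3 y3) + 2)); last by rewrite h; ring.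
by rewrite !mx2M mx2_tr; ring.
Qed.

Lemma vieta2 A B C : unip A -> unip B -> unip C -> \tr (A *m B *m C) = -2 ->
  \tr (A *m B *m invmx A *m C) = - \tr (B *m C) - \tr (A *m B) * \tr (A *m C).
Proof.
move=> /unip_tv[s1 [x1 [y1 ->]]] /unip_tv[s2 [x2 [y2 ->]]] /unip_tv[s3 [x3 [y3 ->]]] h.
rewrite tv_conj !tv_trM; apply/eqP; rewrite -subr_eq0; apply/eqP.
transitivity (2 * (\tr (tv s1 x1 y1 *m tv s2 x2 y2 *m tv s3 x3 y3) + 2)); last by rewrite h; ring.
by rewrite !mx2M mx2_tr; ring.
Qed.

(** As a quadratic in [z] the equation has discriminant [(x^2 - 4) (y^2 - 4)], which must be
    non-negative. *)
Lemma cubic_ge2 (x y z : R) : x ^+ 2 + y ^+ 2 + z ^+ 2 + x * y * z = 4 -> 2 < `|x| -> 2 <= `|y|.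
Proof.
move=> h x2; rewrite -(@ler_pXn2r _ 2) ?nnegrE // real_normK ?num_real //.
have {}x2 : 4 < x ^+ 2 by rewrite -[x ^+ 2]real_normK ?num_real //; nra.
have : 0 <= (2 * z + x * y) ^+ 2 by exact: sqr_ge0.
have -> : (2 * z + x * y) ^+ 2 = (x ^+ 2 - 4) * (y ^+ 2 - 4).
  have -> : (2 * z + x * y) ^+ 2 = 4 * (x ^+ 2 + y ^+ 2 + z ^+ 2 + x * y * z) - 4 * x ^+ 2 - 4 * y ^+ 2 + x ^+ 2 * y ^+ 2 by ring.
  by rewrite h; ring.
rewrite pmulr_rge0; lra.
Qed.

(** The roots [c] and [a b - c] differ by the square root of [(a^2 - 4) (b^2 - 4)], which is at
    least 5. If [c] were the smaller root, then with [b <= a <= c] the quadratic would be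
    non-negative at [a], but its value there is [(b - 2) (b + 2 - a^2) < 0]. *)
Lemma descent_pos (a b c : R) : 3 <= a -> 3 <= b -> 3 <= c -> a <= c -> b <= c ->
  a ^+ 2 + b ^+ 2 + c ^+ 2 - a * b * c = 4 -> a * b - c <= c - 5.
Proof.
wlog ab : a b / b <= a.
  move=> H a3 b3 c3 ac bc h; have [ba|/ltW ab] := lerP b a; first exact: H.
  by rewrite [a * b]mulrC; apply: H => //; rewrite -h; ring.
move=> a3 b3 c3 ac bc h; rewrite leNgt; apply/negP => hc.
have key : (2 * c - a * b) ^+ 2 = (a ^+ 2 - 4) * (b ^+ 2 - 4).
  have -> : (2 * c - a * b) ^+ 2 = 4 * (a ^+ 2 + b ^+ 2 + c ^+ 2 - a * b * c) - 4 * a ^+ 2 - 4 * b ^+ 2 + a ^+ 2 * b ^+ 2 by ring.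
  by rewrite h; ring.
have a5 : 5 <= a ^+ 2 - 4 by nra.
have b5 : 5 <= b ^+ 2 - 4 by nra.
have k25 : 25 <= (2 * c - a * b) ^+ 2 by rewrite key; nra.
have cc : 2 * c <= a * b by nra.
have : 0 <= (a - c) * (a + c - a * b) by rewrite mulr_le0 //; lra.
have -> : (a - c) * (a + c - a * b) = (b - 2) * (b + 2 - a ^+ 2).
  have -> : (a - c) * (a + c - a * b) = 2 * a ^+ 2 + b ^+ 2 - a ^+ 2 * b - (a ^+ 2 + b ^+ 2 + c ^+ 2 - a * b * c) by ring.
  by rewrite h; ring.
have : b + 2 - a ^+ 2 < 0 by nra.
nra.
Qed.

Lemma descent_abs (x y z : R) : x ^+ 2 + y ^+ 2 + z ^+ 2 + x * y * z = 4 ->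
  3 <= `|x| -> 3 <= `|y| -> 3 <= `|z| -> `|x| <= `|z| -> `|y| <= `|z| ->
  `|- z - x * y| <= `|z| - 5.
Proof.
move=> h x3 y3 z3 xz yz.
have sx := real_normK (num_real x); have sy := real_normK (num_real y); have sz := real_normK (num_real z).
(* This sign is what turns the cubic into the one for the absolute values. *)
have neg : x * y * z < 0.
  have x9 : 9 <= x ^+ 2 by rewrite -sx; nra.
  have y9 : 9 <= y ^+ 2 by rewrite -sy; nra.
  have := sqr_ge0 z; lra.
have e1 : `|x| * `|y| * `|z| = - (x * y * z) by rewrite -!normrM ltr0_norm.
have e2 : `|- z - x * y| = `| `|x| * `|y| - `|z| |.
  rewrite -normrM; have [z0|z0|z0] := ltrgtP z 0; last by rewrite z0 mulr0 ltxx in neg.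
    have xy : 0 < x * y by nra.
    rewrite (ltr0_norm z0) (gtr0_norm xy) -normrN; congr `|_|; ring.
  have xy : x * y < 0 by nra.
  rewrite (gtr0_norm z0) (ltr0_norm xy); congr `|_|; ring.
have := @descent_pos `|x| `|y| `|z| x3 y3 z3 xz yz.
rewrite e1 sx sy sz opprK => /(_ h) d.
rewrite e2 ler_norml d andbT.
have : 0 < `|z| * (`|x| * `|y| - `|z|).
  have -> : `|z| * (`|x| * `|y| - `|z|) = `|x| * `|y| * `|z| - `|z| ^+ 2 by ring.
  rewrite e1 sz; have : 9 <= x ^+ 2 by rewrite -sx; nra.
  have := sqr_ge0 y; lra.
rewrite pmulr_rgt0; lra.
Qed.

End traces.

Section descent.
Variable R : realType.
Local Notation SL2 := (SL2 R).
Local Notation PSL2 := (PSL2 R).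
Local Notation bp := (basepoint R).
Local Notation pi1 := (pi1 R bp).

(** Existence in the universal property of a free basis is all that the descent needs: it yields
    non-commutation and is carried along the moves by solving for the old images. *)
Definition free_triple (b1 b2 b3 : pi1) : Prop := forall (G : groupType) (h1 h2 h3 : G),
  exists phi : {multiplicative pi1 -> G}, [/\ phi b1 = h1, phi b2 = h2 & phi b3 = h3].

Lemma PSL2_noncommuting : exists g h : PSL2, (g * h <> h * g)%g.
Proof.
exists (\pi_PSL2 (tvSL (1 : R) 1 0)), (\pi_PSL2 (tvSL (1 : R) 0 1)).
rewrite (pi_mulg (tvSL (1 : R) 1 0)) (pi_mulg (tvSL (1 : R) 0 1)) => /pi_PSL2P[] /=.
  by rewrite /tv !mx2M => /mx2_inj[]; lra.
by rewrite /tv !mx2M mx2N => /mx2_inj[]; lra.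
Qed.

Lemma free_triple_noncommuting b1 b2 b3 : free_triple b1 b2 b3 -> (b1 * b2 <> b2 * b1)%g.
Proof.
move=> fr e; have [g [h gh]] := PSL2_noncommuting; apply: gh.
by have [phi [<- <- _]] := fr _ g h 1%g; rewrite -!gmulfM e.
Qed.

Lemma free_c : free_triple (c1 R) (c2 R) (c3 R).
Proof.
move=> G h1 h2 h3.
pose k (j : nat) : G := match j with 0 => 1%g | 1 => h3 | 2 => (h2 * h3)%g | _ => (h1 * (h2 * h3))%g end.
exists (hol_rep k : {multiplicative pi1 -> G}); split.
- by rewrite [LHS]hol_c1 /= mulgK.
- by rewrite [LHS]hol_c2 /= mulgK.
- by rewrite [LHS]hol_c3 /= invg1 mulg1.
Qed.

Variable rho : rep R.
Hypothesis rho_discrete : discrete_rep rho.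
Hypothesis rho_inj : injective rho.

(* Generators of the fundamental group of a four-punctured sphere, with lifts
   of their images to unipotent matrices. *)
Record good (b1 b2 b3 : pi1) (B1 B2 B3 : SL2) : Prop := Good {
  good1 : rho b1 = \pi_PSL2 B1; good2 : rho b2 = \pi_PSL2 B2; good3 : rho b3 = \pi_PSL2 B3;
  tr1 : \tr (val B1) = 2; tr2 : \tr (val B2) = 2; tr3 : \tr (val B3) = 2;
  tr123 : \tr (val B1 *m val B2 *m val B3) = -2;
  good_free : free_triple b1 b2 b3 }.

Let VmK (B : SL2) (A : 'M[R]_2) : A *m invmx (val B) *m val B = A.
Proof. by rewrite -mulmxA mulVmx ?mulmx1 ?SL2_unit. Qed.

Let mVK (B : SL2) (A : 'M[R]_2) : A *m val B *m invmx (val B) = A.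
Proof. by rewrite -mulmxA mulmxV ?mulmx1 ?SL2_unit. Qed.

Lemma tr_conj (A B : SL2) : \tr (val A *m val B *m invmx (val A)) = \tr (val B).
Proof. by rewrite mxtrace_mulC mulmxA mulVmx ?mul1mx ?SL2_unit. Qed.

Lemma tr_conjV (A B : SL2) : \tr (invmx (val A) *m val B *m val A) = \tr (val B).
Proof. by rewrite mxtrace_mulC mulmxA mulmxV ?mul1mx ?SL2_unit. Qed.

(** [good_T], [good_T'] and [good_S] are braid moves: they keep the product of the three generators,
    hence also the condition on its trace, and each induces one of the three Vieta moves. *)
Lemma good_T b1 b2 b3 B1 B2 B3 : good b1 b2 b3 B1 B2 B3 ->
  good b1 (b2 * b3 / b2)%g b2 B1 (sl2_mul (sl2_mul B2 B3) (sl2_inv B2)) B2.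
Proof.
case=> r1 r2 r3 t1 t2 t3 t fr; split=> //.
- by rewrite !gmulfM multV r2 r3 pi_invg (pi_mulg B2) (pi_mulg _ (sl2_inv B2)).
- by rewrite /= tr_conj.
- by rewrite /= -mulmxA VmK mulmxA.
move=> G h1 h2 h3; have [phi [p1 p2 p3]] := fr G h1 h3 (h3^-1 * h2 * h3)%g.
by exists phi; split=> //; rewrite !gmulfM multV p2 p3 !mulgA mulgV mul1g mulgK.
Qed.

Lemma good_T' b1 b2 b3 B1 B2 B3 : good b1 b2 b3 B1 B2 B3 ->
  good b1 b3 (b3^-1 * b2 * b3)%g B1 B3 (sl2_mul (sl2_mul (sl2_inv B3) B2) B3).
Proof.
case=> r1 r2 r3 t1 t2 t3 t fr; split=> //.
- by rewrite !gmulfM multV r2 r3 pi_invg (pi_mulg _ B2) (pi_mulg _ B3).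
- by rewrite /= tr_conjV.
- by rewrite /= !mulmxA mVK.
move=> G h1 h2 h3; have [phi [p1 p2 p3]] := fr G h1 (h2 * h3 / h2)%g h2.
by exists phi; split=> //; rewrite !gmulfM multV p2 p3 !mulgA mulVg mul1g mulgVK.
Qed.

Lemma good_S b1 b2 b3 B1 B2 B3 : good b1 b2 b3 B1 B2 B3 ->
  good (b1 * b2 / b1)%g b1 b3 (sl2_mul (sl2_mul B1 B2) (sl2_inv B1)) B1 B3.
Proof.
case=> r1 r2 r3 t1 t2 t3 t fr; split=> //.
- by rewrite !gmulfM multV r1 r2 pi_invg (pi_mulg B1) (pi_mulg _ (sl2_inv B1)).
- by rewrite /= tr_conj.
- by rewrite /= VmK.
move=> G h1 h2 h3; have [phi [p1 p2 p3]] := fr G h2 (h2^-1 * h1 * h2)%g h3.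
by exists phi; split=> //; rewrite !gmulfM multV p1 p2 !mulgA mulgV mul1g mulgK.
Qed.

Lemma neg_inv_subproof (B : SL2) : \det (- invmx (val B)) = 1.
Proof. by rewrite -scaleN1r detZ det_inv SL2_det invr1 mulr1 sqrrN expr1n. Qed.

Definition neg_inv (B : SL2) : SL2 := mkSL2 (neg_inv_subproof B).

Lemma tr_inv (B : SL2) : \tr (invmx (val B)) = \tr (val B).
Proof.
have := SL2_det B; rewrite /=; move: (sval B) => M; rewrite [M]mx2_eta mx2_det => d.
by rewrite mx2_adj // !mx2_tr addrC.
Qed.

(** The four punctures play symmetric roles. The fourth generator is the inverse of the product, and
    the minus sign in its lift makes its trace 2. *)
Lemma good_cyc b1 b2 b3 B1 B2 B3 : good b1 b2 b3 B1 B2 B3 ->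
  good b2 b3 (b1 * b2 * b3)^-1%g B2 B3 (neg_inv (sl2_mul (sl2_mul B1 B2) B3)).
Proof.
case=> r1 r2 r3 t1 t2 t3 t fr; split=> //.
- rewrite multV !gmulfM r1 r2 r3 (pi_mulg B1) (pi_mulg _ B3) pi_invg.
  by apply/pi_PSL2P; right; rewrite /= opprK.
- by rewrite [LHS]raddfN /= (tr_inv (sl2_mul (sl2_mul B1 B2) B3)) /= t opprK.
- rewrite /= mulmxN raddfN /=.
  have -> : val B2 *m val B3 = invmx (val B1) *m val (sl2_mul (sl2_mul B1 B2) B3).
    by rewrite /= !mulmxA mulVmx ?mul1mx ?SL2_unit.
  by rewrite (mVK (sl2_mul (sl2_mul B1 B2) B3)) tr_inv t1.
move=> G h1 h2 h3; have [phi [p1 p2 p3]] := fr G (h1 * h2 * h3)^-1%g h1 h2.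
exists phi; split=> //; rewrite multV !gmulfM p1 p2 p3.
by rewrite !invgM !invgK !mulgA mulgVK mulVg mul1g.
Qed.

(** The other alternative in [shimizu], trace 2, would make the two unipotent matrices commute,
    whereas faithfulness keeps the free generators from commuting. *)
Lemma good_pair b1 b2 b3 B1 B2 B3 : good b1 b2 b3 B1 B2 B3 ->
  1 <= `|\tr (val B1 *m val B2) - 2|.
Proof.
case=> r1 r2 r3 t1 t2 t3 t fr.
have [||||| //] := @shimizu R (rep_image rho) B1 B2 rho_discrete _ _ _ _ t1 t2.
- by move=> _ _ [a _ <-] [b _ <-]; exists (a * b)%g => //; rewrite gmulfM.
- by move=> _ [a _ <-]; exists (a^-1)%g => //; rewrite multV.
- by exists b1.
- by exists b2.
have [s1 [x1 [y1 e1]]] := trace2_tv (SL2_det B1) t1; have [s2 [x2 [y2 e2]]] := trace2_tv (SL2_det B2) t2.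
rewrite e1 e2 => /tv_commute; rewrite -e1 -e2 => cB; exfalso.
apply: (free_triple_noncommuting fr); apply: rho_inj; rewrite !gmulfM r1 r2.
by rewrite (pi_mulg B1) (pi_mulg B2); apply/pi_PSL2P; left.
Qed.

(** The complementary pair of punctures has the opposite trace [- x], so [good_pair] keeps [x] at
    distance at least 1 from both 2 and -2. *)
Lemma good_gap b1 b2 b3 B1 B2 B3 : good b1 b2 b3 B1 B2 B3 ->
  2 <= `|\tr (val B1 *m val B2)| -> 3 <= `|\tr (val B1 *m val B2)|.
Proof.
move=> g; have := good_pair g; have := good_pair (good_cyc (good_cyc g)).
have -> : \tr (val B3 *m val (neg_inv (sl2_mul (sl2_mul B1 B2) B3))) = - \tr (val B1 *m val B2).
  rewrite /= mulmxN raddfN /=; congr (- _).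
  have -> : val B3 = invmx (val (sl2_mul B1 B2)) *m val (sl2_mul (sl2_mul B1 B2) B3).
    by rewrite /= mulmxA mulVmx ?mul1mx // (SL2_unit (sl2_mul B1 B2)).
  rewrite [in X in \tr (_ *m X)]/=.
  have -> : val B1 *m val B2 *m (invmx (val (sl2_mul B1 B2)) *m val (sl2_mul (sl2_mul B1 B2) B3)) =
    val (sl2_mul (sl2_mul B1 B2) B3) by rewrite mulmxA mulmxV ?mul1mx // (SL2_unit (sl2_mul B1 B2)).
  by rewrite mVK tr_inv.
move: (\tr _) => x h1 h2 h3; move: h1 h2 h3.
have [x0|x0] := lerP 0 x.
  by rewrite (ger0_norm x0) -opprD normrN; have [_|_] := ler0P (x - 2); lra.
by rewrite (ltr0_norm x0); have [_|_] := ler0P (- x - 2); lra.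
Qed.

Definition size123 (B1 B2 B3 : SL2) : R :=
  `|\tr (val B1 *m val B2)| + `|\tr (val B2 *m val B3)| + `|\tr (val B1 *m val B3)|.

Lemma good_all b1 b2 b3 B1 B2 B3 : good b1 b2 b3 B1 B2 B3 ->
  [\/ 2 < `|\tr (val B1 *m val B2)|, 2 < `|\tr (val B2 *m val B3)| | 2 < `|\tr (val B1 *m val B3)|] ->
  [/\ 3 <= `|\tr (val B1 *m val B2)|, 3 <= `|\tr (val B2 *m val B3)| & 3 <= `|\tr (val B1 *m val B3)|].
Proof.
move=> g; have gx := good_gap g; have gy := good_gap (good_cyc g); have gz := good_gap (good_T' g).
have cub := @cayley_cubic R (val B1) (val B2) (val B3) (conj (SL2_det B1) (tr1 g)) (conj (SL2_det B2) (tr2 g))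
  (conj (SL2_det B3) (tr3 g)) (tr123 g).
move: gx gy gz cub; move: (\tr _) (\tr _) (\tr _) => z y x gx gy gz cub h.
have [hx hy hz] : [/\ 2 <= `|x|, 2 <= `|y| & 2 <= `|z|].
  have cub' p q r : p ^+ 2 + q ^+ 2 + r ^+ 2 + p * q * r = x ^+ 2 + y ^+ 2 + z ^+ 2 + x * y * z ->
      2 < `|p| -> 2 <= `|q| by rewrite cub; exact: cubic_ge2.
  case: h => h; split; try exact: ltW.
  - by apply: (cub' x y z _ h).
  - by apply: (cub' x z y _ h); ring.
  - by apply: (cub' y x z _ h); ring.
  - by apply: (cub' y z x _ h); ring.
  - by apply: (cub' z x y _ h); ring.
  - by apply: (cub' z y x _ h); ring.
by split; [exact: gx|exact: gy|exact: gz].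
Qed.

(** Infinite descent written as an induction: a move lowers the size by at least 5, and the new
    triple has size at least [n]. The hypothesis persists because all three traces have absolute
    value at least 3 and the move changes only one of them. *)
Lemma good_size_ge (n : nat) b1 b2 b3 B1 B2 B3 : good b1 b2 b3 B1 B2 B3 ->
  [\/ 2 < `|\tr (val B1 *m val B2)|, 2 < `|\tr (val B2 *m val B3)| | 2 < `|\tr (val B1 *m val B3)|] ->
  n%:R <= size123 B1 B2 B3.
Proof.
elim: n b1 b2 b3 B1 B2 B3 => [|n IH] b1 b2 b3 B1 B2 B3 g big.
  by rewrite /size123 !addr_ge0.
have [x3 y3 z3] := good_all g big.
have u1 := conj (SL2_det B1) (tr1 g); have u2 := conj (SL2_det B2) (tr2 g); have u3 := conj (SL2_det B3) (tr3 g).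
have cub := @cayley_cubic R (val B1) (val B2) (val B3) u1 u2 u3 (tr123 g).
have e1 := vieta1 u1 u2 u3 (tr123 g); have e2 := vieta2 u1 u2 u3 (tr123 g); have e3 := vieta3 u1 u2 u3 (tr123 g).
have := IH _ _ _ _ _ _ (good_T g); have := IH _ _ _ _ _ _ (good_T' g); have := IH _ _ _ _ _ _ (good_S g).
have y' : \tr (val B2 *m val B3 *m invmx (val B2) *m val B2) = \tr (val B2 *m val B3) by rewrite VmK.
have y'' : \tr (val B3 *m (invmx (val B3) *m val B2 *m val B3)) = \tr (val B2 *m val B3).
  by rewrite !mulmxA mulmxV ?mul1mx ?SL2_unit.
have x' : \tr (val B1 *m val B2 *m invmx (val B1) *m val B1) = \tr (val B1 *m val B2) by rewrite VmK.
rewrite /size123 /= y' y'' x' e1 e2 e3; move: cub x3 y3 z3; clear.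
move: (\tr _) (\tr _) (\tr _) => z y x cub x3 y3 z3 hS hT' hT.
have b2 (u : R) : 3 <= `|u| -> 2 < `|u| by lra.
have natS : n.+1%:R = n%:R + 1 :> R by rewrite -natr1.
(* The move is chosen to change the trace of largest absolute value: [good_T] changes [z], [good_S]
   changes [y], and [good_T'] changes [x]. *)
rewrite natS; have [xz|zx] := lerP `|x| `|z|.
  have [yz|zy] := lerP `|y| `|z|.
    have := descent_abs cub x3 y3 z3 xz yz.
    have := hT (Or32 _ _ (b2 _ y3)); lra.
  have c2 : x ^+ 2 + z ^+ 2 + y ^+ 2 + x * z * y = 4 by rewrite -cub; ring.
  have := descent_abs c2 x3 z3 y3 ltac:(lra) ltac:(lra).
  have := hS (Or31 _ _ (b2 _ x3)); lra.
have [yx|xy] := lerP `|y| `|x|.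
  have c2 : y ^+ 2 + z ^+ 2 + x ^+ 2 + y * z * x = 4 by rewrite -cub; ring.
  have := descent_abs c2 y3 z3 x3 ltac:(lra) ltac:(lra).
  have := hT' (Or32 _ _ (b2 _ y3)); lra.
have c2 : x ^+ 2 + z ^+ 2 + y ^+ 2 + x * z * y = 4 by rewrite -cub; ring.
have := descent_abs c2 x3 z3 y3 ltac:(lra) ltac:(lra).
have := hS (Or31 _ _ (b2 _ x3)); lra.
Qed.

End descent.

Lemma parabolic_trace2 (R : realType) (g : PSL2 R) : parabolic g ->
  exists2 A : SL2 R, g = \pi_(PSL2 R) A & \tr (val A) = 2.
Proof.
case=> _; rewrite /psl2_abstr; case: (ger0P (\tr (val (repr g)))) => _ tr_g.
  by exists (repr g) => //; rewrite reprK.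
have d : \det (- val (repr g)) = 1 by rewrite -scaleN1r detZ SL2_det mulr1 sqrrN expr1n.
exists (mkSL2 d); last by rewrite /= raddfN.
by rewrite -[LHS]reprK; apply/pi_PSL2P; right; rewrite /= opprK.
Qed.

Theorem not_fuchsian (R : realType) (e : int) (rho : rep R) : e = 1 \/ e = -1 ->
  type_preserving rho -> relative_euler_class rho e -> simple_hyperbolic rho -> ~ fuchsian rho.
Proof.
move=> e1 tp ee sh [dr ir].
have [p1 p2 p3 p4] := generators_parabolic tp.
have [A1 r1 t1] := parabolic_trace2 p1; have [A2 r2 t2] := parabolic_trace2 p2.
have [A3 r3 t3] := parabolic_trace2 p3; have [A4 r4 t4] := parabolic_trace2 p4.
have rel := euler_relation e1 ee r1 r2 r3 r4 t1 t2 t3 t4.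
have t123 : \tr (val A1 *m val A2 *m val A3) = -2.
  rewrite -t4 -tr_inv -raddfN; congr (\tr _).
  rewrite -[LHS]mulmx1 -(mulmxV (SL2_unit A4)) mulmxA rel mulNmx mul1mx //.
have g := Good r1 r2 r3 t1 t2 t3 t123 (@free_c R).
have h12 : 2 < `|\tr (val A1 *m val A2)|.
  by have := petal12_hyperbolic sh; rewrite /hyperbolic gmulfM r1 r2 (pi_mulg A1) psl2_abstr_pi.
have := good_size_ge dr ir (Num.bound (size123 A1 A2 A3)) g (Or31 _ _ h12).
by rewrite leNgt archi_boundP // /size123 !addr_ge0.
Qed.

Theorem theorem1p1 (R : realType) (e : int) (he : e = 1 \/ e = -1) :
  let X : set (rep R) :=
    [set rho | [/\ non_elementary rho, type_preserving rho,
                   relative_euler_class rho e & simple_hyperbolic rho]] in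
  ~ countable [set conjugacy_class rho | rho in X] /\
  (forall rho, X rho -> ~ fuchsian rho).
Proof.
move=> X; split; first exact: uncountable_classes.
by move=> rho [_ tp ee sh]; exact: not_fuchsian ee sh.
Qed.
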